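(* Let $(\mathcal{A},H,D,\sigma)$ be a Lipschitz regular weakly twisted spectral triple such that $D$ has compact resolvent. Define the self-adjoint operator $$D_{\log}:=\operatorname{sgnlog}(D)=D|D|^{-1}\log(1+|D|).$$ Then $(\mathcal{A},H,D_{\log})$ is a spectral triple defining the same class in $K$-homology as $(\mathcal{A},H,D,\sigma)$. The weakly twisted spectral triple $(\mathcal{A},H,D,\sigma)$ is finitely summable if and only if the spectral triple $(\mathcal{A},H,D_{\log})$ is $\mathrm{Li}_1$-summable.
   Context: A weakly twisted spectral triple $(\mathcal{A},H,D,\sigma)$ consists of a Hilbert space $H$, a $*$-subalgebra $\mathcal{A}\subset\mathbb{B}(H)$, a densely defined self-adjoint operator $D$ on $H$, and a partially defined automorphism $\sigma$ of $\mathbb{B}(H)$ (a multiplicative linear map $\sigma:\operatorname{Dom}(\sigma)\to\mathbb{B}(H)$ defined on a, possibly proper, $*$-subalgebra $\operatorname{Dom}(\sigma)\subseteq\mathbb{B}(H)$ and regular in the sense that $\sigma(a)^*=\sigma^{-1}(a^* )$) with $\mathcal{A}\subseteq\operatorname{Dom}(\sigma)$, such that for all $a\in\mathcal{A}$: (1) $a\operatorname{Dom}(D)\subset\operatorname{Dom}(D)$ and the twisted commutator $[D,a]_\sigma:=Da-\sigma(a)D$ is bounded; (2) $a(1+D^2)^{-1/2}$ is compact. It may be odd (no grading) or even (there is $\gamma=\gamma^*$, $\gamma^2=1$, anticommuting with $D$ and commuting with $\mathcal{A}$). It is Lipschitz regular if $[|D|,a]_\sigma:=|D|a-\sigma(a)|D|$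 is bounded for all $a\in\mathcal{A}$. A spectral triple $(\mathcal{A},H,D)$ is the case of trivial twist $\sigma(a)=a$. The function $\operatorname{sgnlog}:\mathbb{R}\to\mathbb{R}$ is $\operatorname{sgnlog}(x)=\operatorname{sgn}(x)\log(1+|x|)$, a $C^1$-function, so $\operatorname{sgnlog}(D)$ is defined by functional calculus also if $D$ is not invertible. The $K$-homology class of a Lipschitz regular weakly twisted spectral triple with compact resolvent, or of a spectral triple, is the class of the Fredholm module $(A,H,\chi(D))$, $A$ the $C^*$-closure of $\mathcal{A}$, where $\chi$ is any normalising function, i.e. $\chi:\mathbb{R}\to\mathbb{R}$ is continuous on the spectrum of $D$, odd and $\lim_{x\to\pm\infty}\chi(x)=\pm1$ (e.g. $\chi(x)=x(1+x^2)^{-1/2}$). $(\mathcal{A},H,D,\sigma)$ is finitely summable if there is $p>0$ with $(i+D)^{-1}$ in the Schatten ideal $\mathcal{L}^p(H)$. A spectral triple $(\mathcal{A},H,D')$ is $\mathrm{Li}_1$-summable if $\operatorname{Tr}(\mathrm{e}^{-s|D'|})<\infty$ for large enough $s>0$. *)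

(* Defs.v *)
From HB Require Import structures.
From mathcomp Require Import all_boot all_order all_algebra complex.
From mathcomp Require Import all_classical all_reals all_analysis.

Set Implicit Arguments.
Unset Strict Implicit.
Unset Printing Implicit Defensive.

Import Order.TTheory GRing.Theory Num.Theory.
Import numFieldNormedType.Exports.
Local Open Scope classical_set_scope.
Local Open Scope ring_scope.

(* Complex Hilbert spaces; the inner product is linear in its first argument.
   Norms take values in R[i], as in any normedModType R[i]. *)
Record hilbert (R : realType) := Hilbert {
  hsort :> completeNormedModType R[i];
  inner : {dot hsort for Num.conj};
  inner_norm : forall x : hsort, inner x x = `|x| ^+ 2
}.
Arguments inner {R h}.

Section BoundedOperators.
Context {R : realType}.
Implicit Types H K : hilbert R.

Definition bounded_op H K (T : H -> K) : Prop :=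
  linear T /\ exists M : R[i], forall x, `|T x| <= M * `|x|.

Definition compact_op H K (T : H -> K) : Prop :=
  linear T /\ precompact (T @` [set x | `|x| <= 1]).

(* S = T^*, for everywhere defined T. *)
Definition is_adjoint H K (T : H -> K) (S : K -> H) : Prop :=
  forall x y, inner (T x) y = inner x (S y).

Definition star_subalgebra H (A : set (H -> H)) : Prop :=
  [/\ A `<=` @bounded_op H H,
      A 0,
      forall (c : R[i]) a b, A a -> A b -> A (c *: a + b),
      forall a b, A a -> A b -> A (a \o b) &
      forall a, A a -> exists2 b, A b & is_adjoint a b].

(* The closure in the operator norm. *)
Definition cstar_closure H (A : set (H -> H)) : set (H -> H) :=
  [set T | bounded_op T /\ forall e : R, 0 < e ->
     exists2 a, A a & forall x, `|T x - a x| <= e%:C%C * `|x|].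

End BoundedOperators.

Section UnboundedOperators.
Context {R : realType}.

(* A partially defined operator. The values of app outside dom are junk. *)
Record op (H : hilbert R) := Op { dom : set H; app :> H -> H }.

HB.instance Definition _ (H : hilbert R) := gen_eqMixin (op H).
HB.instance Definition _ (H : hilbert R) := gen_choiceMixin (op H).

Context {H : hilbert R}.
Implicit Types (D T : op H) (z : R[i]).

Definition op_linear T : Prop :=
  dom T 0 /\ forall (c : R[i]) x y, dom T x -> dom T y ->
    dom T (c *: x + y) /\ T (c *: x + y) = c *: T x + T y.

(* The last condition is D^* = D: the pairs (y, z) with <D x, y> = <x, z> for
   all x in dom D form the graph of D^*. *)
Definition self_adjoint D : Prop :=
  [/\ op_linear D, dense (dom D) &
      forall y z : H, (forall x, dom D x -> inner (D x) y = inner x z) <->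
                      (dom D y /\ D y = z)].

(* S is the bounded everywhere defined operator (D - z)^-1. *)
Definition is_resolvent D z (S : H -> H) : Prop :=
  [/\ bounded_op S,
      forall x, dom D (S x) /\ D (S x) - z *: S x = x &
      forall x, dom D x -> S (D x - z *: x) = x].

(* The spectrum intersected with the real line; this is the whole spectrum if D
   is self-adjoint. *)
Definition spectrum D : set R :=
  [set l | ~ exists S, is_resolvent D l%:C%C S].

(* (i + D)^-1 is compact. *)
Definition compact_resolvent D : Prop :=
  exists2 S, is_resolvent D (- 'i%C) S & compact_op S.

End UnboundedOperators.

Section FunctionalCalculus.
Context {R : realType} {H : hilbert R}.
Implicit Types (E : set (measurableTypeR R) -> H -> H) (D T : op H).

Definition scalar_measure E (x : H) (B : set (measurableTypeR R)) : \bar R :=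
  (complex.Re (inner (E B x) x))%:E.

Definition projection_valued_measure E : Prop :=
  [/\ forall B, measurable B ->
        [/\ bounded_op (E B), is_adjoint (E B) (E B) & E B \o E B = E B],
      E setT = idfun,
      forall B C, measurable B -> measurable C -> E (B `&` C) = E B \o E C &
      forall x, semi_sigma_additive (scalar_measure E x)].

(* T = \int_S f dE, the linear operator with domain
   { x | \int_S f^2 d<E x, x> < oo } and quadratic form
   <T x, x> = \int_S f d<E x, x>; it is unique by polarisation. *)
Definition is_spectral_integral E (S : set R) (f : R -> R) T : Prop :=
  [/\ op_linear T,
      forall x, dom T x <->
        (\int[scalar_measure E x]_(t in S) ((f t) ^+ 2)%:E < +oo)%E &
      forall x, dom T x ->
        inner (T x) x =
          (fine (\int[scalar_measure E x]_(t in S) (f t)%:E)%E)%:C%C].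

Definition is_spectral_measure E D : Prop :=
  projection_valued_measure E /\ is_spectral_integral E setT id D.

(* f(D). Integrating over the spectrum only lets f be arbitrary off it. For
   self-adjoint D a spectral measure exists by the spectral theorem, and is
   unique; the default value is never meant to be used. *)
Definition fcalc D (f : R -> R) : op H :=
  xget (Op set0 idfun)
    [set T | exists2 E, is_spectral_measure E D &
                        is_spectral_integral E (spectrum D) f T].

End FunctionalCalculus.

Section SpectralTriples.
Context {R : realType} {H : hilbert R}.
Implicit Types (A : set (H -> H)) (D : op H) (s : (H -> H) -> (H -> H)).

(* Regularity s(a)^* = s^-1(a^* ) is written as: s(a)^* is in Dom(s) and is sent
   to a^* by s. *)
Definition regular_partial_automorphism (Doms : set (H -> H)) s : Prop :=
  [/\ star_subalgebra Doms,
      forall a, Doms a -> bounded_op (s a),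
      forall (c : R[i]) a b, Doms a -> Doms b ->
        s (c *: a + b) = c *: s a + s b,
      forall a b, Doms a -> Doms b -> s (a \o b) = s a \o s b &
      {in Doms &, injective s} /\
      forall a b, Doms a -> is_adjoint a b ->
        exists c, [/\ is_adjoint (s a) c, Doms c & s c = b]].

(* D a - b D is bounded on dom D. *)
Definition bounded_twisted_commutator D (a b : H -> H) : Prop :=
  exists M : R[i], forall x, dom D x -> `|D (a x) - b (D x)| <= M * `|x|.

Definition is_grading A D (g : H -> H) : Prop :=
  [/\ bounded_op g, is_adjoint g g, g \o g = idfun,
      forall a, A a -> g \o a = a \o g &
      forall x, dom D x -> dom D (g x) /\ D (g x) = - g (D x)].

(* g = None for odd triples, g = Some gamma for even ones. *)
Record weakly_twisted_spectral_triple A D (Doms : set (H -> H)) s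
    (g : option (H -> H)) : Prop := {
  wtst_algebra : star_subalgebra A;
  wtst_self_adjoint : self_adjoint D;
  wtst_twist : regular_partial_automorphism Doms s;
  wtst_sub_twist : A `<=` Doms;
  wtst_dom : forall a x, A a -> dom D x -> dom D (a x);
  wtst_commutator : forall a, A a -> bounded_twisted_commutator D a (s a);
  wtst_compact : forall a, A a ->
    compact_op (a \o fcalc D (fun x => (Num.sqrt (1 + x ^+ 2))^-1));
  wtst_grading : if g is Some gamma then is_grading A D gamma else True
}.

Definition spectral_triple A D (g : option (H -> H)) : Prop :=
  weakly_twisted_spectral_triple A D A id g.

Definition lipschitz_regular A D s : Prop :=
  forall a, A a ->
    bounded_twisted_commutator (fcalc D (fun x => `|x|)) a (s a).

Definition sgnlog (x : R) : R := Num.sg x * ln (1 + `|x|).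

End SpectralTriples.

Section Summability.
Context {R : realType}.
Implicit Types H : hilbert R.

Definition orthonormal_basis H (B : set H) : Prop :=
  (forall e e', B e -> B e' -> inner e e' = (e == e')%:R) /\
  (forall x, (forall e, B e -> inner x e = 0) -> x = 0).

(* Only meant for positive T, for which the sum, possibly +oo, does not depend
   on the chosen basis. *)
Definition trace H (T : op H) : \bar R :=
  \esum_(e in xget set0 [set B : set H | orthonormal_basis B])
    (complex.Re (inner (T e) e))%:E.

(* Tr |T|^p < oo, where |T| = (T^* T)^(1/2). *)
Definition schatten H (p : R) (T : H -> H) : Prop :=
  bounded_op T /\
  exists2 T', is_adjoint T T' &
    (trace (fcalc (Op setT (T' \o T)) (fun x => (Num.sqrt x `^ p)%R)) < +oo)%E.

Definition finitely_summable H (D : op H) : Prop :=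
  exists2 p : R, 0 < p & exists2 S, is_resolvent D (- 'i%C) S & schatten p S.

Definition Li1_summable H (D : op H) : Prop :=
  exists s0 : R, forall s, 0 < s -> s0 <= s ->
    (trace (fcalc D (fun x => expR (- s * `|x|)%R)) < +oo)%E.

End Summability.

Section KHomology.
Context {R : realType} {H : hilbert R}.
Variable A : set (H -> H). (* a C*-algebra of operators on H *)

(* The data (rho, K, F) of a Fredholm module over A, with a grading operator
   if it is even; only the restriction of rho to A matters. *)
Record fredholm_data := Fredholm {
  fm_space : hilbert R;
  fm_rep : (H -> H) -> (fm_space -> fm_space);
  fm_op : fm_space -> fm_space;
  fm_grading : option (fm_space -> fm_space)
}.

Definition is_representation (K : hilbert R) (rho : (H -> H) -> (K -> K)) :=
  [/\ forall a, A a -> bounded_op (rho a),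
      forall (c : R[i]) a b, A a -> A b ->
        rho (c *: a + b) = c *: rho a + rho b,
      forall a b, A a -> A b -> rho (a \o b) = rho a \o rho b &
      forall a b, A a -> A b -> is_adjoint a b -> is_adjoint (rho a) (rho b)].

(* small holds of all compact operators for a Fredholm module, and only of 0
   for a degenerate one. *)
Definition fredholm_conditions (x : fredholm_data)
    (small : (fm_space x -> fm_space x) -> Prop) : Prop :=
  let rho := @fm_rep x in let F := @fm_op x in
  [/\ is_representation rho,
      bounded_op F,
      forall a, A a -> small (rho a \o ((F \o F) - idfun)),
      exists2 F', is_adjoint F F' & forall a, A a -> small (rho a \o (F - F')) &
      (forall a, A a -> small ((F \o rho a) - (rho a \o F))) /\
      (if @fm_grading x is Some g then
         [/\ bounded_op g, is_adjoint g g, g \o g = idfun,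
             forall a, A a -> g \o rho a = rho a \o g & g \o F = - (F \o g)]
       else True)].

Definition fredholm_module (x : fredholm_data) : Prop :=
  fredholm_conditions (@compact_op R (fm_space x) (fm_space x)).

Definition degenerate_module (x : fredholm_data) : Prop :=
  @fredholm_conditions x (fun T => T = 0).

Definition intertwining_isometry (x y : fredholm_data)
    (V : fm_space x -> fm_space y) : Prop :=
  [/\ linear V,
      forall u v, inner (V u) (V v) = inner u v,
      forall a, A a -> V \o fm_rep a = fm_rep a \o V,
      V \o @fm_op x = @fm_op y \o V &
      match @fm_grading x, @fm_grading y with
      | None, None => True
      | Some g, Some g' => V \o g = g' \o V
      | _, _ => False
      end].

Definition unitarily_equivalent (x y : fredholm_data) : Prop :=
  exists2 U : fm_space x -> fm_space y,
    intertwining_isometry U & range U = setT.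

(* z is, up to unitary equivalence, the direct sum of x and y. *)
Definition direct_sum (x y z : fredholm_data) : Prop :=
  exists (V : fm_space x -> fm_space z) (W : fm_space y -> fm_space z),
  [/\ intertwining_isometry V, intertwining_isometry W,
      forall u v, inner (V u) (W v) = 0 &
      forall w, exists u v, w = V u + W v].

(* Equality of classes in K-homology: the equivalence relation on Fredholm
   modules generated by unitary equivalence, operator homotopy and addition of
   degenerate modules. *)
Inductive same_K_class : fredholm_data -> fredholm_data -> Prop :=
| K_unitary x y : fredholm_module x -> fredholm_module y ->
    unitarily_equivalent x y -> same_K_class x y
| K_homotopy (K : hilbert R) (rho : (H -> H) -> (K -> K))
    (g : option (K -> K)) (F : R -> K -> K) :
    (forall t, 0 <= t <= 1 -> fredholm_module (Fredholm rho (F t) g)) ->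
    (forall t e : R, 0 <= t <= 1 -> 0 < e -> exists2 d : R, 0 < d &
       forall t', 0 <= t' <= 1 -> `|t' - t| < d ->
         forall v, `|F t' v - F t v| <= e%:C%C * `|v|) ->
    same_K_class (Fredholm rho (F 0) g) (Fredholm rho (F 1) g)
| K_degenerate x y z : fredholm_module x -> degenerate_module y ->
    fredholm_module z -> direct_sum x y z -> same_K_class x z
| K_sym x y : same_K_class x y -> same_K_class y x
| K_trans x y z : same_K_class x y -> same_K_class y z -> same_K_class x z.

End KHomology.

Section KHomologyClass.
Context {R : realType} {H : hilbert R}.

Definition normalising (D : op H) (chi : R -> R) : Prop :=
  [/\ {within spectrum D, continuous chi},
      forall x, chi (- x) = - chi x,
      chi x @[x --> +oo_R] --> (1 : R) &
      chi x @[x --> -oo_R] --> (-1 : R)].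

Definition bounded_transform (D : op H) (chi : R -> R) (g : option (H -> H)) :
    fredholm_data (H := H) :=
  Fredholm id (fcalc D chi) g.

(* The choice of chi and chi' is immaterial, so all choices are quantified. *)
Definition same_K_homology_class (A : set (H -> H)) (D D' : op H)
    (g : option (H -> H)) : Prop :=
  forall chi chi', normalising D chi -> normalising D' chi' ->
    same_K_class (cstar_closure A)
      (bounded_transform D chi g) (bounded_transform D' chi' g).

End KHomologyClass.

(* Main.v *)
Require Import Defs.
From HB Require Import structures.
From mathcomp Require Import all_boot all_order all_algebra complex.
From mathcomp Require Import all_classical all_reals all_analysis.
From mathcomp Require Import measurable_realfun.
From mathcomp Require Import ring lra.
Import Order.TTheory GRing.Theory Num.Theory.
Import numFieldNormedType.Exports.
Local Open Scope classical_set_scope.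
Local Open Scope ring_scope.

Set Implicit Arguments.
Unset Strict Implicit.
Unset Printing Implicit Defensive.

(* Compactness of (D + i)^-1 gives an orthonormal eigenbasis e_i of D, with
   eigenvalues l_i tending to infinity, and D has only one spectral measure; so
   every fcalc D f is diagonal in this basis, with eigenvalues f(l_i).

   Let F be the sign of D and Delta = 1 + |D|. The bounded operators
   D a - s(a) D and (|D| a - s(a) |D|) F differ by |D| [F, a]. Moreover
   Delta a Delta^-1 and Delta a^* Delta^-1 are bounded by Lipschitz regularity, and
     log (Delta^2) = int_0^oo ((1 + t)^-1 - (Delta^2 + t)^-1) dt,
     [(Delta^2 + t)^-1, a] = (Delta^2 + t)^-1 [a, Delta^2] (Delta^2 + t)^-1,
     int_0^oo |Delta (Delta^2 + t)^-1 x|^2 dt = |x|^2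
   yield with Cauchy-Schwarz that [log Delta, a] is bounded. The decomposition
   [D_log, a] = log(Delta) [F, a] + [log Delta, a] F then bounds the commutators
   of D_log.

   For normalising chi, both chi(D) and chi(D_log) are compact perturbations of F,
   and [F, a] is compact because it is Delta^-1 after a bounded operator; hence the
   straight line between the two is a homotopy of Fredholm modules. Finally, both
   traces are sums over the eigenvalues, and (1 + l^2)^(-p/2) is comparable to
   (1 + |l|)^-p = exp (- p |sgnlog l|). *)

(** * Norms and inner products *)

(** The twist disappears because D = |D| F: both D a x and |D| a F x are compared with sigma(a) D x
    = sigma(a) |D| F x. After that, sigma(a) enters only through its bound, in the estimate of Delta
    a Delta^-1.

    The logarithm is taken of Delta^2 and not of Delta so that one factor Delta falls on each side
    of the pairing; with Delta itself the estimate would involve Delta^(1/2) a Delta^(-1/2), hence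
    interpolation. This split is also why a^* has to be controlled together with a.

    No operator-valued integral is formed. On finite combinations of eigenvectors the integral over
    t becomes a monotone real function of t, compared at 0 and at infinity. The price is a passage
    to the limit: dom D_log may be larger than dom D, and that a preserves it is part of the claim.

    [fcalc] is a choice among all admissible operators, for functions that may be nonmeasurable. The
    eigenvalues form a countable set, on which every function is measurable; this reduces all
    spectral integrals to series. *)

Section RealNorm.
Context {R : realType}.
Local Notation C := R[i].

(** Norms take values in R[i]; their real parts live in an ordered field, where [lra] and [nra]
    apply. *)
Definition nm {V : normedZmodType C} (x : V) : R := complex.Re `|x|.

Lemma nmE {V : normedZmodType C} (x : V) : `|x| = (nm x)%:C%C.
Proof. by rewrite /nm RRe_real// normr_real. Qed.

Lemma nm_ge0 {V : normedZmodType C} (x : V) : 0 <= nm x.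
Proof. by rewrite -ler0c -nmE. Qed.

Lemma nm0 {V : normedZmodType C} : nm (0 : V) = 0.
Proof. by rewrite /nm normr0. Qed.

Lemma nm0_eq0 {V : normedZmodType C} (x : V) : nm x = 0 -> x = 0.
Proof. by move=> x0; apply: normr0_eq0; rewrite nmE x0. Qed.

Lemma nm_gt0 {V : normedZmodType C} (x : V) : (0 < nm x) = (x != 0).
Proof. by rewrite -[RHS]normr_gt0 nmE ltcR. Qed.

Lemma nmD {V : normedZmodType C} (x y : V) : nm (x + y) <= nm x + nm y.
Proof.
by have := ler_normD x y; rewrite !nmE -(rmorphD (real_complex R)) lecR.
Qed.

Lemma nmN {V : normedZmodType C} (x : V) : nm (- x) = nm x.
Proof. by rewrite /nm normrN. Qed.

Lemma nmBC {V : normedZmodType C} (x y : V) : nm (x - y) = nm (y - x).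
Proof. by rewrite -nmN opprB. Qed.

Lemma nmB {V : normedZmodType C} (x y : V) : nm (x - y) <= nm x + nm y.
Proof. by rewrite -(nmN y) nmD. Qed.

Lemma nm_triB {V : normedZmodType C} (y x z : V) :
  nm (x - z) <= nm (x - y) + nm (y - z).
Proof. by apply: le_trans (nmD _ _); rewrite addrA subrK. Qed.

Lemma nmZ {V : normedModType C} (c : C) (x : V) : nm (c *: x) = nm c * nm x.
Proof.
by apply: (@complexI R); rewrite rmorphM/= -!nmE normrZ.
Qed.

Lemma nmM (c d : C) : nm (c * d) = nm c * nm d.
Proof. by apply: (@complexI R); rewrite rmorphM/= -!nmE normrM. Qed.

Lemma nmC (r : R) : nm (r%:C%C) = `|r|.
Proof. by rewrite /nm normc_def/= expr0n/= addr0 sqrtr_sqr. Qed.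

Lemma nm_conj (c : C) : nm (Num.conj c) = nm c.
Proof. by rewrite /nm norm_conjC. Qed.

Lemma nm_sqr (c : C) : c * Num.conj c = ((nm c) ^+ 2)%:C%C.
Proof. by rewrite rmorphXn/= -nmE normCK. Qed.

Lemma nm_sqrE (c : C) : nm c ^+ 2 = complex.Re c ^+ 2 + complex.Im c ^+ 2.
Proof.
by apply: (@complexI R); rewrite rmorphXn/= -nmE -add_Re2_Im2.
Qed.

Lemma Re_le_nm (c : C) : `|complex.Re c| <= nm c.
Proof. by have := normc_ge_Re c; rewrite nmE lecR. Qed.

Lemma conjE (z : C) : Num.conj z = (complex.Re z +i* - complex.Im z)%C.
Proof. by case: z. Qed.

Lemma conj_realC (r : R) : Num.conj r%:C%C = r%:C%C :> C.
Proof. by rewrite conjE/= oppr0. Qed.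

Lemma conj_iC : Num.conj 'i%C = - 'i%C :> C.
Proof. by rewrite conjE; apply/eqP; rewrite eq_complex/= oppr0 !eqxx. Qed.

Lemma mul_iC : 'i%C * 'i%C = -1 :> C.
Proof. by rewrite -expr2 sqr_i. Qed.

Lemma ReD (x y : C) : complex.Re (x + y) = complex.Re x + complex.Re y.
Proof. by case: x y => ? ? [? ?]. Qed.

Lemma ReN (x : C) : complex.Re (- x) = - complex.Re x.
Proof. by case: x. Qed.

Lemma ReB (x y : C) : complex.Re (x - y) = complex.Re x - complex.Re y.
Proof. by rewrite ReD ReN. Qed.

Lemma Re_sum I (r : seq I) P (F : I -> C) :
  complex.Re (\sum_(i <- r | P i) F i) = \sum_(i <- r | P i) complex.Re (F i).
Proof. by elim/big_rec2: _ => // i x y _ <-; rewrite ReD. Qed.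

Lemma ReCl (r : R) (z : C) : complex.Re (r%:C%C * z) = r * complex.Re z.
Proof. by case: z => a b /=; rewrite mul0r subr0. Qed.

Lemma nm_resolvent_sqr (t : R) : nm ((t%:C + 'i)%C^-1 : C) ^+ 2 = (t ^+ 2 + 1)^-1.
Proof.
apply: (@complexI R); rewrite rmorphXn/= -nmE normfV exprVn.
by rewrite -add_Re2_Im2 /= addr0 add0r expr1n fmorphV.
Qed.

Lemma nm_sum {V : normedZmodType C} I (r : seq I) P (F : I -> V) :
  nm (\sum_(i <- r | P i) F i) <= \sum_(i <- r | P i) nm (F i).
Proof.
elim/big_rec2: _ => [|i x y _ le_yx]; first by rewrite nm0.
by rewrite (le_trans (nmD _ _))// lerD2l.
Qed.

End RealNorm.

Section InnerProduct.
Context {R : realType} {H : hilbert R}.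
Local Notation C := R[i].
Implicit Types x y z : H.

Lemma innerC x y : inner x y = Num.conj (inner y x).
Proof. by rewrite (hermC (@inner R H)) expr0 mul1r. Qed.

Lemma innerDl x y z : inner (x + y) z = inner x z + inner y z.
Proof. exact: linearDl. Qed.
Lemma innerDr x y z : inner x (y + z) = inner x y + inner x z.
Proof. exact: linearDr. Qed.
Lemma innerNl x z : inner (- x) z = - inner x z.
Proof. exact: linearNl. Qed.
Lemma innerNr x z : inner x (- z) = - inner x z.
Proof. exact: linearNr. Qed.
Lemma innerBl x y z : inner (x - y) z = inner x z - inner y z.
Proof. exact: linearBl. Qed.
Lemma innerBr x y z : inner x (y - z) = inner x y - inner x z.
Proof. exact: linearBr. Qed.
Lemma inner0l x : inner 0 x = 0 :> C.
Proof. exact: linear0l. Qed.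
Lemma inner0r x : inner x 0 = 0 :> C.
Proof. exact: linear0r. Qed.
Lemma innerZl (c : C) x y : inner (c *: x) y = c * inner x y.
Proof. exact: linearZl_LR. Qed.
Lemma innerZr (c : C) x y : inner x (c *: y) = Num.conj c * inner x y.
Proof. exact: linearZr_LR. Qed.
Lemma inner_suml I (r : seq I) P (F : I -> H) y :
  inner (\sum_(i <- r | P i) F i) y = \sum_(i <- r | P i) inner (F i) y.
Proof. by elim/big_rec2: _ => [|i a b _ <-]; rewrite ?inner0l ?innerDl. Qed.
Lemma inner_sumr I (r : seq I) P (F : I -> H) y :
  inner y (\sum_(i <- r | P i) F i) = \sum_(i <- r | P i) inner y (F i).
Proof. by elim/big_rec2: _ => [|i a b _ <-]; rewrite ?inner0r ?innerDr. Qed.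

Lemma innerE x : inner x x = (nm x ^+ 2)%:C%C.
Proof. by rewrite inner_norm nmE rmorphXn. Qed.

Lemma Re_inner x : complex.Re (inner x x) = nm x ^+ 2.
Proof. by rewrite innerE. Qed.

Lemma nm_eq0 x : inner x x = 0 -> x = 0.
Proof.
rewrite innerE => -[/eqP]; rewrite expf_eq0/= => /eqP; exact: nm0_eq0.
Qed.

Lemma Re_innerC x y : complex.Re (inner x y) = complex.Re (inner y x).
Proof. by rewrite innerC conjE. Qed.

Lemma nm_sqrD x y :
  nm (x + y) ^+ 2 = nm x ^+ 2 + nm y ^+ 2 + 2 * complex.Re (inner x y).
Proof.
rewrite -!Re_inner innerDl !innerDr !ReD (Re_innerC y x).
by ring.
Qed.

Lemma nm_sqrB x y :
  nm (x - y) ^+ 2 = nm x ^+ 2 + nm y ^+ 2 - 2 * complex.Re (inner x y).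
Proof. by rewrite nm_sqrD nmN innerNr ReN mulrN. Qed.

Lemma nm_pythagoras x y : inner x y = 0 ->
  nm (x + y) ^+ 2 = nm x ^+ 2 + nm y ^+ 2.
Proof. by move=> xy; rewrite nm_sqrD xy mulr0 addr0. Qed.

Lemma cauchy_schwarz x y : nm (inner x y) <= nm x * nm y.
Proof.
have [->|y0] := eqVneq y 0; first by rewrite inner0r !nm0 mulr0.
have ny : 0 < nm y.
  by rewrite nm_gt0.
rewrite -(@ler_sqr _ (nm (inner x y))) ?nnegrE ?mulr_ge0 ?nm_ge0//.
(* A multiple of the component of x orthogonal to y, scaled by |y|^2 to avoid division. *)
pose c : C := inner x y; pose b := nm y ^+ 2.
have b0 : 0 < b by rewrite exprn_gt0.
have : 0 <= nm (b%:C%C *: x - c *: y) ^+ 2 by rewrite exprn_ge0 ?nm_ge0.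
rewrite nm_sqrB !nmZ nmC (ger0_norm (ltW b0)) innerZl innerZr ReCl.
rewrite [Num.conj c * _]mulrC nm_sqr/= -/b !exprMn -/c -/b.
have -> : b ^+ 2 * nm x ^+ 2 + nm c ^+ 2 * b - 2 * (b * nm c ^+ 2) =
  b * (nm x ^+ 2 * b - nm c ^+ 2) by ring.
by rewrite pmulr_rge0// subr_ge0.
Qed.

Lemma Re_cauchy_schwarz x y : complex.Re (inner x y) <= nm x * nm y.
Proof.
by rewrite (le_trans (ler_norm _))// (le_trans (Re_le_nm _))// cauchy_schwarz.
Qed.

Lemma inner_ext x y : (forall z, inner x z = inner y z) -> x = y.
Proof.
by move=> xy; apply/eqP; rewrite -subr_eq0; apply/eqP/nm_eq0; rewrite innerBl xy subrr.
Qed.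

End InnerProduct.

Section Operators.
Context {R : realType}.
Local Notation C := R[i].
Implicit Types H K L : hilbert R.

Lemma bounded_opP H K (T : H -> K) :
  bounded_op T <-> linear T /\ exists M : R, 0 <= M /\ forall x, nm (T x) <= M * nm x.
Proof.
split=> [[lT [M bT]]|[lT [M [M0 bT]]]]; split=> //; last first.
  by exists M%:C%C => x; rewrite !nmE -rmorphM lecR.
(* The given bound [M] is a complex number; comparing real parts turns it into a nonnegative real
   one. *)
exists `|complex.Re M|; split=> // x.
have [->|x0] := eqVneq x 0.
  have T0 : T 0 = 0 by have := lT (-1) 0 0; rewrite scaler0 addr0 scaleN1r addNr.
  by rewrite T0 !nm0 mulr0.
have := bT x; rewrite !nmE lecE => /andP[_].
case: M {bT} => a b /=; rewrite mulr0 subr0 => /le_trans; apply.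
by rewrite ler_wpM2r ?nm_ge0// ler_norm.
Qed.

Section Linear.
Context {H K : hilbert R} (T : H -> K).
Hypothesis lT : linear T.
Lemma lin0 : T 0 = 0.
Proof. by have := lT (-1) 0 0; rewrite scaler0 addr0 scaleN1r addNr. Qed.
Lemma linZ c x : T (c *: x) = c *: T x.
Proof. by have := lT c x 0; rewrite lin0 !addr0. Qed.
Lemma linD x y : T (x + y) = T x + T y.
Proof. by have := lT 1 x y; rewrite !scale1r. Qed.
Lemma linN x : T (- x) = - T x.
Proof. by rewrite -scaleN1r linZ scaleN1r. Qed.
Lemma linB x y : T (x - y) = T x - T y.
Proof. by rewrite linD linN. Qed.
Lemma lin_sum I (r : seq I) P (F : I -> H) :
  T (\sum_(i <- r | P i) F i) = \sum_(i <- r | P i) T (F i).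
Proof. by elim/big_rec2: _ => [|i x y _ <-]; rewrite ?lin0 ?linD. Qed.
End Linear.

Lemma op_linear0 H (D : op H) : op_linear D -> D 0 = 0.
Proof.
move=> [D0 lin]; have [_] := lin 1 0 0 D0 D0; rewrite !scale1r addr0 => /eqP.
by rewrite -subr_eq0 opprD addNKr oppr_eq0 => /eqP.
Qed.

Lemma twisted_commutator_bound H (D : op H) (a s : H -> H) :
  bounded_twisted_commutator D a s ->
  exists M : R, 0 <= M /\ forall x, dom D x -> nm (D (a x) - s (D x)) <= M * nm x.
Proof.
move=> [M MP]; exists `|complex.Re M|; split=> // x xD.
have := MP x xD; rewrite !nmE lecE => /andP[_].
case: M {MP} => p q /=; rewrite mulr0 subr0 => /le_trans; apply.
by rewrite ler_wpM2r ?nm_ge0// ler_norm.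
Qed.

Lemma adjoint_sym H K (T : H -> K) S : is_adjoint T S -> is_adjoint S T.
Proof. by move=> TS x y; rewrite innerC -TS -innerC. Qed.

Lemma adjoint_linear H K (T : H -> K) S : is_adjoint T S -> linear S.
Proof.
move=> /adjoint_sym TS c x y; apply: inner_ext => z.
by rewrite TS !innerDl !innerZl !TS.
Qed.

(** Cancel |S y| in |S y|^2 = <T (S y), y>, which is at most M |S y| |y|. *)
Lemma adjoint_nm H K (T : H -> K) S (M : R) : is_adjoint T S -> 0 <= M ->
  (forall x, nm (T x) <= M * nm x) -> forall y, nm (S y) <= M * nm y.
Proof.
move=> TS M0 bT y.
have [->|Sy0] := eqVneq (S y) 0; first by rewrite nm0 mulr_ge0// nm_ge0.
have nS : 0 < nm (S y).
  by rewrite nm_gt0.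
rewrite -(ler_pM2l nS) -expr2 -Re_inner -TS (le_trans (Re_cauchy_schwarz _ _))//.
by rewrite mulrA ler_wpM2r ?nm_ge0// mulrC.
Qed.

Lemma adjoint_unique H K (T : H -> K) S S' :
  is_adjoint T S -> is_adjoint T S' -> S = S'.
Proof.
move=> /adjoint_sym TS /adjoint_sym TS'; apply/funext => x.
by apply: inner_ext => z; rewrite TS TS'.
Qed.

End Operators.

(** * Completeness and compactness *)

Section Topology.
Context {R : realType} {H : hilbert R}.
Implicit Types x y z : H.

Lemma ball_nm x (r : R) : ball x (r%:C%C) = [set y | nm (x - y) < r].
Proof.
by rewrite -ball_normE; apply/seteqP; split=> y /=; rewrite nmE ltcR.
Qed.

Lemma posC (e : R[i]) : 0 < e -> exists2 r : R, 0 < r & e = r%:C%C.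
Proof.
by case: e => a b; rewrite ltcE/= => /andP[/eqP-> a0]; exists a.
Qed.

Lemma nm_complete (u : nat -> H) :
  (forall e : R, 0 < e -> exists N, forall m n, (N <= m)%N -> (N <= n)%N ->
    nm (u m - u n) < e) ->
  exists v, forall e : R, 0 < e -> exists N, forall n, (N <= n)%N -> nm (u n - v) < e.
Proof.
move=> uc.
have : cauchy_ex (u @ \oo).
  move=> e /posC[r r0 ->].
  have [N uN] := uc _ r0.
  exists (u N); exists N => // n /= Nn; rewrite ball_nm/=.
  exact: uN.
move/cauchy_exP/cauchy_cvg => /cvg_ex[v uv].
exists v => e e0.
have /= := (cvgrPdist_lt _ _).1 uv (e%:C%C).
rewrite ltcR => /(_ _ e0)[N _ uN].
by exists N => n Nn; have := uN n Nn; rewrite nmE ltcR nmBC.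
Qed.

Definition totally_bounded (A : set H) := forall e : R, 0 < e ->
  exists s : seq H, forall x, A x -> exists2 y, y \in s & nm (x - y) < e.

Lemma precompact_tb A : precompact A -> totally_bounded A.
Proof.
rewrite precompactE compact_cover => cA e e0.
have [|x _|D _ AD] := cA H setT (fun y => (ball y (e%:C%C))^°).
- by move=> *; exact: open_interior.
- exists x => //; rewrite /interior; apply: nbhsx_ballx.
  by rewrite ltcR.
- exists (finmap.enum_fset D) => x Ax.
  have [y yD /interior_subset] := AD x (subset_closure Ax).
  by rewrite ball_nm => yx; exists y => //; rewrite nmBC.
Qed.

(** An ultrafilter on the closure contains one of finitely many small balls, for every radius; so it
    is Cauchy and converges by completeness. *)
Lemma tb_precompact A : totally_bounded A -> precompact A.
Proof.
move=> tA; rewrite precompactE compact_ultra => F UF FA.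
have : cauchy_ex F.
  move=> e /posC[r r0 ->].
  have [|s As] := tA (r / 2); first by rewrite divr_gt0.
  have : F [set x | exists2 y, y \in s & nm (y - x) < r].
    apply: filterS FA => x.
    move=> /(_ (ball x ((r / 2)%:C%C))) [].
      by apply: nbhsx_ballx; rewrite ltcR divr_gt0.
    move=> z [/As[y ys yz]]; rewrite ball_nm/= => xz.
    exists y => //; rewrite (le_lt_trans (nm_triB z _ _))// (splitr r) ltrD//.
      by rewrite nmBC.
    by rewrite nmBC.
  elim: s {As} => [|y s IHs] Fs.
    by have [x []] := filter_ex Fs.
  have [Fy|Fy] := in_ultra_setVsetC [set x | nm (y - x) < r] UF.
    by exists y; rewrite ball_nm.
  apply: IHs; apply: filterS2 Fs Fy => x [z].
  rewrite inE => /orP[/eqP-> //|zs zx _]; by exists z.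
move/cauchy_exP/cauchy_cvg => /cvg_ex[v Fv].
exists v; split => //.
rewrite ((closure_id (closure A)).1 (@closed_closure _ A)).
by move=> B /Fv FB; have [x xB] := filter_ex (filterI FA FB); exists x.
Qed.

Lemma closure_nm (A : set H) y : closure A y ->
  forall e : R, 0 < e -> exists2 x, A x & nm (y - x) < e.
Proof.
move=> clA e e0; have [|x [Ax]] := clA (ball y (e%:C%C)).
  by apply: nbhsx_ballx; rewrite ltcR.
by rewrite ball_nm; exists x.
Qed.

(** The supremum over [A] may be attained only in the closure, which is compact. *)
Lemma precompact_argmax (A : set H) (f : H -> R) (M : R) x0 :
  A x0 -> precompact A -> (forall x y, `|f x - f y| <= M * nm (x - y)) ->
  exists2 y0, closure A y0 & forall x, A x -> f x <= f y0.
Proof.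
move=> Ax0; rewrite precompactE => cA lipf.
have [||y0 y0A fy0] := @compact_EVT_max _ _ f _ _ cA.
- by exists x0; exact: subset_closure.
- apply: continuous_subspaceT => x; apply/cvgrPdist_lt => e e0.
  pose M' := `|M| + 1.
  have M'0 : 0 < M' by rewrite ltr_wpDl.
  have : ball x ((e / M')%:C%C) `<=` [set y | `|f x - f y| < e].
    move=> y; rewrite ball_nm/= => xy; rewrite (le_lt_trans (lipf _ _))//.
    apply: (@le_lt_trans _ _ (M' * nm (x - y))).
      by rewrite ler_wpM2r ?nm_ge0// ler_wpDr// ler_norm.
    by rewrite mulrC -ltr_pdivlMr.
  move=> sub; apply: (filterS sub); apply: nbhsx_ballx.
  by rewrite ltcR divr_gt0.
- exists y0; first by rewrite -in_setE.
  by move=> x Ax; apply: fy0; rewrite in_setE; exact: subset_closure.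
Qed.

End Topology.

(** * Orthonormal sequences and diagonal operators *)

(** Boundedness of the partial sums amounts to convergence for the nonnegative sequences considered
    below. *)
Definition summable_seq {R : realType} (u : nat -> R) :=
  exists M : R, forall N, \sum_(i < N) u i <= M.

Section SummableSeq.
Context {R : realType}.
Implicit Types u v : nat -> R.

Lemma summable_le u v : (forall i, u i <= v i) -> summable_seq v -> summable_seq u.
Proof.
by move=> uv [M vM]; exists M => N; rewrite (le_trans _ (vM N))// ler_sum.
Qed.

Lemma summableD u v : summable_seq u -> summable_seq v ->
  summable_seq (fun i => u i + v i).
Proof.
by move=> [M uM] [M' vM]; exists (M + M') => N; rewrite big_split lerD.
Qed.

Lemma summableZ (c : R) u : 0 <= c -> summable_seq u -> summable_seq (fun i => c * u i).
Proof.
by move=> c0 [M uM]; exists (c * M) => N; rewrite -mulr_sumr ler_wpM2l.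
Qed.

Lemma sum_mono u m n : (forall i, 0 <= u i) -> (m <= n)%N ->
  \sum_(i < m) u i <= \sum_(i < n) u i.
Proof.
move=> u0 mn; rewrite -!(big_mkord xpredT u) (big_cat_nat (leq0n m) mn)/=.
by rewrite lerDl sumr_ge0.
Qed.

Lemma summable_tail u : (forall i, 0 <= u i) -> summable_seq u ->
  forall e : R, 0 < e -> exists N, forall m n, (N <= m)%N -> (m <= n)%N ->
    \sum_(m <= i < n) u i < e.
Proof.
move=> u0 [M uM] e e0.
pose U := [set \sum_(i < N) u i | N in [set: nat]].
have supU : has_sup U.
  by split; [exists (\sum_(i < 0) u i), 0|exists M => _ [N _ <-]].
have [_ [N _ <-] UN] := sup_adherent e0 supU.
exists N => m n Nm mn.
have : \sum_(i < n) u i <= sup U by apply: sup_ubound; [case: supU|exists n].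
have := sum_mono u0 Nm.
rewrite -[X in _ -> X <= _ -> _](big_mkord xpredT u) (big_cat_nat (leq0n m) mn)/=.
rewrite [\sum_(0 <= i < m) _]big_mkord.
move: UN; lra.
Qed.

End SummableSeq.

Section BasisSequences.
Context {R : realType} {H : hilbert R}.
Local Notation C := R[i].
Implicit Types (x y z : H) (e : nat -> H) (c : nat -> C).

(* An orthonormal basis enumerated by the natural numbers, in which some entries
   may be 0: this also covers spaces of finite dimension. *)
Definition basis_seq e : Prop :=
  (forall i j, inner (e i) (e j) = ((i == j) && (e i != 0))%:R) /\
  (forall x, (forall i, inner x (e i) = 0) -> x = 0).

(** At a zero entry of [e] every vector has coefficient 0, so only such [c] can be sequences of
    coefficients. *)
Definition supported e c := forall i, e i = 0 -> c i = 0.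

Variable e : nat -> H.
Hypothesis eB : basis_seq e.

Lemma basis_nm i : nm (e i) = (e i != 0)%:R.
Proof.
have [-> | ei] := eqVneq (e i) 0; first by rewrite nm0.
have : nm (e i) ^+ 2 = 1 ^+ 2 by rewrite -Re_inner eB.1 eqxx ei/= expr1n.
by move/eqP; rewrite eqrXn2 ?nm_ge0// => /eqP.
Qed.

Lemma basis_orth i j : i != j -> inner (e i) (e j) = 0.
Proof. by rewrite eB.1 => /negPf->. Qed.

Lemma supported_hat x : supported e (fun i => inner x (e i)).
Proof. by move=> i ->; rewrite inner0r. Qed.

Lemma basis_mull c j : supported e c -> c j * inner (e j) (e j) = c j.
Proof.
move=> sc; rewrite eB.1 eqxx/=.
by have [/sc ->|_] := eqVneq (e j) 0; rewrite ?mul0r ?mulr1.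
Qed.

Lemma hat_sum c N j : supported e c ->
  inner (\sum_(i < N) c i *: e i) (e j) = if (j < N)%N then c j else 0.
Proof.
move=> sc; rewrite inner_suml; case: ifPn => [jN|]; last first.
  rewrite -leqNgt => Nj; rewrite big1// => i _; rewrite innerZl basis_orth ?mulr0//.
  by rewrite neq_ltn (leq_trans (ltn_ord i) Nj).
rewrite (bigD1 (Ordinal jN))//= innerZl basis_mull// big1 ?addr0// => i ij.
by rewrite innerZl basis_orth ?mulr0//.
Qed.

Lemma nm_sum_sqr c m n : supported e c ->
  nm (\sum_(m <= i < n) c i *: e i) ^+ 2 = \sum_(m <= i < n) nm (c i) ^+ 2.
Proof.
move=> sc; have [mn|nm_] := leqP m n; last first.
  by rewrite !big_geq ?(ltnW nm_)// nm0 expr0n.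
elim: n mn => [|n IHn]; first by rewrite leqn0 => /eqP->; rewrite !big_geq// nm0 expr0n.
rewrite leq_eqVlt => /orP[/eqP->|mn]; first by rewrite !big_geq// nm0 expr0n.
rewrite !big_nat_recr//= nm_pythagoras ?IHn//.
  congr (_ + _); rewrite nmZ exprMn -[nm (e n) ^+ 2]Re_inner.
  have := basis_mull n sc; rewrite eB.1 eqxx/=.
  by case: (e n != 0) => /= [_|]; rewrite ?mulr1// mulr0 => <-; rewrite nm0 expr0n mul0r.
rewrite inner_suml big_nat big1// => i /andP[_ iN].
by rewrite innerZl innerZr basis_orth ?mulr0// neq_ltn iN.
Qed.

Lemma nm_sum_sqr_ord c n : supported e c ->
  nm (\sum_(i < n) c i *: e i) ^+ 2 = \sum_(i < n) nm (c i) ^+ 2.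
Proof.
by move=> sc; rewrite -!(big_mkord xpredT (fun i => c i *: e i)) nm_sum_sqr// big_mkord.
Qed.

Definition trunc N x : H := \sum_(i < N) inner x (e i) *: e i.

Lemma hat_trunc N x j :
  inner (trunc N x) (e j) = if (j < N)%N then inner x (e j) else 0.
Proof. by rewrite (hat_sum _ _ (@supported_hat x)). Qed.

Lemma nm_trunc N x : nm (trunc N x) ^+ 2 = \sum_(i < N) nm (inner x (e i)) ^+ 2.
Proof. by rewrite (nm_sum_sqr_ord _ (@supported_hat x)). Qed.

Lemma inner_trunc N x : inner x (trunc N x) = (nm (trunc N x) ^+ 2)%:C%C.
Proof.
rewrite nm_trunc /trunc inner_sumr (rmorph_sum (real_complex R)).
by apply: eq_bigr => i _; rewrite innerZr mulrC nm_sqr.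
Qed.

Lemma nm_trunc_le N x : nm (trunc N x) <= nm x.
Proof.
have [->|t0] := eqVneq (trunc N x) 0; first by rewrite nm0 nm_ge0.
have nt : 0 < nm (trunc N x).
  by rewrite nm_gt0.
rewrite -(ler_pM2r nt) -expr2.
by have := Re_cauchy_schwarz x (trunc N x); rewrite inner_trunc.
Qed.

Lemma bessel N x : \sum_(i < N) nm (inner x (e i)) ^+ 2 <= nm x ^+ 2.
Proof. by rewrite -nm_trunc lerXn2r ?nnegrE ?nm_ge0// nm_trunc_le. Qed.

Lemma basis_ext x y : (forall i, inner x (e i) = inner y (e i)) -> x = y.
Proof.
move=> xy; apply/eqP; rewrite -subr_eq0; apply/eqP/eB.2 => i.
by rewrite innerBl xy subrr.
Qed.

Lemma riesz_fischer c : supported e c -> summable_seq (fun i => nm (c i) ^+ 2) ->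
  exists v, (forall i, inner v (e i) = c i) /\
    forall r : R, 0 < r -> exists N, forall n, (N <= n)%N ->
      nm (\sum_(i < n) c i *: e i - v) < r.
Proof.
move=> sc smc.
have [|v vP] := @nm_complete _ _ (fun n => \sum_(i < n) c i *: e i).
  move=> r r0.
  have [||N Nr] := @summable_tail _ (fun i => nm (c i) ^+ 2) _ smc (r ^+ 2).
  - by move=> i; rewrite exprn_ge0 ?nm_ge0.
  - by rewrite exprn_gt0.
  exists N => m n; wlog mn : m n / (m <= n)%N => [wl Nm Nn|Nm Nn].
    by have [/wl|/ltnW/wl] := leqP m n; [exact|rewrite nmBC; exact].
  rewrite nmBC -!(big_mkord xpredT (fun i => c i *: e i)).
  rewrite (big_cat_nat (leq0n m) mn)/= addrAC subrr add0r.
  rewrite -(@ltr_sqr _ (nm _)) ?nnegrE ?nm_ge0 ?(ltW r0)// nm_sum_sqr//.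
  exact: Nr.
exists v; split=> // i; apply/eqP; rewrite -subr_eq0; apply/eqP/nm0_eq0.
apply/eqP; rewrite eq_le nm_ge0 andbT; apply/ler_addgt0Pr => r r0; rewrite add0r.
have [N vN] := vP _ r0.
(* With at least i.+1 terms the partial sum has the coefficient c i itself. *)
have := vN (maxn N i.+1) (leq_maxl _ _).
have <- : inner (\sum_(k < maxn N i.+1) c k *: e k) (e i) = c i.
  by rewrite hat_sum// leq_max ltnSn orbT.
rewrite -innerBl => /ltW; rewrite nmBC => /(le_trans _); apply.
rewrite (le_trans (cauchy_schwarz _ _))// ler_piMr ?nm_ge0//.
by rewrite basis_nm; case: (e i != 0).
Qed.

Lemma summable_hat x : summable_seq (fun i => nm (inner x (e i)) ^+ 2).
Proof. by exists (nm x ^+ 2) => N; exact: bessel. Qed.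

(** Riesz-Fischer gives a limit of the expansion; having the coefficients of [x], it is [x]. *)
Lemma trunc_cvg x (r : R) : 0 < r ->
  exists N, forall n, (N <= n)%N -> nm (trunc n x - x) < r.
Proof.
have [v [vx +]] := riesz_fischer (@supported_hat x) (summable_hat x).
by rewrite (basis_ext vx) => + /[dup] r0 => /[apply].
Qed.

Lemma parseval_le x (M : R) :
  (forall N, \sum_(i < N) nm (inner x (e i)) ^+ 2 <= M ^+ 2) -> 0 <= M -> nm x <= M.
Proof.
move=> xM M0; apply/ler_addgt0Pr => r r0.
have [N /(_ N (leqnn N)) xN] := trunc_cvg x r0.
have -> : x = trunc N x - (trunc N x - x) by rewrite opprB addrC subrK.
rewrite (le_trans (nmB _ _))//; apply: lerD; last exact: ltW.
by rewrite -(@ler_sqr _ (nm _)) ?nnegrE ?nm_ge0// nm_trunc.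
Qed.

End BasisSequences.

Section DiagonalOperators.
Context {R : realType} {H : hilbert R}.
Local Notation C := R[i].
Implicit Types (x y z : H) (D T : op H) (l f : nat -> R).
Variable e : nat -> H.
Hypothesis eB : basis_seq e.

(** A relation, not an equality with [diag l], because values off the domain are junk. The domain is
    the maximal one, which is what makes real diagonal operators self-adjoint. *)
Definition op_diag l D : Prop :=
  (forall x, dom D x <->
     summable_seq (fun i => l i ^+ 2 * nm (inner x (e i)) ^+ 2)) /\
  (forall x, dom D x -> forall i, inner (D x) (e i) = (l i)%:C%C * inner x (e i)).

Definition diag l : op H :=
  Op [set x | summable_seq (fun i => l i ^+ 2 * nm (inner x (e i)) ^+ 2)]
     (fun x => xget 0 [set v | forall i, inner v (e i) = (l i)%:C%C * inner x (e i)]).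

Lemma nm_diag_hat (r : R) (z : C) : nm (r%:C%C * z) ^+ 2 = r ^+ 2 * nm z ^+ 2.
Proof. by rewrite nmM nmC exprMn real_normK// num_real. Qed.

Lemma diagP l : op_diag l (diag l).
Proof.
split=> // x xD i.
have [||v [vP _]] := @riesz_fischer _ _ e eB (fun i => (l i)%:C%C * inner x (e i)).
- by move=> j ej; rewrite ej inner0r mulr0.
- by under eq_fun do rewrite nm_diag_hat.
exact: (@xgetPex _ 0 [set v | forall i, inner v (e i) = (l i)%:C%C * inner x (e i)]
  (ex_intro _ v vP)).
Qed.

Section OneOperator.
Variables (l : nat -> R) (D : op H).
Hypothesis lD : op_diag l D.

Lemma diag_ext x y : dom D x ->
  (forall i, inner y (e i) = (l i)%:C%C * inner x (e i)) -> D x = y.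
Proof. by move=> xD yE; apply: (basis_ext eB) => i; rewrite lD.2// yE. Qed.

(** Domain membership is always proved by exhibiting the image: Bessel's inequality for [y] bounds
    the series. *)
Lemma diag_dom x y : (forall i, inner y (e i) = (l i)%:C%C * inner x (e i)) ->
  dom D x.
Proof.
move=> xy; apply/lD.1; exists (nm y ^+ 2) => N; apply: le_trans (bessel eB N y).
by under eq_bigr do rewrite -nm_diag_hat -xy.
Qed.

Lemma diag_op_linear : op_linear D.
Proof.
split=> [|c x y xD yD]; first by apply: (@diag_dom _ 0) => i; rewrite inner0l mulr0.
have cE i : inner (c *: D x + D y) (e i) = (l i)%:C%C * inner (c *: x + y) (e i).
  by rewrite !innerDl !innerZl !lD.2//; ring.
by split; [exact: diag_dom cE|apply: diag_ext => //; exact: diag_dom cE].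
Qed.

Lemma diag_basis i : dom D (e i) /\ D (e i) = (l i)%:C%C *: e i.
Proof.
have ei j : inner ((l i)%:C%C *: e i) (e j) = (l j)%:C%C * inner (e i) (e j).
  rewrite innerZl; have [->//|ij] := eqVneq i j.
  by rewrite (basis_orth eB)// !mulr0.
by split; [exact: diag_dom ei|apply: diag_ext => //; exact: diag_dom ei].
Qed.

Lemma diag_trunc N x : dom D (trunc e N x).
Proof.
apply/lD.1; exists (\sum_(i < N) l i ^+ 2 * nm (inner x (e i)) ^+ 2) => M.
rewrite -(big_mkord xpredT (fun i => l i ^+ 2 * nm (inner (trunc e N x) (e i)) ^+ 2)).
rewrite (eq_bigr (fun i => if (i < N)%N then l i ^+ 2 * nm (inner x (e i)) ^+ 2 else 0)).
  rewrite -big_mkcond/=.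
  have [MN|NM] := leqP M N.
    rewrite [leLHS](_ : _ = \sum_(i < M) l i ^+ 2 * nm (inner x (e i)) ^+ 2).
      apply: (@sum_mono _ (fun i => l i ^+ 2 * nm (inner x (e i)) ^+ 2)) => // i.
      by rewrite mulr_ge0 ?sqr_ge0.
    rewrite big_mkord; apply: eq_bigl => i.
    by rewrite (leq_trans (ltn_ord i) MN).
  rewrite (big_cat_nat (leq0n N) (ltnW NM))/= [X in _ + X]big1_seq ?addr0.
    rewrite [leLHS](_ : _ = \sum_(0 <= i < N) l i ^+ 2 * nm (inner x (e i)) ^+ 2).
      by rewrite big_mkord.
    by apply: congr_big_nat => // i /andP[_ ->].
  move=> i /andP[iN]; rewrite mem_index_iota => /andP[Ni _].
  by move: iN; rewrite ltnNge Ni.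
move=> i _; rewrite (hat_trunc eB); case: ifP => // _.
by rewrite nm0 expr0n mulr0.
Qed.

Lemma diag_trunc_comm N x : dom D x -> D (trunc e N x) = trunc e N (D x).
Proof.
move=> xD; apply: diag_ext => [|i]; first exact: diag_trunc.
by rewrite !(hat_trunc eB) lD.2//; case: ifP; rewrite ?mulr0.
Qed.

Lemma diag_sym_trunc N x y : dom D x -> dom D y ->
  inner (trunc e N (D x)) y = inner x (trunc e N (D y)).
Proof.
move=> xD yD; rewrite /trunc inner_suml inner_sumr; apply: eq_bigr => i _.
rewrite innerZl innerZr !lD.2// rmorphM/= -innerC conj_realC; ring.
Qed.

(** The identity is exact once D x and D y are truncated; the two truncation errors, paired with x
    and y, are made small together. *)
Lemma diag_sym x y : dom D x -> dom D y -> inner (D x) y = inner x (D y).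
Proof.
move=> xD yD; apply/eqP; rewrite -subr_eq0; apply/eqP/nm0_eq0/eqP.
rewrite eq_le nm_ge0 andbT; apply/ler_addgt0Pr => r r0; rewrite add0r.
pose M := nm x + nm y + 1.
have M0 : 0 < M by rewrite ltr_wpDl// addr_ge0 ?nm_ge0.
have rM : 0 < r / M by rewrite divr_gt0.
have [N1 /(_ (maxn _ _) (leq_maxl _ _)) +] := trunc_cvg eB (D x) rM.
have [N2 /(_ (maxn _ _) (leq_maxr _ _)) +] := trunc_cvg eB (D y) rM.
move=> /(_ N1) + /(_ N2); set N := maxn _ _ => yN xN.
have -> : inner (D x) y - inner x (D y) =
    inner x (trunc e N (D y) - D y) - inner (trunc e N (D x) - D x) y.
  by rewrite innerBl innerBr diag_sym_trunc//; ring.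
rewrite (le_trans (nmB _ _))//.
have -> : r = M * (r / M) by rewrite mulrCA divff ?mulr1// gt_eqF.
have := cauchy_schwarz x (trunc e N (D y) - D y).
have := cauchy_schwarz (trunc e N (D x) - D x) y.
have := nm_ge0 x; have := nm_ge0 y; move: xN yN rM; rewrite /M; nra.
Qed.

Lemma diag_dense : dense (dom D).
Proof.
move=> O [x Ox] oO.
have : nbhs x O by exact: open_nbhs_nbhs.
move=> /nbhs_ballP[r /posC[r' r'0 ->]]; rewrite ball_nm => rO.
have [N /(_ N (leqnn N)) xN] := trunc_cvg eB x r'0.
exists (trunc e N x); split; last exact: diag_trunc.
by apply: rO => /=; rewrite nmBC.
Qed.

Lemma diag_self_adjoint : self_adjoint D.
Proof.
split; [exact: diag_op_linear|exact: diag_dense|] => y z; split=> [yz|[yD <-]]; last first.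
  by move=> x xD; rewrite diag_sym.
(* Testing the adjoint relation on the eigenvectors alone already determines all coefficients of
   z. *)
have yzE i : inner z (e i) = (l i)%:C%C * inner y (e i).
  have [eD De] := diag_basis i.
  have := yz _ eD; rewrite De innerZl => /(congr1 Num.conj).
  by rewrite rmorphM/= -!innerC conjE/= oppr0.
by split; [exact: diag_dom yzE|apply: diag_ext => //; exact: diag_dom yzE].
Qed.

Lemma diag_bounded (M : R) : 0 <= M -> (forall i, e i != 0 -> `|l i| <= M) ->
  [/\ forall x, dom D x, bounded_op D & forall x, nm (D x) <= M * nm x].
Proof.
move=> M0 lM.
have lxM x i : l i ^+ 2 * nm (inner x (e i)) ^+ 2 <= M ^+ 2 * nm (inner x (e i)) ^+ 2.
  have [-> | ei] := eqVneq (e i) 0; first by rewrite inner0r nm0 expr0n !mulr0.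
  rewrite ler_wpM2r ?sqr_ge0// -real_normK ?num_real//.
  by rewrite lerXn2r ?nnegrE// lM.
have xD x : dom D x.
  apply/lD.1/(summable_le (lxM x))/summableZ; first exact: sqr_ge0.
  exact: summable_hat.
have bD x : nm (D x) <= M * nm x.
  apply: (parseval_le eB) => [N|]; last by rewrite mulr_ge0 ?nm_ge0.
  under eq_bigr do rewrite lD.2// nm_diag_hat.
  apply: (le_trans (ler_sum _ (fun (i : 'I_N) _ => lxM x i))).
  by rewrite -mulr_sumr exprMn ler_wpM2l ?sqr_ge0// bessel.
split=> //; apply/bounded_opP; split; last by exists M.
by move=> c x y; have [_ lin] := diag_op_linear; have [_ ->] := lin c x y (xD x) (xD y).
Qed.

Lemma diag_form_cvg x (r : R) : dom D x -> 0 < r ->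
  exists N, forall n, (N <= n)%N ->
    `|\sum_(i < n) l i * nm (inner x (e i)) ^+ 2 - complex.Re (inner (D x) x)| < r.
Proof.
move=> xD r0; pose M := nm x + 1.
have M0 : 0 < M by rewrite ltr_wpDl// nm_ge0.
have [N xN] := trunc_cvg eB (D x) (divr_gt0 r0 M0).
exists N => n /xN Dn.
have -> : \sum_(i < n) l i * nm (inner x (e i)) ^+ 2 =
    complex.Re (inner (trunc e n (D x)) x).
  rewrite /trunc inner_suml Re_sum; apply: eq_bigr => i _.
  by rewrite innerZl lD.2// -mulrA [inner (e i) x]innerC nm_sqr ReCl.
rewrite -ReB -innerBl (le_lt_trans (Re_le_nm _))//.
rewrite (le_lt_trans (cauchy_schwarz _ _))//.
have -> : r = r / M * M by rewrite divfK// gt_eqF.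
have rM := divr_gt0 r0 M0.
have := nm_ge0 x; have := nm_ge0 (trunc e n (D x) - D x); move: Dn rM; rewrite /M; nra.
Qed.

Lemma diag_form_real x : dom D x -> complex.Im (inner (D x) x) = 0.
Proof.
move=> xD; have := diag_sym xD xD; rewrite [RHS]innerC conjE.
by case: (inner (D x) x) => a b [] /= /eqP; rewrite -addr_eq0 -mulr2n mulrn_eq0/= => /eqP.
Qed.

End OneOperator.
End DiagonalOperators.

(** * The spectral measure of a diagonal operator *)

Section DiscreteMeasures.
Context {R : realType}.
Local Open Scope ereal_scope.

Section Concentrated.
Context d (T : measurableType d) (mu : {measure set T -> \bar R}) (C S : set T).
Hypotheses (mC : forall B, B `<=` C -> measurable B) (muC : mu (~` C) = 0).
Import HBNNSimple.

(** Here [f] and [S] may be nonmeasurable: the integral is a supremum over simple functions below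
    [f], whose integrals live on [C], and on [C] every function is measurable. *)
Lemma ge0_integral_concentrated (f : T -> \bar R) : C `<=` S ->
  (forall t, 0 <= f t) -> \int[mu]_(t in S) f t = \int[mu]_(t in C) f t.
Proof.
move=> CS f0; have mCC : measurable C by exact: mC.
have mf : measurable_fun C f by move=> _ Y mY; apply: mC; exact: subIsetl.
apply/eqP; rewrite eq_le; apply/andP; split; last first.
  rewrite !ge0_integralE//; apply: ereal_sup_le => _ [h /= hf <-].
  exists h => // t; apply: le_trans (hf t) _.
  rewrite /patch; case: ifPn; last by move=> _; case: ifP.
  by rewrite inE => /CS; rewrite -in_setE => ->.
rewrite ge0_integralE//; apply: ge_ereal_sup => _ [h /= hf <-].
rewrite -integralT_nnsfun (@ge0_negligible_integral _ _ _ _ _ (~` C))//.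
- rewrite setTD setCK; apply: ge0_le_integral => //.
  + by move=> t _; rewrite lee_fin.
  + by apply/measurable_EFinP; apply: measurable_funTS.
  + move=> t Ct; apply: le_trans (hf t) _; rewrite /patch.
    by case: ifP.
- exact: measurableC.
- by apply/measurable_EFinP.
- by move=> t _; rewrite lee_fin.
Qed.

End Concentrated.

Section EqSetFunction.
Import HBNNSimple.

(** The integral is defined for plain set functions and evaluates them on measurable sets only; so
    [scalar_measure] can be replaced by a genuine measure under the integral. *)
Lemma eq_setfun_integral d (T : measurableType d) (m1 m2 : set T -> \bar R)
    (S : set T) (f : T -> \bar R) :
  (forall B, measurable B -> m1 B = m2 B) ->
  \int[m1]_(t in S) f t = \int[m2]_(t in S) f t.
Proof.
move=> m12; have m12s (h : {nnsfun T >-> R}) : sintegral m1 h = sintegral m2 h.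
  by apply: eq_fsbigr => r _; rewrite m12.
by rewrite /integral; congr (ereal_sup _ - ereal_sup _); apply: eq_imagel => h _.
Qed.

End EqSetFunction.

Section PointMasses.
Context d (T : measurableType d) (w : nat -> {nonneg R}) (a : nat -> T).
Hypothesis m1 : forall t : T, measurable [set t].

Definition point_masses := mseries (fun n => mscale (w n) \d_(a n)) 0%N.

Lemma point_massesE B :
  point_masses B = \sum_(n <oo) ((w n)%:num * (a n \in B)%:R)%:E.
Proof.
apply: eq_eseriesr => n _; rewrite EFinM.
by rewrite -[LHS]/((w n)%:num%:E * @dirac _ T (a n) R B) diracE.
Qed.

Lemma integral_point_masses (S : set T) (f : T -> \bar R) :
  (forall n, (w n)%:num != 0%R -> S (a n)) -> (forall t, 0 <= f t) ->
  \int[point_masses]_(t in S) f t = \sum_(n <oo) (w n)%:num%:E * f (a n).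
Proof.
(* The points of nonzero weight: a countable set that carries all the mass and has only measurable
   subsets. *)
move=> Sa f0; pose C := [set a n | n in [set n | (w n)%:num != 0%R]].
have cC : countable C by exact: sub_countable (card_image_le _ _) (countableP _).
have mC B : B `<=` C -> measurable B.
  by move=> BC; apply: countable_measurable => //; exact: sub_countable (subset_card_le BC) cC.
have mCC : measurable C by exact: mC.
have mf : measurable_fun C f by move=> _ Y mY; apply: mC; exact: subIsetl.
rewrite (@ge0_integral_concentrated _ _ _ C)//; first last.
- by move=> _ [n /= wn <-]; exact: Sa.
- rewrite -[LHS]/(point_masses (~` C)) point_massesE eseries0// => n _ _.
  have [->|wn] := eqVneq (w n)%:num 0%R; first by rewrite mul0r.
  by rewrite memNset ?mulr0//=; apply; exists n.
rewrite ge0_integral_measure_series//; apply: eq_eseriesr => n _.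
rewrite ge0_integral_mscale// integral_dirac//.
have [->|wn] := eqVneq (w n)%:num 0%R; first by rewrite !mul0e.
by rewrite diracE mem_set ?mul1e//; exists n.
Qed.

End PointMasses.

Lemma nneseries_summable (u : nat -> R) : (forall n, 0 <= u n)%R ->
  (\sum_(n <oo) (u n)%:E < +oo) <-> summable_seq u.
Proof.
move=> u0; split=> [|[M uM]].
- move=> us; exists (fine (\sum_(n <oo) (u n)%:E)) => N.
  rewrite -lee_fin fineK; last first.
    by rewrite ge0_fin_numE// nneseries_ge0// => n _ _; rewrite lee_fin.
  rewrite -sumEFin -(big_mkord xpredT (EFin \o u)).
  by apply: nneseries_lim_ge => n _ _; rewrite lee_fin.
- apply: (@le_lt_trans _ _ M%:E); last exact: ltry.
  apply: lime_le.
    by apply: is_cvg_ereal_nneg_natsum => n _; rewrite lee_fin.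
  by apply: nearW => N; rewrite big_mkord sumEFin lee_fin.
Qed.

Lemma nneseries_cvg (u : nat -> R) (L : R) :
  (forall r : R, (0 < r)%R -> exists N, forall n, (N <= n)%N ->
    (`|\sum_(i < n) u i - L| < r)%R) ->
  \sum_(n <oo) (u n)%:E = L%:E.
Proof.
move=> uL; apply/cvg_lim => //.
rewrite (_ : (fun n => _) = EFin \o (fun n => \sum_(i < n) u i)%R); last first.
  by apply/funext => n /=; rewrite big_mkord sumEFin.
apply: cvg_EFin; first exact: nearW.
apply/cvgrPdist_lt => r /uL[N uN]; exists N => // n /= /uN.
by rewrite distrC.
Qed.

End DiscreteMeasures.

Lemma measurable_set1R {R : realType} (t : measurableTypeR R) : measurable [set t].
Proof. exact: measurable_set1. Qed.

Section SpectralMeasure.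
Context {R : realType} {H : hilbert R}.
Local Notation C := R[i].
Implicit Types (x y z : H) (D T : op H) (f g : R -> R) (B S : set R).
Variable e : nat -> H.
Hypothesis eB : basis_seq e.
Local Notation op_diag := (op_diag e).

Lemma diag_form_series (l : nat -> R) T x : op_diag l T -> dom T x ->
  (\sum_(n <oo) (l n * nm (inner x (e n)) ^+ 2)%:E =
  (complex.Re (inner (T x) x))%:E)%E.
Proof.
by move=> lT xT; apply: nneseries_cvg => r r0; exact: diag_form_cvg.
Qed.

Section Eigenvalues.
Variable l : nat -> R.

Definition eigen_pvm (B : set (measurableTypeR R)) : H -> H :=
  diag e (fun n => \1_B (l n)).

Definition weight x n : {nonneg R} := NngNum (sqr_ge0 (nm (inner x (e n)))).

Definition eigen_masses x := @point_masses R _ (measurableTypeR R) (weight x) l.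

Lemma indicN1 (B : set (measurableTypeR R)) n : `|\1_B (l n) : R| <= 1.
Proof. by rewrite indicE; case: (_ \in _); rewrite ?normr1 ?normr0. Qed.

Lemma eigen_pvm_dom B x : dom (diag e (fun n => \1_B (l n))) x.
Proof.
have [] := diag_bounded eB (diagP eB (fun n => \1_B (l n))) ler01 => //.
by move=> n _; exact: indicN1.
Qed.

Lemma eigen_pvm_hat B x n :
  inner (eigen_pvm B x) (e n) = (\1_B (l n))%:C%C * inner x (e n).
Proof. by rewrite (diagP eB _).2//; exact: eigen_pvm_dom. Qed.

Lemma eigen_massesE x : scalar_measure eigen_pvm x = eigen_masses x.
Proof.
apply/funext => B; rewrite [RHS]point_massesE /scalar_measure.
rewrite -(diag_form_series (diagP eB _) (eigen_pvm_dom B x)).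
by apply: eq_eseriesr => n _; rewrite indicE mulrC.
Qed.

Lemma eigen_pvmP : projection_valued_measure eigen_pvm.
Proof.
split.
- move=> B mB; split.
  + have [//|_ + _] := diag_bounded eB (diagP eB (fun n => \1_B (l n))) ler01.
      by move=> n _; exact: indicN1.
    by [].
  + by move=> x y; apply: (diag_sym eB (diagP eB _)); exact: eigen_pvm_dom.
  + apply/funext => x; apply: (basis_ext eB) => n /=.
    rewrite !eigen_pvm_hat mulrA indicE; case: (_ \in _); by rewrite ?mul1r ?mul0r.
- apply/funext => x; apply: (basis_ext eB) => n /=.
  by rewrite eigen_pvm_hat indicT mul1r.
- move=> B B' _ _; apply/funext => x; apply: (basis_ext eB) => n /=.
  by rewrite !eigen_pvm_hat indicI rmorphM mulrA.
- move=> x; rewrite eigen_massesE; exact: measure_semi_sigma_additive.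
Qed.

Lemma eigen_integral S (f : R -> \bar R) x : (forall n, e n != 0 -> S (l n)) ->
  (forall t, (0 <= f t)%E) ->
  (\int[scalar_measure eigen_pvm x]_(t in S) f t =
   \sum_(n <oo) (nm (inner x (e n)) ^+ 2)%:E * f (l n))%E.
Proof.
move=> Sl f0; rewrite eigen_massesE.
have := @integral_point_masses R _ (measurableTypeR R) (weight x) l
  measurable_set1R S f _ f0; apply.
move=> n /=; have [en|/Sl//] := eqVneq (e n) 0.
by rewrite en inner0r nm0 expr0n eqxx.
Qed.

Lemma eigen_integral_sqr S f x : (forall n, e n != 0 -> S (l n)) ->
  (\int[scalar_measure eigen_pvm x]_(t in S) ((f t) ^+ 2)%:E < +oo)%E <->
  summable_seq (fun n => f (l n) ^+ 2 * nm (inner x (e n)) ^+ 2).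
Proof.
move=> Sl; rewrite (eigen_integral _ (f := fun t => (f t ^+ 2)%:E))//; last first.
  by move=> t; rewrite lee_fin sqr_ge0.
rewrite -nneseries_summable; last by move=> n; rewrite mulr_ge0 ?sqr_ge0.
by under eq_eseriesr do rewrite -EFinM mulrC.
Qed.

Lemma summable_parts f x :
  summable_seq (fun n => f (l n) ^+ 2 * nm (inner x (e n)) ^+ 2) ->
  forall g, (forall t, 0 <= g t <= `|f t|) ->
  summable_seq (fun n => g (l n) ^+ 2 * nm (inner x (e n)) ^+ 2).
Proof.
move=> sf g gf; apply: summable_le sf => n.
have /andP[g0 gfn] := gf (l n).
apply: ler_wpM2r; first exact: sqr_ge0.
by rewrite -[leRHS](real_normK (num_real _)) ler_sqr ?nnegrE.
Qed.

(** The positive and negative parts of [f] are dominated by |f|, so [x] lies in the domain of both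
    diagonal operators; both integrals are then finite and can be subtracted. *)
Lemma eigen_integral_form S f T x : (forall n, e n != 0 -> S (l n)) ->
  op_diag (f \o l) T -> dom T x ->
  (\int[scalar_measure eigen_pvm x]_(t in S) (f t)%:E)%E =
  (complex.Re (inner (T x) x))%:E.
Proof.
move=> Sl fT xT; pose F t := (f t)%:E.
have -> : (\int[scalar_measure eigen_pvm x]_(t in S) F t =
    \int[scalar_measure eigen_pvm x]_(t in S) F^\+ t -
    \int[scalar_measure eigen_pvm x]_(t in S) F^\- t)%E.
  by rewrite eigen_massesE; exact: integralE.
pose fp t := Num.max (f t) 0; pose fn t := Num.max (- f t) 0.
have fp0 t : 0 <= fp t by rewrite /fp le_max lexx orbT.
have fn0 t : 0 <= fn t by rewrite /fn le_max lexx orbT.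
have fpn t : f t = fp t - fn t.
  rewrite /fp /fn; have [ft|ft] := leP 0 (f t).
    by rewrite max_r ?subr0// oppr_le0.
  by rewrite max_l ?sub0r ?opprK// oppr_ge0 ltW.
have fpE : F^\+%E = (fun t => (fp t)%:E).
  by apply/funext => t; rewrite funeposE EFin_max.
have fnE : F^\-%E = (fun t => (fn t)%:E).
  by apply/funext => t; rewrite funenegE EFin_max.
have sf := (fT.1 x).1 xT.
have fpT : dom (diag e (fp \o l)) x.
  apply: (summable_parts sf) => t; rewrite fp0/= /fp ge_max normr_ge0 andbT.
  exact: ler_norm.
have fnT : dom (diag e (fn \o l)) x.
  apply: (summable_parts sf) => t; rewrite fn0/= /fn ge_max normr_ge0 andbT.
  by rewrite -normrN ler_norm.
rewrite fpE fnE.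
rewrite !(eigen_integral _ (f := fun t => (_ t)%:E))//.
under eq_eseriesr do rewrite -EFinM mulrC.
under [X in (_ - X)%E]eq_eseriesr do rewrite -EFinM mulrC.
rewrite (diag_form_series (diagP eB (fp \o l)) fpT).
rewrite (diag_form_series (diagP eB (fn \o l)) fnT).
rewrite -EFinB -ReB -innerBl; congr (complex.Re (inner _ x))%:E.
apply: (basis_ext eB) => n.
rewrite innerBl !(diagP eB _).2// fT.2//= fpn rmorphB/=; ring.
Qed.

Lemma diag_spectral_integral S f T : (forall n, e n != 0 -> S (l n)) ->
  op_diag (f \o l) T -> is_spectral_integral eigen_pvm S f T.
Proof.
move=> Sl fT; split; first exact: (diag_op_linear eB fT).
- by move=> x; rewrite eigen_integral_sqr//; exact: fT.1.
- move=> x xT; rewrite (eigen_integral_form Sl fT xT)/=.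
  have := diag_form_real eB fT xT.
  by case: (inner (T x) x) => a b /= ->.
Qed.

(* Polarisation recovers the matrix coefficients from the quadratic form. *)
Lemma polar_eq (u v w : C) (r : R) :
  (forall c : C, complex.Re (c * u + Num.conj c * v) =
                 2 * r * complex.Re (Num.conj c * w)) ->
  (forall c : C, complex.Im (c * u + Num.conj c * v) = 0) ->
  v = r%:C%C * w.
Proof.
move=> cR cI.
have := cR 1; have := cR 'i%C; have := cI 1; have := cI 'i%C.
case: u v w {cR cI} => [u1 u2] [v1 v2] [w1 w2]; rewrite !conjE /=.
by move=> E1 E2 E3 E4; apply/eqP; rewrite eq_complex/=; apply/andP; split; apply/eqP; lra.
Qed.

Lemma spectral_integral_diag S f T : (forall n, e n != 0 -> S (l n)) ->
  is_spectral_integral eigen_pvm S f T -> op_diag (f \o l) T.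
Proof.
move=> Sl [lT domT formT].
have dT x : dom T x <-> summable_seq (fun n => f (l n) ^+ 2 * nm (inner x (e n)) ^+ 2).
  by rewrite domT eigen_integral_sqr.
split => // x xT n /=.
have F := diagP eB (f \o l).
have dF y : dom T y -> dom (diag e (f \o l)) y by move=> /dT.
have TF y : dom T y -> inner (T y) y = (complex.Re (inner (diag e (f \o l) y) y))%:C%C.
  by move=> yT; rewrite formT// (eigen_integral_form Sl F)//; exact: dF.
have [eF Fe] := diag_basis eB F n.
have eT : dom T (e n) by apply/dT.
have lin : forall c : C, dom T (c *: e n + x) /\ T (c *: e n + x) = c *: T (e n) + T x.
  by move=> c; have [_ /(_ c _ _ eT xT)] := lT.
have linF : forall c : C, diag e (f \o l) (c *: e n + x) =
    c *: diag e (f \o l) (e n) + diag e (f \o l) x.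
  by move=> c; have [_ /(_ c _ _ eF (dF _ xT))[_ ->]] := diag_op_linear eB F.
(* The quadratic forms of [T] and of the diagonal operator agree at c e_n + x, e_n and x;
   subtracting leaves the cross terms. *)
have key (c : C) : c * inner (T (e n)) x + Num.conj c * inner (T x) (e n) =
    (2 * f (l n) * complex.Re (Num.conj c * inner x (e n)))%:C%C.
  have [cT cE] := lin c.
  have := TF _ cT; rewrite cE linF !innerDl !innerDr !innerZl !innerZr Fe.
  rewrite (TF _ eT) (TF _ xT) Fe F.2; last exact: dF.
  rewrite !innerZl !ReD /= => /(canRL (addrK _)).
  set X := inner (diag e _ x) x; set u := inner (T (e n)) x.
  set v := inner (T x) (e n).
  rewrite [inner (e n) x]innerC; set w := inner x (e n).
  have -> : inner (e n) (e n) = (nm (e n) ^+ 2)%:C%C by rewrite innerE.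
  set en := nm (e n) ^+ 2.
  clearbody X u v w en; clear; move: c u v w X => [c1 c2] [u1 u2] [v1 v2] [w1 w2] [X1 X2].
  rewrite !conjE; set t := f (l n); move=> /eqP; rewrite eq_complex/= => /andP[/eqP E1 /eqP E2].
  apply/eqP; rewrite eq_complex/=; apply/andP; split; apply/eqP; lra.
by apply: (@polar_eq (inner (T (e n)) x)) => c; rewrite key.
Qed.

End Eigenvalues.
End SpectralMeasure.

(** * Uniqueness of the spectral measure *)

Section IntegralZero.
Context {R : realType}.
Variable mu : {measure set (measurableTypeR R) -> \bar R}.
Local Open Scope ereal_scope.

(** On a finite measure space |t| is dominated by the integrable function 1 + t^2. *)
Lemma integrable_id_of_sqr : mu setT < +oo ->
  \int[mu]_t ((t : R) ^+ 2)%:E < +oo -> mu.-integrable setT (EFin : measurableTypeR R -> \bar R).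
Proof.
move=> muT sq.
have mid : measurable_fun setT (fun t : measurableTypeR R => t : R) by exact: measurable_id.
have msq : measurable_fun setT (fun t : measurableTypeR R => ((t : R) ^+ 2)%R).
  exact: measurable_funX.
apply/integrableP; split; first exact/measurable_EFinP.
apply: (@le_lt_trans _ _ (\int[mu]_t (1 + (t : R) ^+ 2)%:E)).
  apply: ge0_le_integral => //.
  - by apply: measurableT_comp => //; exact/measurable_EFinP.
  - by apply/measurable_EFinP; exact: measurable_funD.
  - move=> t _; rewrite lee_fin.
    have := real_normK (num_real (t : R)); have := normr_ge0 (t : R).
    move: `|(t : R)|%R => s; nra.
under eq_integral do rewrite EFinD.
rewrite ge0_integralD//; first last.
- exact/measurable_EFinP.
- by move=> t _; rewrite lee_fin sqr_ge0.
by rewrite integral_cst// mul1e lte_add_pinfty.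
Qed.

(** The function r (t - l) has integral 0 but is positive on [B], which carries all the mass. The
    sign of [r] tells on which side of [l] the set lies. *)
Lemma measure0_of_mean (B : set (measurableTypeR R)) (l r : R) : measurable B ->
  mu (~` B) = 0 -> mu setT < +oo -> (r != 0)%R ->
  (forall t : R, B t -> (0 < r * (t - l))%R) ->
  \int[mu]_t ((t : R) ^+ 2)%:E < +oo ->
  \int[mu]_t (t : R)%:E = l%:E * mu setT -> mu setT = 0.
Proof.
move=> mB muB muT r0 rB sq mean.
have iid := integrable_id_of_sqr muT sq.
have icst (c : R) : mu.-integrable setT (cst c%:E).
  apply/integrableP; split; first exact: measurable_cst.
  by rewrite /= integral_cst// lte_mul_pinfty// lee_fin.
have : \int[mu]_t (r * (t - l))%:E = 0.
  under eq_integral do rewrite EFinM EFinB.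
  rewrite integralZl//=; last exact: (integrableB measurableT iid (icst l)).
  have -> : \int[mu]_t ((t : R)%:E - l%:E) = \int[mu]_t (t : R)%:E - \int[mu]_t l%:E.
    exact: (integralB measurableT iid (icst l)).
  rewrite integral_cst// mean subee ?mule0//.
  by rewrite fin_numM// ge0_fin_numE.
have mf : measurable_fun setT (fun t : measurableTypeR R => (r * ((t : R) - l))%R).
  by apply: measurable_funM => //; apply: measurable_funB => //; exact: measurable_id.
rewrite (negligible_integral (N := ~` B))//; first last.
- under [X in _.-integrable _ X]eq_fun do rewrite EFinM EFinB.
  by apply: integrableZl => //; exact: (integrableB measurableT iid (icst l)).
- exact: measurableC.
rewrite setTD setCK => int0.
have : \int[mu]_(t in B) `|(r * (t - l))%:E| = 0.
  rewrite -[RHS]int0; apply: eq_integral => t; rewrite inE => Bt.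
  by rewrite /= ger0_norm// ltW// rB.
move/ae_eq_integral_abs => -[//||N [mN N0 NB]].
  by apply/measurable_EFinP; apply: measurable_funTS.
have BN : B `<=` N.
  move=> t Bt; apply: NB => /= /(_ Bt)[/eqP].
  by rewrite gt_eqF// rB.
apply/eqP; rewrite -measure_le0 -(setUv B).
apply: le_trans (measureU2 _ mB (measurableC mB)) _.
by rewrite [X in _ + X]muB adde0 -N0 le_measure// inE.
Qed.

End IntegralZero.

Section Uniqueness.
Context {R : realType} {H : hilbert R}.
Local Notation C := R[i].
Implicit Types (x y z : H) (B S : set (measurableTypeR R)).
Variables (E : set (measurableTypeR R) -> H -> H).
Hypothesis PE : projection_valued_measure E.

Let pvm_bounded B : measurable B -> bounded_op (E B).
Proof. by have [+ _ _ _] := PE; move=> /(_ B) + mB => /(_ mB)[]. Qed.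
Let pvm_sym B : measurable B -> is_adjoint (E B) (E B).
Proof. by have [+ _ _ _] := PE; move=> /(_ B) + mB => /(_ mB)[]. Qed.
Let pvm_idem B x : measurable B -> E B (E B x) = E B x.
Proof.
by have [+ _ _ _] := PE; move=> /(_ B) + mB => /(_ mB)[_ _] /(congr1 (@^~ x)).
Qed.
Let pvmT x : E setT x = x.
Proof. by have [_ -> _ _] := PE. Qed.
Let pvmI B S x : measurable B -> measurable S -> E (B `&` S) x = E B (E S x).
Proof. by have [_ _ EI _] := PE => mB mS; rewrite EI. Qed.

Lemma pvm_scalar B x : measurable B -> scalar_measure E x B = (nm (E B x) ^+ 2)%:E.
Proof.
move=> mB; rewrite /scalar_measure -Re_inner -{1}(pvm_idem x mB).
by rewrite (pvm_sym mB).
Qed.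

Lemma pvm_nm_le B x : measurable B -> nm (E B x) <= nm x.
Proof.
move=> mB; have [->|y0] := eqVneq (E B x) 0; first by rewrite nm0 nm_ge0.
have ny : 0 < nm (E B x).
  by rewrite nm_gt0.
rewrite -(ler_pM2r ny) -expr2 -Re_inner -(pvm_sym mB) pvm_idem//.
by rewrite (Re_innerC (E B x)) Re_cauchy_schwarz.
Qed.

(** Countable additivity over copies of the empty set makes a series with constant term |E(set0)
    x|^2 converge to a finite number. *)
Lemma pvm0 x : E set0 x = 0.
Proof.
pose a := nm (E set0 x) ^+ 2; have a0 : 0 <= a by exact: sqr_ge0.
suff /eqP : a = 0 by rewrite sqrf_eq0 => /eqP/nm0_eq0.
have [_ _ _ /(_ x) sa] := PE.
have := sa (fun=> set0) (fun=> measurable0) (@trivIset_set0 _ _ _).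
rewrite bigcup0// => /(_ measurable0); rewrite pvm_scalar// -/a => /cvg_lim lim0.
have /(nneseries_summable (u := fun=> a))[//|M uM] : (\sum_(n <oo) a%:E < +oo)%E.
  by have := lim0 (@ereal_hausdorff R) => ->; rewrite ltry.
apply/eqP; rewrite eq_le a0 andbT leNgt; apply/negP => ap.
have := uM (Num.truncn (M / a)).+1; rewrite sumr_const card_ord.
have := truncnS_gt (M / a); rewrite ltr_pdivrMr// mulr_natl => + Ma.
by rewrite ltNge Ma.
Qed.

(* scalar_measure E x, corrected on the non-measurable sets, where projection
   valued measures are unconstrained. *)
Definition pvm_measure x B : \bar R :=
  if pselect (measurable B) is left _ then scalar_measure E x B else 0%E.

Lemma pvm_measureE x B : measurable B -> pvm_measure x B = (nm (E B x) ^+ 2)%:E.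
Proof.
by move=> mB; rewrite /pvm_measure; case: pselect => // _; rewrite pvm_scalar.
Qed.

Let pvm_measure0 x : pvm_measure x set0 = 0%E.
Proof. by rewrite pvm_measureE// pvm0 nm0 expr0n. Qed.

Let pvm_measure_ge0 x B : (0 <= pvm_measure x B)%E.
Proof.
rewrite /pvm_measure; case: pselect => // mB; rewrite pvm_scalar//.
by rewrite lee_fin sqr_ge0.
Qed.

Let pvm_measure_sigma_additive x : semi_sigma_additive (pvm_measure x).
Proof.
move=> F mF tF mUF; have [_ _ _ /(_ x F mF tF mUF)] := PE.
rewrite pvm_measureE// -pvm_scalar//.
rewrite [X in X @ _ --> _ -> _](_ : _ = fun n => \sum_(0 <= i < n) pvm_measure x (F i))%E//.
by apply/funext => n; apply: eq_bigr => i _; rewrite pvm_measureE// pvm_scalar.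
Qed.

HB.instance Definition _ x := isMeasure.Build _ _ _ (pvm_measure x)
  (pvm_measure0 x) (pvm_measure_ge0 x) (@pvm_measure_sigma_additive x).

Lemma pvm_integral x (f : R -> \bar R) (S : set R) :
  (\int[scalar_measure E x]_(t in S) f t = \int[pvm_measure x]_(t in S) f t)%E.
Proof.
by apply: eq_setfun_integral => B mB; rewrite pvm_measureE// pvm_scalar.
Qed.

Lemma pvm_measureT x : pvm_measure x setT = (nm x ^+ 2)%:E.
Proof. by rewrite pvm_measureE// pvmT. Qed.

Let pvm_lin B : measurable B -> linear (E B).
Proof. by move=> /pvm_bounded[]. Qed.

Lemma pvm_comm B S x : measurable B -> measurable S -> E B (E S x) = E S (E B x).
Proof. by move=> mB mS; rewrite -!pvmI// setIC. Qed.

Variables (D : op H) (e : H) (l : R).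
Hypotheses (ID : is_spectral_integral E setT id D)
  (Dsym : forall x y, dom D x -> dom D y -> inner (D x) y = inner x (D y))
  (eD : dom D e) (De : D e = l%:C%C *: e).

Let integral_le x y : (forall S, measurable S -> nm (E S x) <= nm (E S y)) ->
  (\int[pvm_measure x]_t ((t : R) ^+ 2)%:E <= \int[pvm_measure y]_t ((t : R) ^+ 2)%:E)%E.
Proof.
move=> xy; apply: ge0_le_measure_integral => //.
- move=> S mS; rewrite [leLHS]pvm_measureE// [leRHS]pvm_measureE//.
  by rewrite lee_fin lerXn2r ?nnegrE ?nm_ge0 ?xy.
- by move=> t; rewrite lee_fin sqr_ge0.
- apply/measurable_EFinP.
  by apply: (@measurable_funX _ (measurableTypeR R) R setT id); exact: measurable_id.
Qed.

(** E(B) is a contraction commuting with every E(S), so the scalar measure of E(B) x lies below that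
    of x. *)
Lemma pvm_dom_sub B x : measurable B -> dom D x -> dom D (E B x).
Proof.
move=> mB xD; have [_ domD _] := ID.
apply/domD; rewrite pvm_integral; move/domD: xD; rewrite pvm_integral.
apply: le_lt_trans; apply: integral_le => S mS.
by rewrite -pvm_comm// pvm_nm_le.
Qed.

(* With y = E B e and z = e - y, the measures of y + z and y - z agree, so the
   quadratic form of D does not see the cross terms of y and z. *)
Lemma pvm_eigen_mean B : measurable B ->
  (\int[pvm_measure (E B e)]_t (t : R)%:E = l%:E * pvm_measure (E B e) setT)%E.
Proof.
move=> mB; pose y := E B e; pose z := e - y.
have [lD domD formD] := ID.
have yD : dom D y by exact: pvm_dom_sub.
have zD : dom D z /\ D z = D e - D y.
  by have [_ /(_ (-1) y e yD eD)] := lD; rewrite !scaleN1r ![- _ + _]addrC.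
have wD : dom D (y - z) /\ D (y - z) = D y - D z.
  by have [_ /(_ (-1) z y zD.1 yD)] := lD; rewrite !scaleN1r ![- _ + _]addrC.
have orth S : measurable S -> inner (E S y) (E S z) = 0.
  move=> mS; rewrite -(pvm_sym mS) pvm_idem// pvm_comm// (pvm_sym mB).
  by rewrite /z (linB (pvm_lin mB)) pvm_idem// subrr inner0r.
have nmE_ S : measurable S -> nm (E S (y - z)) ^+ 2 = nm (E S e) ^+ 2.
  move=> mS; have -> : e = y + z by rewrite addrC subrK.
  rewrite (linB (pvm_lin mS)) (linD (pvm_lin mS)) nm_sqrB nm_sqrD orth//.
  by rewrite mulr0 subr0 addr0.
have same : complex.Re (inner (D (y - z)) (y - z)) = complex.Re (inner (D e) e).
  rewrite !formD//; last exact: wD.1.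
  rewrite !pvm_integral/=; congr fine; apply: eq_setfun_integral => S mS.
  by rewrite !pvm_measureE// nmE_.
have cross : complex.Re (inner (D z) y) = 0.
  move: same; rewrite wD.2 zD.2 /z !innerBl !innerBr !ReB.
  have : complex.Re (inner (D y) e) = complex.Re (inner (D e) y).
    by rewrite Dsym// Re_innerC.
  by move: (complex.Re _) (complex.Re _) (complex.Re _) => *; lra.
have yy : complex.Re (inner (D y) y) = l * nm y ^+ 2.
  move: cross; rewrite zD.2 innerBl ReB => /eqP; rewrite subr_eq0 => /eqP <-.
  have ey : inner e y = inner y y by rewrite [RHS](pvm_sym mB) pvm_idem.
  by rewrite De innerZl ReCl ey Re_inner.
have := formD y yD; rewrite pvm_integral => /(congr1 (@complex.Re R)).
rewrite yy pvm_measureT -EFinM => ->; rewrite fineK//.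
have /domD := yD; rewrite pvm_integral => sq.
have muT : (pvm_measure y setT < +oo)%E by rewrite pvm_measureT ltry.
exact: integrable_fin_num (integrable_id_of_sqr muT sq).
Qed.

Lemma pvm_eigen0 B (r : R) : measurable B -> r != 0 ->
  (forall t : R, B t -> 0 < r * (t - l)) -> E B e = 0.
Proof.
move=> mB r0 rB.
have [lD domD formD] := ID.
suff : pvm_measure (E B e) setT = 0%E.
  by rewrite pvm_measureT => -[/eqP]; rewrite sqrf_eq0 => /eqP/nm0_eq0.
apply: (measure0_of_mean mB _ _ r0 rB _ (pvm_eigen_mean mB)).
- rewrite [LHS]pvm_measureE; last exact: measurableC.
  by rewrite -pvmI ?setICl ?pvm0 ?nm0 ?expr0n//; exact: measurableC.
- by rewrite [ltLHS]pvm_measureT ltry.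
- by rewrite -pvm_integral; apply/domD; exact: pvm_dom_sub.
Qed.

(** The half-lines on both sides of [l] carry no mass of [e]; hence the projection E({l}) preserves
    the norm of [e] and so fixes it. *)
Lemma pvm_eigen1 : E [set l] e = e.
Proof.
have ml : measurable ([set l] : set (measurableTypeR R)) by exact: measurable_set1.
have mgt : measurable ([set t | l < t] : set (measurableTypeR R)).
  by rewrite -set_itvoy; exact: measurable_itv.
have mlt : measurable ([set t | t < l] : set (measurableTypeR R)).
  by rewrite -set_itvNyo; exact: measurable_itv.
have Egt : E [set t | l < t] e = 0.
  by apply: (@pvm_eigen0 _ 1) => // t /=; rewrite mul1r subr_gt0.
have Elt : E [set t | t < l] e = 0.
  apply: (@pvm_eigen0 _ (-1)) => [//||t /=]; first by rewrite oppr_eq0 oner_eq0.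
  by rewrite mulN1r opprB subr_gt0.
have : (pvm_measure e setT <= pvm_measure e [set l])%E.
  have -> : setT = [set l] `|` ([set t | l < t] `|` [set t | t < l]).
    apply/seteqP; split=> // t _ /=; have [lt|gt|->] := ltgtP t l; by [right;right|right;left|left].
  apply: le_trans (measureU2 _ ml (measurableU _ _ mgt mlt)) _.
  rewrite -[leRHS]adde0; apply: leeD => //.
  apply: le_trans (measureU2 _ mgt mlt) _.
  rewrite [X in (X + _ <= _)%E]pvm_measureE// [X in (_ + X <= _)%E]pvm_measureE//.
  by rewrite Egt Elt nm0 expr0n adde0.
rewrite pvm_measureT pvm_measureE// lee_fin => le_e.
apply/esym/eqP; rewrite -subr_eq0; apply/eqP/nm0_eq0/eqP.
rewrite -sqrf_eq0 eq_le sqr_ge0 andbT nm_sqrB.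
have -> : inner e (E [set l] e) = inner (E [set l] e) (E [set l] e).
  by rewrite [RHS](pvm_sym ml) pvm_idem.
rewrite Re_inner; by move: le_e; lra.
Qed.

Lemma pvm_eigen S : measurable S -> E S e = ((\1_S l)%:C)%C *: e.
Proof.
move=> mS; have ml : measurable ([set l] : set (measurableTypeR R)) by exact: measurable_set1.
rewrite -{1}pvm_eigen1 -pvmI// indicE; have [Sl|Sl] := boolP (l \in S).
  by rewrite setIC (setIidl _) ?pvm_eigen1 ?scale1r// => _ ->; rewrite -in_setE.
rewrite (_ : S `&` _ = set0) ?pvm0 ?scale0r//.
apply/seteqP; split=> // t [+ tl]; rewrite tl => /mem_set.
by rewrite (negPf Sl).
Qed.

End Uniqueness.

Section FunctionalCalculusDiag.
Context {R : realType} {H : hilbert R}.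
Variable (e : nat -> H) (l : nat -> R) (D : op H).
Hypotheses (eB : basis_seq e) (lD : op_diag e l D).

Lemma spectral_measure_eigen E : is_spectral_measure E D ->
  forall B, measurable B -> E B = eigen_pvm e l B.
Proof.
move=> [PE ID] B mB; apply/funext => x; apply: (basis_ext eB) => n.
have [eD De] := diag_basis eB lD n.
rewrite eigen_pvm_hat//.
have [/(_ B mB)[_ symB _] _ _ _] := PE.
rewrite symB (pvm_eigen PE ID (diag_sym eB lD) eD De)//.
by rewrite innerZr conj_realC.
Qed.

(** Consequently an integral over the spectrum sees every point mass of the spectral measure. *)
Lemma eigen_spectrum n : e n != 0 -> spectrum D (l n).
Proof.
move=> /eqP en [S [[lS _] _ SD]]; have [eD De] := diag_basis eB lD n.
by have := SD _ eD; rewrite De subrr (lin0 lS) => /esym.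
Qed.

(** Since a candidate exists, the choice in [fcalc] is a candidate and not the default value; since
    the spectral measure is unique, every candidate is diagonal. *)
Lemma fcalc_diag (f : R -> R) : op_diag e (f \o l) (fcalc D f).
Proof.
have specE : is_spectral_measure (eigen_pvm e l) D.
  by split; [exact: eigen_pvmP|exact: diag_spectral_integral].
pose T0 := diag e (f \o l).
have : exists T, [set T | exists2 E, is_spectral_measure E D &
                        is_spectral_integral E (spectrum D) f T] T.
  exists T0, (eigen_pvm e l) => //; apply: diag_spectral_integral => //.
    exact: eigen_spectrum.
  exact: diagP.
move=> /(xgetPex (Op set0 idfun))[E EM EI].
apply: (spectral_integral_diag eB eigen_spectrum).
have sE x B : measurable B -> scalar_measure E x B = scalar_measure (eigen_pvm e l) x B.
  by move=> mB; rewrite /scalar_measure (spectral_measure_eigen EM).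
have [lT domT formT] := EI; split => // [x|x xT].
  by rewrite domT (eq_setfun_integral _ _ (sE x)).
by rewrite formT// (eq_setfun_integral _ _ (sE x)).
Qed.

End FunctionalCalculusDiag.

(** * Diagonalisation of operators with compact resolvent *)

Section Riesz.
Context {R : realType} {H : hilbert R}.
Local Notation C := R[i].
Implicit Types x y z : H.

(* The representing vector minimises |x|^2 - 2 Re phi(x). *)
Lemma riesz_representation (phi : H -> C) (M : R) :
  (forall c x y, phi (c *: x + y) = c * phi x + phi y) ->
  (forall x, nm (phi x) <= M * nm x) -> exists v, forall x, phi x = inner x v.
Proof.
move=> lphi bphi.
have phi0 : phi 0 = 0.
  by have := lphi 1 0 0; rewrite scaler0 addr0 mul1r => /eqP; rewrite addrC -subr_eq subrr => /eqP.
have phiZ (c : C) x : phi (c *: x) = c * phi x.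
  by have := lphi c x 0; rewrite phi0 !addr0.
have phiD x y : phi (x + y) = phi x + phi y.
  by have := lphi 1 x y; rewrite scale1r mul1r.
pose F x := nm x ^+ 2 - 2 * complex.Re (phi x).
have Flb x : - M ^+ 2 <= F x.
  have := le_trans (Re_le_nm _) (bphi x); rewrite ler_norml => /andP[_].
  have := sqr_ge0 (nm x - M); rewrite /F; nra.
pose FS := [set F x | x in [set: H]].
have infF : has_inf FS.
  split; first by exists (F 0), 0.
  by exists (- M ^+ 2) => _ [x _ <-].
pose m := inf FS.
have Fm x : m <= F x by apply: ge_inf; [case: infF|exists x].
have near_inf (r : R) : 0 < r -> exists x, F x < m + r.
  by move=> r0; have [_ [x _ <-]] := inf_adherent r0 infF; exists x.
(* Parallelogram law: if x and y nearly minimise [F], their midpoint would undercut the infimum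
   unless they are close. *)
have half x y : F ((2^-1)%:C%C *: (x + y)) =
    (F x + F y) / 2 - nm (x - y) ^+ 2 / 4.
  rewrite /F phiZ phiD nmZ nmC ReCl ReD exprMn nm_sqrB nm_sqrD.
  have -> : `|2^-1 : R| = 2^-1 by rewrite ger0_norm.
  move: (nm x) (nm y) (complex.Re _) (complex.Re _) (complex.Re _) => *; lra.
have near_min : forall x y (r : R), F x < m + r -> F y < m + r -> nm (x - y) ^+ 2 < 4 * r.
  by move=> x y r Fx Fy; have := Fm ((2^-1)%:C%C *: (x + y)); rewrite half; lra.
have ex n : exists x, F x < m + n.+1%:R^-1 by apply: near_inf; rewrite invr_gt0.
have [u uP] := choice ex.
have archi (r : R) : 0 < r -> exists N, forall n, (N <= n)%N -> n.+1%:R^-1 < r.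
  move=> r0; exists (Num.truncn r^-1) => n Nn; rewrite -[ltRHS]invrK ltf_pV2 ?posrE ?invr_gt0//.
  apply: lt_le_trans (truncnS_gt _) _; by rewrite ler_nat.
have [|v vP] := @nm_complete _ _ u.
  move=> r r0; have r4 : 0 < r ^+ 2 / 4 by rewrite divr_gt0 ?exprn_gt0.
  have [N Nr] := archi _ r4.
  exists N => i j Ni Nj; rewrite -(@ltr_sqr _ (nm _)) ?nnegrE ?nm_ge0 ?(ltW r0)//.
  have -> : r ^+ 2 = 4 * (r ^+ 2 / 4) by field.
  apply: near_min.
    by apply: lt_trans (uP i) _; rewrite ltrD2l; exact: Nr.
  by apply: lt_trans (uP j) _; rewrite ltrD2l; exact: Nr.
exists v.
have Fv : F v <= m.
  apply/ler_addgt0Pr => r r0.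
  (* For |w - v| at most 1, F(v) - F(w) is at most 2 K |w - v|; the choice of [s] makes this at most
     r / 2, and the other r / 2 pays for w being only a near minimiser. *)
  pose K := nm v + `|M| + 2.
  have K0 : 0 < K by rewrite /K; have := nm_ge0 v; have := normr_ge0 M; lra.
  pose s := Num.min 1 (r / (4 * K)).
  have s0 : 0 < s by rewrite lt_min ltr01/= divr_gt0// mulr_gt0.
  have [N1 vN] := vP s s0.
  have r2 : 0 < r / 2 by rewrite divr_gt0.
  have [N2 Nr] := archi _ r2.
  pose n := maxn N1 N2.
  have un := uP n; have := Nr n (leq_maxr _ _); have := vN n (leq_maxl _ _).
  move=> vn rn.
  have s1 : s <= 1 by rewrite ge_min lexx.
  have s4 : s * (4 * K) <= r.
    by rewrite -ler_pdivlMr ?mulr_gt0// ge_min lexx orbT.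
  set w := u n in un vn.
  have := nm_ge0 (w - v); have wv1 : nm (w - v) <= 1 by apply: le_trans s1; exact: ltW.
  have phiwv : `|complex.Re (phi (w - v))| <= `|M| * nm (w - v).
    apply: le_trans (Re_le_nm _) _; apply: le_trans (bphi _) _.
    by rewrite ler_wpM2r ?nm_ge0// ler_norm.
  have : complex.Re (phi w) = complex.Re (phi (w - v)) + complex.Re (phi v).
    by rewrite -ReD -phiD subrK.
  have : nm v <= nm w + nm (w - v).
    by have := nm_triB w v 0; rewrite !subr0 nmBC addrC.
  have : nm w <= nm v + nm (w - v).
    by have := nm_triB v w 0; rewrite !subr0 addrC.
  move: un; rewrite /F; move: phiwv; rewrite ler_norml => /andP[].
  move: vn rn s4 wv1; rewrite /K; have := nm_ge0 v; have := nm_ge0 w; have := normr_ge0 M.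
  move: (nm v) (nm w) (nm (w - v)) `|M| (complex.Re (phi w)) (complex.Re (phi v)) (complex.Re (phi (w - v))) (n.+1%:R^-1).
  clear; move=> a b d M' p q t k.
  move=> M0 b0 a0 ds kr sK d1 t1 t2 Fu ba ab pq d0.
  have : (a - b) * (a + b) <= d * (2 * a + 1) by nra.
  nra.
have rphi x : complex.Re (phi x) = complex.Re (inner x v).
  have key (t : R) : 0 <= t ^+ 2 * nm x ^+ 2 + 2 * t * (complex.Re (inner x v) - complex.Re (phi x)).
    have := le_trans Fv (Fm (t%:C%C *: x + v)).
    rewrite /F phiD phiZ nm_sqrD nmZ nmC ReD ReCl innerZl ReCl exprMn real_normK ?num_real//.
    lra.
  set a := nm x ^+ 2 in key; set b := complex.Re (inner x v) - _ in key.
  have a0 : 0 <= a by exact: sqr_ge0.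
  have : b = 0.
    (* The denominator a + 1 replaces a, which may be 0; at this t the quadratic is negative unless
       b = 0. *)
    have := key (- b / (a + 1)).
    have -> : (- b / (a + 1)) ^+ 2 * a + 2 * (- b / (a + 1)) * b =
      - (b ^+ 2 * ((a + 2) / (a + 1) ^+ 2)) by field; rewrite gt_eqF// ltr_wpDl.
    rewrite oppr_ge0 pmulr_lle0; last first.
      by rewrite divr_gt0 ?exprn_gt0// ltr_wpDl.
    by move=> b0; apply/eqP; rewrite -sqrf_eq0 eq_le b0 sqr_ge0.
  by rewrite /b => /eqP; rewrite subr_eq0 => /eqP.
move=> x; have := rphi x; have := rphi ('i%C *: x).
rewrite phiZ innerZl.
case: (phi x) (inner x v) => [a b] [c d] /=; rewrite !mul0r !mul1r !sub0r => /oppr_inj -> ->.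
by [].
Qed.

Lemma adjoint_exists {K : hilbert R} (T : H -> K) : bounded_op T ->
  exists S, is_adjoint T S.
Proof.
move=> /bounded_opP[lT [M [M0 bT]]].
have ex (y : K) : exists v, forall x, inner (T x) y = inner x v.
  apply: (@riesz_representation (fun x => inner (T x) y) (M * nm y)).
    by move=> c x z; rewrite lT innerDl innerZl.
  move=> x; rewrite (le_trans (cauchy_schwarz _ _))// mulrAC.
  by rewrite ler_wpM2r ?nm_ge0.
have [S SP] := choice ex.
by exists S => x y; exact: SP.
Qed.

End Riesz.

Section Diagonalisation.
Context {R : realType} {H : hilbert R}.
Local Notation C := R[i].
Implicit Types (x y z : H) (B : set H).
Variables (D : op H) (S : H -> H).
Hypotheses (saD : self_adjoint D) (resS : is_resolvent D (- 'i%C) S)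
  (cS : compact_op S).

Let Dsym x y : dom D x -> dom D y -> inner (D x) y = inner x (D y).
Proof.
by have [_ _ sD] := saD => xD yD; have [_ /(_ (conj yD erefl))] := sD y (D y); exact.
Qed.

Let lS : linear S. Proof. by have [[]] := resS. Qed.

Let D_lin (c : C) x y : dom D x -> dom D y ->
  dom D (c *: x + y) /\ D (c *: x + y) = c *: D x + D y.
Proof. by have [[_ +] _ _] := saD; apply. Qed.

Let S_dom x : dom D (S x). Proof. by have [_ /(_ x)[]] := resS. Qed.

Let D_S x : D (S x) = x - 'i%C *: S x.
Proof.
have [_ /(_ x)[_] + _] := resS.
by rewrite scaleNr opprK => /(canRL (addrK _)).
Qed.

Let S_D x : dom D x -> S (D x + 'i%C *: x) = x.
Proof. by have [_ _ /(_ x)] := resS; rewrite scaleNr opprK. Qed.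

Let S_inj x : S x = 0 -> x = 0.
Proof.
move=> Sx; have := D_S x; rewrite Sx scaler0 subr0 => <-.
by have [lD _ _] := saD; exact: op_linear0.
Qed.

Section Adjoint.
Variable T : H -> H.
Hypothesis ST : is_adjoint S T.

(** By self-adjointness of D, the adjoint of (D + i)^-1 is (D - i)^-1. *)
Let T_dom x : dom D (T x) /\ D (T x) = x + 'i%C *: T x.
Proof.
have [_ _ sD] := saD; apply/sD => z zD.
have -> : inner z (x + 'i%C *: T x) = inner z x - 'i%C * inner z (T x).
  by rewrite innerDr innerZr conj_iC mulNr.
have -> : inner z x = inner (D z) (T x) + 'i%C * inner z (T x).
  by rewrite -{1}(S_D zD) ST innerDl innerZl.
by rewrite addrK.
Qed.

Let T_D x : dom D x -> T (D x - 'i%C *: x) = x.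
Proof.
move=> xD; apply: inner_ext => z; rewrite (adjoint_sym ST).
rewrite innerBl innerZl Dsym// D_S innerBr innerZr conj_iC mulNr opprK.
by rewrite addrK.
Qed.

Section Complement.
Variable B : set H.
Hypothesis BE : forall e, B e -> exists l : R, dom D e /\ D e = l%:C%C *: e.

Definition orth_compl : set H := [set x | forall e, B e -> inner x e = 0].
Local Notation W := orth_compl.

Lemma orth_compl_lin (c : C) x y : W x -> W y -> W (c *: x + y).
Proof.
by move=> Wx Wy e Be; rewrite innerDl innerZl Wx// Wy// mulr0 addr0.
Qed.

Let W_S x : W x -> W (S x).
Proof.
move=> Wx e Be; have [l [eD De]] := BE Be.
have := T_D eD; rewrite De -scalerBl (linZ (adjoint_linear ST)) => eE.
by rewrite ST -[X in _ = X](mulr0 (Num.conj (l%:C%C - 'i%C))^-1) -(Wx _ Be) -{2}eE innerZr mulKf//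
  fmorph_eq0 eq_complex/= subr0 sub0r oppr_eq0 oner_eq0 andbF.
Qed.

Let W_T x : W x -> W (T x).
Proof.
move=> Wx e Be; have [l [eD De]] := BE Be.
have := S_D eD; rewrite De -scalerDl (linZ lS) => eE.
by rewrite (adjoint_sym ST) -[X in _ = X](mulr0 (Num.conj (l%:C%C + 'i%C))^-1) -(Wx _ Be) -{2}eE innerZr mulKf//
  fmorph_eq0 eq_complex/= addr0 add0r oner_eq0 andbF.
Qed.

Let bT : exists2 M : R, 0 <= M & forall x, nm (T x) <= M * nm x.
Proof.
have [/bounded_opP[_ [M [M0 bS]]] _ _] := resS.
by exists M => // x; exact: (adjoint_nm ST M0 bS).
Qed.

(* y0 maximises |T y| on the closure of the image under S of the unit ball of W;
   the maximum m is then an eigenvalue of S T. *)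
Let eigen_ST x0 : W x0 -> x0 != 0 ->
  exists y (m : R), [/\ W y, y != 0, 0 < m & S (T y) = m%:C%C *: y].
Proof.
move=> Wx0 x00; have [M M0 MT] := bT; have lT := adjoint_linear ST.
pose A := S @` [set x | W x /\ nm x <= 1].
have W0 : W 0 by move=> e _; rewrite inner0l.
have A0 : A 0 by exists 0; [rewrite /= nm0|rewrite (lin0 lS)].
have pA : precompact A.
  have [_] := cS; apply: precompact_subset => _ [x [Wx x1] <-].
  by exists x => //=; rewrite nmE -[1]/(1%:C%C) lecR.
have lip x y : `|nm (T x) - nm (T y)| <= M * nm (x - y).
  apply: le_trans (MT _); rewrite (linB lT) ler_norml; apply/andP; split.
    by have := nm_triB (T x) (T y) 0; rewrite !subr0 nmBC; lra.
  by have := nm_triB (T y) (T x) 0; rewrite !subr0; lra.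
have [y y_cl ymax] := precompact_argmax A0 pA lip.
pose m := nm (T y).
have Wy : W y.
  move=> e Be; apply: nm0_eq0; apply/eqP; rewrite eq_le nm_ge0 andbT.
  apply/ler_addgt0Pr => r r0; rewrite add0r.
  have K0 : 0 < nm e + 1 by rewrite ltr_wpDl ?nm_ge0.
  have [_ [x [Wx x1] <-] yx] := closure_nm y_cl (divr_gt0 r0 K0).
  rewrite -[inner y e]subr0 -(W_S Wx Be) -innerBl.
  apply: le_trans (cauchy_schwarz _ _) _.
  have -> : r = r / (nm e + 1) * (nm e + 1) by rewrite divfK// gt_eqF.
  have := divr_gt0 r0 K0; have := nm_ge0 e; have := nm_ge0 (y - S x).
  by move: yx; nra.
have Sm x : W x -> nm (S x) ^+ 2 <= m * nm x ^+ 2.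
  move=> Wx; have [->|xn0] := eqVneq x 0.
    by rewrite (lin0 lS) nm0 expr0n mulr0.
  have nx : 0 < nm x.
    by rewrite nm_gt0.
  pose u := ((nm x)^-1)%:C%C *: x.
  have nu : nm u = 1 by rewrite nmZ nmC ger0_norm ?invr_ge0 ?nm_ge0// mulVf// gt_eqF.
  have Wu : W u by have := orth_compl_lin ((nm x)^-1)%:C%C Wx W0; rewrite addr0.
  have uS : nm (S u) ^+ 2 <= m.
    rewrite -Re_inner ST; apply: le_trans (Re_cauchy_schwarz _ _) _.
    rewrite nu mul1r; apply: ymax; exists u => //=; by rewrite nu.
  have xE : x = (nm x)%:C%C *: u.
    by rewrite scalerA -rmorphM/= mulfV ?gt_eqF// scale1r.
  clearbody u; rewrite xE (linZ lS) !nmZ nu mulr1 exprMn mulrC ler_wpM2r ?sqr_ge0//.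
have m0 : 0 < m.
  have Sx0 : S x0 != 0 by apply: contra_neq x00; exact: S_inj.
  have : 0 < nm (S x0) ^+ 2.
    by rewrite exprn_gt0// nm_gt0.
  move=> /lt_le_trans/(_ (Sm _ Wx0)); rewrite pmulr_lgt0//.
  by rewrite exprn_gt0// nm_gt0.
have ym : nm y ^+ 2 <= m.
  have ny : nm y <= Num.sqrt m.
    apply/ler_addgt0Pr => r r0; have [_ [x [Wx x1] <-] yx] := closure_nm y_cl r0.
    have Sxm : nm (S x) <= Num.sqrt m.
      rewrite -(@ler_sqr _ (nm _)) ?nnegrE ?nm_ge0 ?sqrtr_ge0// sqr_sqrtr ?(ltW m0)//.
      apply: le_trans (Sm _ Wx) _; rewrite ler_piMr ?(ltW m0)//.
      by rewrite expr_le1// nm_ge0.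
    have := nm_triB (S x) y 0; rewrite !subr0; lra.
  rewrite -[leRHS]sqr_sqrtr ?(ltW m0)//.
  by rewrite lerXn2r ?nnegrE ?nm_ge0 ?sqrtr_ge0.
exists y, m; split => //.
  by apply/eqP => y0; move: m0; rewrite /m y0 (lin0 lT) nm0 ltxx.
(* The square of |S T y - m y| is at most m^3 + m^3 - 2 m^3, by [Sm] at T y, by [ym] and by <S T y,
   y> = |T y|^2 = m^2. *)
apply/eqP; rewrite -subr_eq0; apply/eqP/nm0_eq0/eqP.
rewrite -sqrf_eq0 eq_le sqr_ge0 andbT nm_sqrB nmZ nmC innerZr conj_realC ReCl.
rewrite ST Re_inner -/m ger0_norm ?(ltW m0)// exprMn.
have := Sm _ (W_T Wy); rewrite -/m.
have : m * (m * nm y ^+ 2) <= m * (m * m) by rewrite !ler_wpM2l ?(ltW m0).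
move: (nm (S (T y))) (nm y) => *; nra.
Qed.

(** S T is (D^2 + 1)^-1, so its eigenvector satisfies D^2 y = d^2 y with d^2 = m^-1 - 1. As (D +
    d)(D - d) y = 0, either y itself or w = (D - d) y is an eigenvector of D. *)
Lemma eigenvector_exists x0 : W x0 -> x0 != 0 ->
  exists v (l : R), [/\ W v, nm v = 1, dom D v & D v = l%:C%C *: v].
Proof.
move=> Wx0 x00; have [y [m [Wy y0 m0 STy]]] := eigen_ST Wx0 x00.
suff [v [l [Wv v0 vD Dv]]] : exists v (l : R), [/\ W v, v != 0, dom D v & D v = l%:C%C *: v].
  have W0 : W 0 by move=> e _; rewrite inner0l.
  have [[D0 _] _ _] := saD.
  have nv : 0 < nm v.
    by rewrite nm_gt0.
  pose c := (nm v)^-1%:C%C.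
  have [cD cE] := D_lin c vD D0.
  have D00 : D 0 = 0 by have [lD _ _] := saD; exact: op_linear0.
  rewrite D00 !addr0 in cD cE.
  exists (c *: v), l; split => //.
  - by have := orth_compl_lin c Wv W0; rewrite addr0.
  - by rewrite nmZ nmC ger0_norm ?invr_ge0 ?nm_ge0// mulVf// gt_eqF.
  - by rewrite cE Dv !scalerA mulrC.
have yE : y = m^-1%:C%C *: S (T y).
  by rewrite STy scalerA -rmorphM/= mulVf ?scale1r// gt_eqF.
have lT := adjoint_linear ST.
have yD : dom D y.
  by have [+ _] := D_lin m^-1%:C%C (S_dom (T y)) (S_dom 0); rewrite (lin0 lS) addr0 -yE.
have [[D0 _] _ _] := saD.
have D00 : D 0 = 0 by have [lD _ _] := saD; exact: op_linear0.
have Dy : D y = m^-1%:C%C *: T y - 'i%C *: y.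
  have [_] := D_lin m^-1%:C%C (S_dom (T y)) D0.
  rewrite D00 !addr0 -yE D_S scalerBr scalerA mulrC -scalerA -yE. by [].
have [Ty DTy] := T_dom y.
have [iyD iyE] := D_lin (- 'i%C) yD D0.
rewrite D00 !addr0 in iyD iyE.
have [DyD DDy] := D_lin m^-1%:C%C Ty iyD.
have DyE : m^-1%:C%C *: T y + (- 'i%C) *: y = D y by rewrite scaleNr -Dy.
rewrite DyE in DyD DDy; rewrite iyE DTy in DDy.
pose d2 := m^-1 - 1.
have {}DDy : D (D y) = d2%:C%C *: y.
  have e1 : - 'i%C * m^-1%:C%C = - (m^-1%:C%C * 'i%C) :> C by rewrite mulNr mulrC.
  have e2 : - 'i%C * 'i%C = 1 :> C by rewrite mulNr mul_iC opprK.
  rewrite DDy Dy scalerBr scalerDr !scalerA e1 e2 scale1r [X in _ + X]addrC addrACA.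
  by rewrite -scalerDl subrr scale0r addr0 rmorphB/= rmorph1 scalerBl scale1r.
have d20 : 0 <= d2.
  have : 0 <= complex.Re (inner (D (D y)) y).
    by rewrite Dsym// Re_inner sqr_ge0.
  rewrite DDy innerZl ReCl Re_inner pmulr_lge0//.
  by rewrite exprn_gt0// nm_gt0.
pose d := Num.sqrt d2.
have dd : d%:C%C * d%:C%C = d2%:C%C by rewrite -rmorphM/= -expr2 sqr_sqrtr.
have [wD wE] := D_lin (- d%:C%C) yD DyD.
set w := - d%:C%C *: y + D y in wD wE.
have [w0|w0] := eqVneq w 0.
  exists y, d; split => //; move/eqP: w0.
  by rewrite /w scaleNr addrC subr_eq0 => /eqP.
exists w, (- d); split => //.
- apply: orth_compl_lin => //; rewrite Dy addrC -scaleNr.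
  apply: orth_compl_lin => //.
  have := orth_compl_lin m^-1%:C%C (W_T Wy) (fun e _ => inner0l e).
  by rewrite addr0.
- by rewrite wE DDy /w scalerDr rmorphN/= scalerA mulrNN dd addrC.
Qed.

End Complement.
End Adjoint.
End Diagonalisation.

Section Enumeration.
Context {R : realType} {H : hilbert R}.
Implicit Types (x y z : H) (B X : set H).

(** Two points of [X] assigned to the same centre of a finite r / 2-net would have images closer
    than r; so [X] injects into the net. *)
Lemma separated_finite (T : H -> H) X (r : R) : totally_bounded (T @` X) -> 0 < r ->
  (forall x y, X x -> X y -> x != y -> r <= nm (T x - T y)) -> finite_set X.
Proof.
move=> tX r0 sepX; have [s sP] := tX (r / 2) (divr_gt0 r0 (ltr0n _ 2)).
have exf x : exists y, X x -> y \in s /\ nm (T x - y) < r / 2.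
  have [Xx|nXx] := pselect (X x); last by exists 0.
  by have [|y ys yx] := sP (T x); [exists x|exists y].
have [f fP] := choice exf.
have injf : {in X &, injective f}.
  move=> x y; rewrite !inE => Xx Xy fxy; apply/eqP/negPn/negP => xy.
  have [_ xf] := fP _ Xx; have [_] := fP _ Xy; rewrite -fxy => yf.
  have := sepX _ _ Xx Xy xy; rewrite leNgt => /negP; apply.
  rewrite (splitr r); apply: le_lt_trans (nm_triB (f x) _ _) _.
  by rewrite [nm (f x - _)]nmBC ltrD.
rewrite -(eq_finite_set (inj_card_eq injf)).
apply: (@sub_finite_set _ _ [set` s]); last exact: finite_seq.
by move=> _ [x Xx <-] /=; have [] := fP x Xx.
Qed.

Definition enumerates (e : nat -> H) B :=
  [/\ forall n, e n != 0 -> B (e n), forall b, B b -> exists n, e n = b &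
      forall m n, e m != 0 -> e m = e n -> m = n].

Lemma basis_enumeration B : countable B -> (forall b, B b -> nm b = 1) ->
  (forall b b', B b -> B b' -> b != b' -> inner b b' = 0) ->
  (forall x, (forall b, B b -> inner x b = 0) -> x = 0) ->
  exists2 e : nat -> H, basis_seq e & enumerates e B.
Proof.
move=> /countable_injP[phi phi_inj] B1 Borth Bc.
pose E n x := B x /\ phi x = n.
have Euniq n x y : E n x -> E n y -> x = y.
  by move=> [Bx px] [By py]; apply: phi_inj; rewrite ?inE// px py.
(* Numbers that are not the code of an element of [B] get the entry 0. *)
have exe n : exists x, (E n x) \/ (x = 0 /\ forall y, ~ E n y).
  have [[x Ex]|nE] := pselect (exists x, E n x); first by exists x; left.
  by exists 0; right; split=> // y Ey; apply: nE; exists y.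
have [e eP] := choice exe.
have eE n : e n != 0 -> E n (e n) by case: (eP n) => // -[->]; rewrite eqxx.
have eb b : B b -> e (phi b) = b.
  move=> Bb; have [Eb|[_ /(_ b)]] := eP (phi b); last by case.
  exact: Euniq Eb _.
exists e; last first.
  split=> [n /eE[]//|b /eb bE|m n em emn]; first by exists (phi b).
  have [_ <-] := eE m em; have [|_ <-] := eE n; first by rewrite -emn.
  by rewrite emn.
split=> [i j|x xe].
  have [->|ij] := eqVneq i j => /=.
    have [->|ej] := eqVneq (e j) 0; first by rewrite inner0l.
    by rewrite innerE (B1 _ (eE j ej).1) expr1n.
  have [->|ei] := eqVneq (e i) 0; first by rewrite inner0l.
  have [->|ej] := eqVneq (e j) 0; first by rewrite inner0r.
  apply: Borth; [exact: (eE i ei).1|exact: (eE j ej).1|].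
  apply: contra_neq ij => eij.
  by have [_ <-] := eE i ei; have [_ <-] := eE j ej; rewrite eij.
by apply: Bc => b Bb; rewrite -(eb b Bb).
Qed.

End Enumeration.

Section Eigenbasis.
Context {R : realType} {H : hilbert R}.
Local Notation C := R[i].
Implicit Types (x y z : H) (B : set H).
Variables (D : op H).
Hypotheses (saD : self_adjoint D) (cD : compact_resolvent D).

Definition orthonormal_eigenvectors B : Prop :=
  (forall e, B e -> nm e = 1 /\ exists l : R, dom D e /\ D e = l%:C%C *: e) /\
  (forall e e', B e -> B e' -> e != e' -> inner e e' = 0).

(** A maximal orthonormal set of eigenvectors is total, since a nonzero orthogonal complement would
    contain a further eigenvector. *)
Lemma eigenbasis_exists : exists B, orthonormal_eigenvectors B /\
  forall x, (forall e, B e -> inner x e = 0) -> x = 0.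
Proof.
have [F FP totF|B [BP Bmax]] := @Zorn_bigcup _ orthonormal_eigenvectors.
  split=> [e [X FX Xe]|e e' [X FX Xe] [Y FY Ye']]; first exact: (FP _ FX).1.
  have [XY|YX] := totF _ _ FX FY.
    exact: ((FP _ FY).2 _ _ (XY _ Xe) Ye').
  exact: ((FP _ FX).2 _ _ Xe (YX _ Ye')).
exists B; split=> // x xB; apply/eqP/negPn/negP => x0.
have [S resS cS] := cD.
have [T ST] := adjoint_exists (let: And3 bS _ _ := resS in bS).
have BE e : B e -> exists l : R, dom D e /\ D e = l%:C%C *: e by move=> /BP.1[].
have [v [l [Wv v1 vD Dv]]] := eigenvector_exists saD resS cS ST BE xB x0.
have nBv : ~ B v.
  move=> Bv; have := Wv v Bv; rewrite innerE v1 expr1n => /eqP.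
  by rewrite eq_complex/= oner_eq0.
apply: (Bmax (B `|` [set v])).
  split=> [e|]; first by left.
  by move=> /(_ v); apply: contra_not nBv; apply; right.
split=> [e [/BP.1//|->]|e e' [Be|->] [Be'|->]]; first by split=> //; exists l.
- exact: BP.2.
- by move=> _; rewrite innerC Wv// conjC0.
- by move=> _; exact: Wv.
- by rewrite eqxx.
Qed.

(* Orthogonal eigenvectors with small eigenvalues are mapped by the compact
   resolvent to points that stay far apart. *)
Lemma eigenvalues_discrete B (l : H -> R) : orthonormal_eigenvectors B ->
  (forall e, B e -> dom D e /\ D e = (l e)%:C%C *: e) ->
  forall M : R, finite_set (B `&` [set e | `|l e| <= M]).
Proof.
move=> BP lP M; have [S resS [lS cS]] := cD.
have [bS _ SD] := resS.
have Se e : B e -> S e = ((l e)%:C + 'i)%C^-1 *: e.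
  move=> Be; have [eD De] := lP e Be; have := SD e eD.
  rewrite De scaleNr opprK -scalerDl (linZ lS).
  move=> /(congr1 (fun z => ((l e)%:C + 'i)%C^-1 *: z)).
  rewrite scalerA mulVf ?scale1r//.
  by rewrite eq_complex/= addr0 add0r oner_eq0 andbF.
pose K := Num.max M 0 ^+ 2 + 1.
have K0 : 0 < K by rewrite ltr_wpDl ?sqr_ge0.
have nS e : B e -> `|l e| <= M -> K^-1 <= nm (S e) ^+ 2.
  move=> Be leM; rewrite Se// nmZ (BP.1 _ Be).1 mulr1.
  rewrite nm_resolvent_sqr lef_pV2 ?posrE ?ltr_wpDl ?sqr_ge0// lerD2r -real_normK ?num_real//.
  rewrite lerXn2r ?nnegrE//; last by rewrite le_max leM.
  by rewrite le_max lexx orbT.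
apply: (@separated_finite _ _ S _ (Num.sqrt K^-1)).
- move=> r r0; have [s sP] := precompact_tb cS r0; exists s => _ [e [Be _] <-].
  by apply: sP; exists e => //=; rewrite nmE -[1]/(1%:C%C) lecR (BP.1 _ Be).1.
- by rewrite sqrtr_gt0 invr_gt0.
move=> e e' [Be le_] [Be' le_'] ee'.
rewrite -(@ler_sqr _ _ (nm _)) ?nnegrE ?nm_ge0 ?sqrtr_ge0//.
rewrite sqr_sqrtr ?invr_ge0 ?(ltW K0)// nm_sqrB.
have -> : inner (S e) (S e') = 0.
  by rewrite !Se// innerZl innerZr (BP.2 _ _ Be Be')// !mulr0.
have := nS e Be le_; have := nS e' Be' le_'; have := sqr_ge0 (nm (S e)); lra.
Qed.

Lemma eigen_sequence : exists (e : nat -> H) (l : nat -> R),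
  [/\ basis_seq e, op_diag e l D &
      forall M : R, exists N, forall n, (N <= n)%N -> M < `|l n|].
Proof.
have [B [BP Bc]] := eigenbasis_exists.
have exl x : exists l : R, B x -> dom D x /\ D x = l%:C%C *: x.
  have [Bx|nBx] := pselect (B x); last by exists 0.
  by have [_ [l lP]] := BP.1 _ Bx; exists l.
have [lam lamP] := choice exl.
have fin := eigenvalues_discrete BP lamP.
have cB : countable B.
  rewrite (_ : B = \bigcup_n (B `&` [set e | `|lam e| <= n%:R])).
    by apply: bigcup_countable => // n _; apply: finite_set_countable; exact: fin.
  apply/seteqP; split=> [x Bx|x [n _ []]//].
  exists (Num.truncn `|lam x|).+1 => //; split=> //=.
  by apply/ltW; exact: truncnS_gt.
have [e eB [eE esurj einj]] := basis_enumeration cB (fun b Bb => (BP.1 b Bb).1) BP.2 Bc.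
(* At a zero entry any eigenvalue is correct; the value n keeps |l n| tending to infinity even if
   only finitely many entries are nonzero. *)
pose l n := if e n == 0 then n%:R else lam (e n).
have eD n : dom D (e n) /\ D (e n) = (l n)%:C%C *: e n.
  rewrite /l; have [en0|en] := eqVneq (e n) 0; last exact: lamP (eE n en).
  by rewrite en0 scaler0; have [lD _ _] := saD; split; [exact: lD.1|exact: op_linear0].
have Dsym x y : dom D x -> dom D y -> inner (D x) y = inner x (D y).
  have [_ _ sD] := saD => xD yD; have [_ /(_ (conj yD erefl))] := sD y (D y); exact.
have DE x n : dom D x -> inner (D x) (e n) = (l n)%:C%C * inner x (e n).
  move=> xD; have [enD De] := eD n; rewrite Dsym// De innerZr conj_realC. by [].
have diagP' := diagP eB l.
exists e, l; split=> //.
  split=> [x|x xD n]; last exact: DE.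
  split=> [xD|xs].
    by apply/diagP'.1; apply: (diag_dom eB diagP' (y := D x)) => n; exact: DE.
  have xD' : dom (diag e l) x by exact/diagP'.1.
  have [_ _ sD] := saD.
  (* The maximal diagonal operator is a symmetric extension of D; self-adjointness of D leaves no
     room for a proper one. *)
  apply: (iffLR (sD x (diag e l x)) _).1 => u uD.
  have uD' : dom (diag e l) u by apply: (diag_dom eB diagP' (y := D u)) => n; exact: DE.
  rewrite -(diag_sym eB diagP')//; congr (inner _ x).
  by apply/esym; apply: (diag_ext eB diagP') => // n; exact: DE.
move=> M; have /finite_seqP[s sE] := fin M.
have expsi b : exists n, B b -> e n = b.
  by have [/esurj[n nb]|nBb] := pselect (B b); [exists n|exists 0].
have [psi psiP] := choice expsi.
(* Past the first number the zero entries have eigenvalue above M; past the second, none of the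
   finitely many eigenvectors with eigenvalue at most M in modulus occurs. *)
exists (maxn (Num.truncn M).+1 (\max_(x <- s) (psi x).+1)) => n.
rewrite geq_max => /andP[nM ns]; rewrite /l; have [en0|en] := eqVneq (e n) 0.
  rewrite normr_nat; apply: lt_le_trans (truncnS_gt M) _.
  by rewrite ler_nat.
rewrite ltNge; apply/negP => lM.
have Be := eE n en.
have pe : n = psi (e n) by apply: einj => //; rewrite psiP.
have : e n \in s by have : [set` s] (e n) by rewrite -sE.
move=> /(@leq_bigmax_seq _ _ xpredT (fun x => (psi x).+1))/(_ isT).
by rewrite -pe leqNgt => /negP; apply; rewrite ltnS.
Qed.

End Eigenbasis.

(** * Boundedness of the commutators *)

Section LogarithmicMultiplier.
Context {R : realType}.
Local Notation C := R[i].

Lemma is_derive_log_inv (a b p t : R) : 0 < p + t ->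
  is_derive t 1 (fun s => a * ln (p + s) - b * (p + s)^-1)
    (a * (p + t)^-1 + b * (p + t)^-1 ^+ 2).
Proof.
move=> pt.
have dp : is_derive t 1 (fun s => p + s) 1.
  by have := is_deriveD (is_derive_cst p t 1) (is_derive_id t 1); rewrite add0r.
have dln : is_derive t 1 (fun s => ln (p + s)) (p + t)^-1.
  have := @is_derive1_comp R (@ln R) (fun s => p + s) t _ _ (is_derive1_ln pt) dp.
  by rewrite mulr1.
have dV : is_derive t 1 (fun s => (p + s)^-1) (- (p + t)^-1 ^+ 2).
  have := @is_deriveV R (fun s => p + s) t 1 1 (lt0r_neq0 pt) dp.
  by rewrite -exprVn -[_ *: 1]/(_ * 1) mulr1.
have := is_deriveB (is_deriveZ a dln) (is_deriveZ b dV).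
by rewrite -![_ *: _]/(_ * _) mulrN opprK.
Qed.

Section RealEstimate.
Variables (N : nat) (z : 'I_N -> 'I_N -> R) (p w : 'I_N -> R) (K : R).
Hypotheses (p0 : forall i, 0 < p i) (w0 : forall i, 0 <= w i) (K0 : 0 <= K).
Hypothesis zK : forall t : R, 0 < t ->
  - (\sum_i \sum_j z i j * ((p i + t)^-1 - (p j + t)^-1)) <=
    K * \sum_k w k * p k * (p k + t)^-1 ^+ 2.

(** Regrouped by index, the double sum of differences becomes a single sum with weights [a]. The
    term [b] is chosen so that [zK] says exactly that the sum of the [h k] has nonnegative
    derivative. *)
Let a k := \sum_j z k j - \sum_i z i k.
Let b k := K * w k * p k.
Let h k t := a k * ln (p k + t) - b k * (p k + t)^-1.

Let sum_a (f : 'I_N -> R) :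
  \sum_k a k * f k = \sum_i \sum_j z i j * (f i - f j).
Proof.
under [RHS]eq_bigr do under eq_bigr do rewrite mulrBr.
under [RHS]eq_bigr do rewrite sumrB -mulr_suml.
rewrite sumrB [X in _ - X]exchange_big/=.
under [X in _ - X]eq_bigr do rewrite -mulr_suml.
by rewrite -sumrB; apply: eq_bigr => k _; rewrite /a mulrBl.
Qed.

(* The sum over k of h k t is nondecreasing in t by zK and tends to 0 as t tends
   to +oo, so it is at most 0 at t = 0. *)
Lemma log_estimate :
  \sum_i \sum_j z i j * (ln (p i) - ln (p j)) <= K * \sum_k w k.
Proof.
pose G : R -> R := \sum_(k < N) h k.
have GE t : G t = \sum_k h k t by rewrite /G fct_sumE.
have pt k (t : R) : 0 <= t -> 0 < p k + t by move=> t0; rewrite ltr_pwDl.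
have dG (t : R) : 0 <= t -> is_derive t 1 G
    (\sum_k (a k * (p k + t)^-1 + b k * (p k + t)^-1 ^+ 2)).
  by move=> t0; apply: is_derive_sum => k; apply: is_derive_log_inv; exact: pt.
have Gmono (t : R) : 0 <= t -> G 0 <= G t.
  move=> t0; apply: (@ger0_derive1_ndecry _ G 0) => // [s|s|].
  - rewrite in_itv/= andbT => s0; by case: (dG s (ltW s0)).
  - rewrite in_itv/= andbT => s0; rewrite derive1E; have [_ ->] := dG s (ltW s0).
    rewrite big_split/= sum_a; have := zK s0.
    rewrite -subr_ge0 opprK addrC mulr_sumr; congr (_ <= _ + _).
    by apply: eq_bigr => k _; rewrite /b !mulrA.
  - apply: derivable_within_continuous => s; rewrite in_itv/= andbT => s0.
    by case: (dG s s0).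
have ln_le (x y t : R) : 0 < t -> t <= x -> t <= y -> ln x - ln y <= `|x - y| / t.
  move=> t0 tx ty; have x0 := lt_le_trans t0 tx; have y0 := lt_le_trans t0 ty.
  rewrite -ln_div ?posrE//.
  have -> : x / y = 1 + (x - y) / y by rewrite mulrBl divff ?gt_eqF// addrC subrK.
  apply: (@le_trans _ _ ((x - y) / y)).
    by apply: le_ln1Dx; rewrite mulrBl divff ?gt_eqF// ltrBrDr addNr divr_gt0.
  apply: (@le_trans _ _ (`|x - y| / y)).
    by rewrite ler_wpM2r ?invr_ge0 ?(ltW y0)// ler_norm.
  by rewrite ler_wpM2l// lef_pV2.
pose M := \sum_i \sum_j `|z i j| * `|p i - p j|.
have M0 : 0 <= M by apply: sumr_ge0 => i _; apply: sumr_ge0 => j _; rewrite mulr_ge0.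
(* The logarithms enter only through differences ln (p i + t) - ln (p j + t), which are O(1 / t);
   the terms with [b] are subtracted and nonnegative. *)
have Gbound (t : R) : 0 < t -> G t <= M / t.
  move=> t0; rewrite GE /h sumrB sum_a lerBlDr; apply: (@le_trans _ _ (M / t)).
    rewrite mulr_suml; apply: ler_sum => i _; rewrite mulr_suml; apply: ler_sum => j _.
    apply: le_trans (ler_norm _) _; rewrite normrM -mulrA ler_wpM2l// ler_norml.
    have ti : t <= p i + t by rewrite lerDr ltW.
    have tj : t <= p j + t by rewrite lerDr ltW.
    have := ln_le _ _ _ t0 ti tj; have := ln_le _ _ _ t0 tj ti.
    have -> : p i + t - (p j + t) = p i - p j by ring.
    have -> : p j + t - (p i + t) = - (p i - p j) by ring.
    rewrite normrN => ? ?; apply/andP; split => //; lra.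
  rewrite lerDl; apply: sumr_ge0 => k _.
  by rewrite /b !mulr_ge0// ?ltW// invr_gt0 pt ?ltW.
have : G 0 <= 0.
  apply/ler_addgt0Pr => r r0; rewrite add0r.
  have t0 : 0 < (M + 1) / r by rewrite divr_gt0// ltr_wpDl.
  apply: le_trans (Gmono _ (ltW t0)) _; apply: le_trans (Gbound _ t0) _.
  rewrite invf_div mulrCA ler_piMr ?(ltW r0)// ler_pdivrMr ?ltr_wpDl//.
  by rewrite mul1r lerDl.
rewrite GE /h sumrB subr_le0.
under eq_bigr do rewrite addr0.
rewrite sum_a => /le_trans; apply.
rewrite mulr_sumr le_eqVlt; apply/orP; left; apply/eqP; apply: eq_bigr => k _.
by rewrite /b addr0 mulfK// gt_eqF.
Qed.

End RealEstimate.
End LogarithmicMultiplier.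

Section DiagonalComparison.
Context {R : realType} {H : hilbert R}.
Local Notation C := R[i].
Variable e : nat -> H.
Hypothesis eB : basis_seq e.
Implicit Types (x y z : H) (f g l : nat -> R).

Lemma nm_hat_le x y : (forall i, nm (inner x (e i)) <= nm (inner y (e i))) -> nm x <= nm y.
Proof.
move=> xy; apply: (parseval_le eB) => [N|]; last exact: nm_ge0.
apply: le_trans (bessel eB N y); apply: ler_sum => i _.
by rewrite lerXn2r ?nnegrE ?nm_ge0.
Qed.

Lemma diag_dom_le f g T S x : op_diag e f T -> op_diag e g S ->
  (forall i, `|f i| <= `|g i|) -> dom S x -> dom T x.
Proof.
move=> fT gS fg /gS.1 xs; apply/fT.1; apply: summable_le xs => i.
rewrite ler_wpM2r ?sqr_ge0// -(real_normK (num_real (f i))).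
by rewrite -(real_normK (num_real (g i))) lerXn2r ?nnegrE.
Qed.

Lemma diag_nm_le f g T S x : op_diag e f T -> op_diag e g S ->
  (forall i, `|f i| <= `|g i|) -> dom S x -> nm (T x) <= nm (S x).
Proof.
move=> fT gS fg xS; have xT := diag_dom_le fT gS fg xS.
apply: nm_hat_le => i; rewrite fT.2// gS.2// !nmM !nmC.
by rewrite ler_wpM2r ?nm_ge0.
Qed.

Lemma diag_dom_mul f g h T S x : op_diag e f T -> op_diag e g S ->
  op_diag e (fun i => f i * g i) h -> dom S x -> dom h x ->
  dom T (S x) /\ T (S x) = h x.
Proof.
move=> fT gS hS xS xh.
have E i : inner (h x) (e i) = (f i)%:C%C * inner (S x) (e i).
  by rewrite hS.2// gS.2// rmorphM mulrA.
by split; [exact: (diag_dom eB fT E)|apply: (diag_ext eB fT _ E); exact: (diag_dom eB fT E)].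
Qed.

Definition vec N (c : nat -> C) : H := \sum_(i < N) c i *: e i.

Lemma vec_diag l D N (f : nat -> R) (c : nat -> C) : op_diag e l D ->
  dom D (vec N (fun i => (f i)%:C%C * c i)) /\
  D (vec N (fun i => (f i)%:C%C * c i)) = vec N (fun i => (l i * f i)%:C%C * c i).
Proof.
move=> lD; have [D0 lin] := diag_op_linear eB lD.
rewrite /vec; elim: N => [|N [IHd IHD]].
  by rewrite !big_ord0; split=> //; exact: (op_linear0 (conj D0 lin)).
rewrite !big_ord_recr/= ![\sum_(i < N) _ + _]addrC.
have [eD De] := diag_basis eB lD N.
have [dd ->] := lin ((f N)%:C%C * c N) _ _ eD IHd.
by split=> //; rewrite IHD De scalerA; congr (_ *: _ + _); rewrite rmorphM; ring.
Qed.

Lemma inner_vec (a : H -> H) N (c d : nat -> C) : linear a ->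
  inner (a (vec N c)) (vec N d) =
  \sum_(i < N) \sum_(j < N) inner (a (e j)) (e i) * (c j * Num.conj (d i)).
Proof.
move=> la; rewrite inner_sumr; apply: eq_bigr => i _.
rewrite /vec (lin_sum la) inner_suml; apply: eq_bigr => j _.
by rewrite (linZ la) innerZl innerZr; ring.
Qed.

Lemma nm_vec_sqr N (f : nat -> R) x :
  nm (vec N (fun i => (f i)%:C%C * inner x (e i))) ^+ 2 =
  \sum_(i < N) f i ^+ 2 * nm (inner x (e i)) ^+ 2.
Proof.
rewrite (nm_sum_sqr_ord eB) => [|i ei]; last by rewrite ei inner0r mulr0.
by apply: eq_bigr => i _; rewrite nm_diag_hat.
Qed.

End DiagonalComparison.

Section LogCommutator.
Context {R : realType} {H : hilbert R}.
Local Notation C := R[i].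
Implicit Types (x y z : H).
Variables (e : nat -> H) (l : nat -> R) (absD L : op H).
Hypotheses (eB : basis_seq e) (absP : op_diag e (fun i => `|l i|) absD)
  (LP : op_diag e (fun i => ln (1 + `|l i|)) L).
Let mu i := 1 + `|l i|.
Let mu0 i : 0 < mu i. Proof. by rewrite ltr_pwDl. Qed.
Let Delta := diag e mu.
Let DeltaP : op_diag e mu Delta := diagP eB mu.

Lemma Delta_dom x : dom absD x -> dom Delta x /\ Delta x = absD x + x.
Proof.
move=> xD; have E i : inner (absD x + x) (e i) = (mu i)%:C%C * inner x (e i).
  by rewrite innerDl absP.2// /mu rmorphD/= mulrDl rmorph1 mul1r addrC.
by split; [exact: (diag_dom eB DeltaP E)|apply: (diag_ext eB DeltaP _ E); exact: (diag_dom eB DeltaP E)].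
Qed.

Lemma absD_dom x : dom Delta x -> dom absD x.
Proof.
apply: (diag_dom_le absP DeltaP) => i.
by rewrite normr_id (ger0_norm (ltW (mu0 i))) /mu lerDr.
Qed.

Section TwistedBound.
Variables (a s : H -> H) (M Ma Ms : R).
Hypotheses (M0 : 0 <= M) (Ma0 : 0 <= Ma) (Ms0 : 0 <= Ms)
  (aM : forall x, nm (a x) <= Ma * nm x) (sM : forall x, nm (s x) <= Ms * nm x)
  (a_dom : forall x, dom absD x -> dom absD (a x))
  (aD : forall x, dom absD x -> nm (absD (a x) - s (absD x)) <= M * nm x).

(** |D| a x is within M |x| of s(|D| x), and |x| and the norm of |D| x are both at most that of
    Delta x. This gives an untwisted bound for Delta a Delta^-1. *)
Lemma twisted_bound x : dom absD x -> nm (Delta (a x)) <= (M + Ms + Ma) * nm (Delta x).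
Proof.
move=> xD; have [xd Dx] := Delta_dom xD.
have [axd ->] := Delta_dom (a_dom xD).
have x1 : nm x <= nm (Delta x).
  apply: (nm_hat_le eB) => i; rewrite DeltaP.2// nmM nmC ler_peMl ?nm_ge0//.
  by rewrite (ger0_norm (ltW (mu0 i))) /mu lerDl.
have x2 : nm (absD x) <= nm (Delta x).
  apply: (diag_nm_le eB absP DeltaP) => // i.
  by rewrite normr_id (ger0_norm (ltW (mu0 i))) /mu lerDr.
apply: le_trans (nmD _ _) _.
have t1 := nm_triB (s (absD x)) (absD (a x)) 0; rewrite !subr0 in t1.
have t2 := aD xD; have t3 := sM (absD x); have t4 := aM x.
have : M * nm x <= M * nm (Delta x) by rewrite ler_wpM2l.
have : Ms * nm (absD x) <= Ms * nm (Delta x) by rewrite ler_wpM2l.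
have : Ma * nm x <= Ma * nm (Delta x) by rewrite ler_wpM2l.
lra.
Qed.

End TwistedBound.

Section AdjointPair.
Variables (a b : H -> H) (Ka Kb : R).
Hypotheses (ab : is_adjoint a b) (la : linear a) (Ka0 : 0 <= Ka) (Kb0 : 0 <= Kb)
  (a_dom : forall x, dom absD x -> dom absD (a x))
  (b_dom : forall x, dom absD x -> dom absD (b x))
  (aK : forall x, dom absD x -> nm (Delta (a x)) <= Ka * nm (Delta x))
  (bK : forall x, dom absD x -> nm (Delta (b x)) <= Kb * nm (Delta x)).
Let K := (Ka + Kb) / 2.

(* log_estimate with p i = mu i ^ 2 and w i = |x_i|^2 + |y_i|^2. For its hypothesis
   zK, put q := (Delta^2 + t)^-1: the commutator of q and a has the matrix
   coefficient <a Delta^2 q x, q y> - <a q x, Delta^2 q y> =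
   <Delta q x, Delta (b q y)> - <Delta (a q x), Delta q y>. *)
Let log_form N x y :
  complex.Re (inner (a (trunc e N x)) (L (trunc e N y)) -
              inner (a (L (trunc e N x))) (trunc e N y)) <=
  K / 2 * (nm x ^+ 2 + nm y ^+ 2).
Proof.
pose c i := inner x (e i); pose d i := inner y (e i).
pose z (i j : 'I_N) := complex.Re (inner (a (e j)) (e i) * (c j * Num.conj (d i))).
pose w (k : 'I_N) := nm (c k) ^+ 2 + nm (d k) ^+ 2.
have form (f g : nat -> R) :
    complex.Re (inner (a (vec e N (fun i => (f i)%:C%C * c i))) (vec e N (fun i => (g i)%:C%C * d i)))
    = \sum_(i < N) \sum_(j < N) z i j * (g i * f j).
  rewrite inner_vec// Re_sum; apply: eq_bigr => i _; rewrite Re_sum.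
  apply: eq_bigr => j _; rewrite rmorphM/= conj_realC.
  rewrite [X in complex.Re X](_ : _ = (g i * f j)%:C%C *
    (inner (a (e j)) (e i) * (c j * Num.conj (d i)))); last by rewrite rmorphM/=; ring.
  by rewrite ReCl mulrC.
have vecE (f : nat -> R) (u : nat -> C) : (forall i, f i = 1) ->
    vec e N (fun i => (f i)%:C%C * u i) = vec e N u.
  by move=> f1; apply: eq_bigr => i _; rewrite f1 mul1r.
have tx : trunc e N x = vec e N (fun i => (1 : R)%:C%C * c i) by rewrite vecE.
have ty : trunc e N y = vec e N (fun i => (1 : R)%:C%C * d i) by rewrite vecE.
rewrite tx ty.
rewrite (vec_diag eB N (fun=> 1) c LP).2 (vec_diag eB N (fun=> 1) d LP).2.
rewrite ReB !form -sumrB.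
under eq_bigr do rewrite -sumrB.
have K0 : 0 <= K by rewrite divr_ge0// addr_ge0.
have est : \sum_i \sum_j z i j * (ln (mu i ^+ 2) - ln (mu j ^+ 2)) <= K * \sum_k w k.
  apply: log_estimate => //.
  - by move=> i; rewrite exprn_gt0.
  - by move=> k; rewrite addr_ge0 ?sqr_ge0.
  move=> t t0; pose q (i : nat) := (mu i ^+ 2 + t)^-1.
  have qt i : 0 < mu i ^+ 2 + t by rewrite ltr_wpDl ?sqr_ge0.
  have -> : - (\sum_i \sum_j z i j * ((mu i ^+ 2 + t)^-1 - (mu j ^+ 2 + t)^-1)) =
     complex.Re (inner (a (vec e N (fun i => (q i)%:C%C * c i)))
                     (vec e N (fun i => (mu i * (mu i * q i))%:C%C * d i))) -
     complex.Re (inner (a (vec e N (fun i => (mu i * (mu i * q i))%:C%C * c i)))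
                     (vec e N (fun i => (q i)%:C%C * d i))).
    rewrite !form -sumrB -sumrN; apply: eq_bigr => i _; rewrite -sumrB -sumrN.
    apply: eq_bigr => j _; rewrite -mulrN -mulrBr; congr (_ * _); rewrite /q.
    by field; rewrite !gt_eqF.
  have [zd zE] := vec_diag eB N q c DeltaP.
  have [zd' zE'] := vec_diag eB N q d DeltaP.
  have [vd vE] := vec_diag eB N (fun i => mu i * q i) d DeltaP.
  have [vd' vE'] := vec_diag eB N (fun i => mu i * q i) c DeltaP.
  rewrite -vE -vE'.
  set Z := vec e N (fun i => (q i)%:C%C * c i) in zd zE *.
  set Z' := vec e N (fun i => (q i)%:C%C * d i) in zd' zE' *.
  set V := vec e N (fun i => (mu i * q i)%:C%C * d i) in vd zE' *.
  set V' := vec e N (fun i => (mu i * q i)%:C%C * c i) in vd' zE *.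
  have aZ := a_dom (absD_dom zd); have bZ' := b_dom (absD_dom zd').
  rewrite -(diag_sym eB DeltaP (Delta_dom aZ).1 vd).
  rewrite ab (diag_sym eB DeltaP vd' (Delta_dom bZ').1).
  have b1 := aK (absD_dom zd); have b2 := bK (absD_dom zd'); rewrite zE in b1; rewrite zE' in b2.
  have c1 := Re_cauchy_schwarz (Delta (a Z)) V.
  have c2 : - complex.Re (inner V' (Delta (b Z'))) <= nm V' * nm (Delta (b Z')).
    rewrite -ReN -innerNl; apply: le_trans (Re_cauchy_schwarz _ _) _; by rewrite nmN.
  have -> : K * (\sum_k w k * mu k ^+ 2 * (mu k ^+ 2 + t)^-1 ^+ 2) =
      K * (nm V' ^+ 2 + nm V ^+ 2).
    congr (_ * _); rewrite /V /V' !(nm_vec_sqr eB) -big_split/=; apply: eq_bigr => k _.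
    by rewrite /w /c /d -/(q k); move: (q k) => qk; ring.
  have : nm (Delta (a Z)) * nm V <= Ka * nm V' * nm V by rewrite ler_wpM2r ?nm_ge0.
  have : nm V' * nm (Delta (b Z')) <= nm V' * (Kb * nm V) by rewrite ler_wpM2l ?nm_ge0.
  (* Arithmetic-geometric mean for (Ka + Kb) |V| |V'|; hence the factor 1 / 2 in [K]. *)
  have : 0 <= (Ka + Kb) * (nm V - nm V') ^+ 2 by rewrite mulr_ge0 ?sqr_ge0 ?addr_ge0.
  rewrite /K; move: c1 c2; move: (complex.Re _) (complex.Re _) (nm V) (nm V') => p1 p2 v v'.
  move: (nm (Delta (a Z))) (nm (Delta (b Z'))) => n1 n2; lra.
have wle : \sum_k w k <= nm x ^+ 2 + nm y ^+ 2.
  by rewrite big_split/=; apply: lerD; exact: bessel.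
have : K * \sum_k w k <= K * (nm x ^+ 2 + nm y ^+ 2) by rewrite ler_wpM2l.
(* The estimate was made for ln (mu^2) = 2 ln mu, which accounts for K / 2 in the statement. *)
have -> : \sum_(i < N) \sum_(j < N)
     (z i j * (ln (1 + `|l i|) * 1 * 1) - z i j * (1 * (ln (1 + `|l j|) * 1))) =
   (\sum_i \sum_j z i j * (ln (mu i ^+ 2) - ln (mu j ^+ 2))) / 2.
  rewrite mulr_suml; apply: eq_bigr => i _; rewrite mulr_suml; apply: eq_bigr => j _.
  by rewrite !lnXn// -/(mu i) -/(mu j) !mulr2n; field.
move: est; move: (\sum_i _) (\sum_k _) (nm x ^+ 2 + _) => ? ? ?; lra.
Qed.

(** With u the commutator applied to t, [log_form] at t and r u gives r |u|^2 at most K / 2 (|t|^2 +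
    r^2 |u|^2); the optimal r = |t| / |u| turns this into |u| at most K |t|. *)
Lemma log_commutator N x : dom L (a (trunc e N x)) /\
  nm (L (a (trunc e N x)) - a (L (trunc e N x))) <= K * nm (trunc e N x).
Proof.
have K0 : 0 <= K by rewrite divr_ge0// addr_ge0.
set t := trunc e N x.
have tD : dom absD t by exact: (diag_trunc eB absP).
have atL : dom L (a t).
  apply: (diag_dom_le LP absP _ (a_dom tD)) => i.
  rewrite normr_id (ger0_norm (ln_ge0 _)) ?lerDl// le_ln1Dx//.
  exact: lt_le_trans (normr_ge0 _).
split=> //; set u := L (a t) - a (L t).
have tt M : (N <= M)%N -> trunc e M t = t.
  move=> NM; apply: (basis_ext eB) => i; rewrite !(hat_trunc eB).
  by case: ifP => // /negbT; case: ifP => //= iN; rewrite (leq_trans iN NM).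
(* Truncating beyond [N] leaves t unchanged but only approximates u; [key2] removes this truncation
   by letting M grow. *)
have key M (r : R) : (N <= M)%N -> r * nm (trunc e M u) ^+ 2 <= K / 2 * (nm t ^+ 2 + r ^+ 2 * nm u ^+ 2).
  move=> NM; have := log_form M t (r%:C%C *: u); rewrite tt//.
  have tL : dom L (trunc e M (r%:C%C *: u)) by exact: (diag_trunc eB LP).
  rewrite -(diag_sym eB LP)// -innerBl -/u nmZ nmC exprMn real_normK ?num_real//.
  have -> : trunc e M (r%:C%C *: u) = r%:C%C *: trunc e M u.
    by apply: (basis_ext eB) => i; rewrite !(innerZl, hat_trunc eB); case: ifP; rewrite ?mulr0.
  by rewrite innerZr conj_realC ReCl (inner_trunc eB).
have key2 (r : R) : 0 < r -> r * nm u ^+ 2 <= K / 2 * (nm t ^+ 2 + r ^+ 2 * nm u ^+ 2).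
  move=> r0; rewrite -ler_pdivlMl//; set B := r^-1 * _.
  have B0 : 0 <= B.
    apply: mulr_ge0; first by rewrite invr_ge0 ltW.
    apply: mulr_ge0; first exact: divr_ge0.
    by apply: addr_ge0; [exact: sqr_ge0|rewrite mulr_ge0 ?sqr_ge0].
  rewrite -(sqr_sqrtr B0) lerXn2r ?nnegrE ?nm_ge0 ?sqrtr_ge0//.
  apply: (parseval_le eB); last exact: sqrtr_ge0.
  move=> M; rewrite sqr_sqrtr//.
  apply: le_trans (@sum_mono _ (fun i => nm (inner u (e i)) ^+ 2) M (maxn M N) _ (leq_maxl _ _)) _.
    by move=> i; exact: sqr_ge0.
  rewrite -(nm_trunc eB) /B ler_pdivlMl// key//; exact: leq_maxr.
have [t0|t0] := eqVneq (nm t) 0.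
  have tz : t = 0 by exact: nm0_eq0.
  rewrite /u tz (lin0 la).
  by rewrite (op_linear0 (diag_op_linear eB LP)) (lin0 la) subrr nm0 mulr0.
have tp : 0 < nm t by rewrite lt_neqAle eq_sym t0 nm_ge0.
have [u0|u0] := eqVneq (nm u) 0; first by rewrite u0 mulr_ge0 ?nm_ge0.
have up : 0 < nm u by rewrite lt_neqAle eq_sym u0 nm_ge0.
have := key2 _ (divr_gt0 tp up).
have -> : nm t / nm u * nm u ^+ 2 = nm t * nm u by field.
have -> : (nm t / nm u) ^+ 2 * nm u ^+ 2 = nm t ^+ 2 by field.
have -> : K / 2 * (nm t ^+ 2 + nm t ^+ 2) = nm t * (K * nm t) by field.
by rewrite ler_pM2l.
Qed.

End AdjointPair.
End LogCommutator.

Section SgnLogCommutator.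
Context {R : realType} {H : hilbert R}.
Local Notation C := R[i].
Implicit Types (x y z : H).
Variables (e : nat -> H) (l : nat -> R) (D absD T : op H).
Hypotheses (eB : basis_seq e) (DP : op_diag e l D)
  (absP : op_diag e (fun i => `|l i|) absD)
  (TP : op_diag e (fun i => sgnlog (l i)) T).

Let F := diag e (fun i => Num.sg (l i)).
Let FP : op_diag e (fun i => Num.sg (l i)) F := diagP eB _.
Let L := diag e (fun i => ln (1 + `|l i|)).
Let LP : op_diag e (fun i => ln (1 + `|l i|)) L := diagP eB _.

Let F_bounded : [/\ forall x, dom F x, bounded_op F & forall x, nm (F x) <= 1 * nm x].
Proof.
by apply: (diag_bounded eB FP) => // i _; rewrite normr_sg; case: (_ != 0).
Qed.

Let F_dom x : dom F x. Proof. by case: F_bounded. Qed.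

Let nmF x : nm (F x) <= nm x.
Proof. by case: F_bounded => _ _ /(_ x); rewrite mul1r. Qed.

Lemma dom_absD x : dom D x <-> dom absD x.
Proof.
by split; [apply: (diag_dom_le absP DP)|apply: (diag_dom_le DP absP)] => i;
  rewrite normr_id.
Qed.

Let ln_ge0_abs i : 0 <= ln (1 + `|l i|).
Proof. by rewrite ln_ge0// lerDl. Qed.

Let D_F x : dom D x -> dom absD (F x) /\ absD (F x) = D x.
Proof.
move=> xD; apply: (diag_dom_mul eB absP FP) => //.
rewrite (_ : (fun i => _) = l)//; apply/funext => i.
by rewrite mulrC -numEsg.
Qed.

Let T_LF x : dom T x -> dom L (F x) /\ L (F x) = T x.
Proof.
move=> xT; apply: (diag_dom_mul eB LP FP) => //.
rewrite (_ : (fun i => _) = fun i => sgnlog (l i))//; apply/funext => i.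
by rewrite mulrC.
Qed.

Let T_dom_of_L x : dom L x -> dom T x.
Proof.
apply: (diag_dom_le TP LP) => i; rewrite /sgnlog normrM normr_sg.
by case: (_ != 0); rewrite ?mul1r ?mul0r.
Qed.

Let abs_dom_L x : dom absD x -> dom L x /\ nm (L x) <= nm (absD x).
Proof.
move=> xD; have Labs i : `|ln (1 + `|l i|)| <= `| `|l i| |.
  rewrite normr_id (ger0_norm (ln_ge0_abs i)) le_ln1Dx//.
  by rewrite (lt_le_trans _ (normr_ge0 _))// ltrN10.
by split; [exact: (diag_dom_le LP absP Labs)|exact: (diag_nm_le eB LP absP Labs)].
Qed.

Section SignCommutator.
Variables (a s : H -> H) (M MD : R).
Hypotheses (la : linear a) (M0 : 0 <= M)
  (a_dom : forall x, dom D x -> dom D (a x))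
  (aD : forall x, dom D x -> nm (D (a x) - s (D x)) <= MD * nm x)
  (aabs : forall x, dom absD x -> nm (absD (a x) - s (absD x)) <= M * nm x).

(** |D| F a x = D a x and |D| a F x are both close to s(D x) = s(|D| F x), so the twist cancels in
    their difference. *)
Lemma sign_commutator x : dom D x -> dom absD (F (a x) - a (F x)) /\
  nm (absD (F (a x) - a (F x))) <= (MD + M) * nm x.
Proof.
move=> xD; have axD := a_dom xD.
have [Fax FaxE] := D_F axD.
have [FxD DFx] := D_F xD.
have aFx : dom absD (a (F x)) by apply/dom_absD/a_dom/dom_absD.
have [d0 lin] := diag_op_linear eB absP.
have [yD yE] := lin (-1) _ _ aFx Fax.
rewrite !scaleN1r ![- _ + _]addrC in yD yE.
split=> //; rewrite yE FaxE.
apply: le_trans (nm_triB (s (D x)) _ _) _; rewrite mulrDl.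
apply: lerD; first exact: aD.
rewrite nmBC -DFx; apply: le_trans (aabs FxD) _.
by rewrite ler_wpM2l.
Qed.

Variable (K : R).
Hypothesis logK : forall N x, dom L (a (trunc e N x)) /\
  nm (L (a (trunc e N x)) - a (L (trunc e N x))) <= K * nm (trunc e N x).
Hypothesis K0 : 0 <= K.

Let finite_commutator N x :
  dom T (a (trunc e N x)) /\
  nm (T (a (trunc e N x)) - a (T (trunc e N x))) <= (MD + M + K) * nm (trunc e N x).
Proof.
set t := trunc e N x.
have tD : dom D t by exact: (diag_trunc eB DP).
have atD := a_dom tD.
have atT : dom T (a t) by apply: T_dom_of_L; apply: (abs_dom_L _).1; exact/dom_absD.
have tT : dom T t by exact: (diag_trunc eB TP).
split=> //; have [yD yM] := sign_commutator tD.
have Ft : F t = trunc e N (F x) by exact: (diag_trunc_comm eB FP).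
have [aFtL LK] := logK N (F x); rewrite -Ft in aFtL LK.
rewrite -(T_LF atT).2 -(T_LF tT).2.
have [d0 lin] := diag_op_linear eB LP.
have [yL yLM] := abs_dom_L yD.
have [_ +] := lin 1 _ _ yL aFtL; rewrite !scale1r subrK => ->.
rewrite -addrA; apply: le_trans (nmD _ _) _; rewrite mulrDl; apply: lerD.
  exact: le_trans yLM yM.
apply: le_trans LK _; rewrite ler_wpM2l//.
Qed.

(** It is not known beforehand that a x lies in dom T. The numbers [u i] are the coefficients that T
    (a x) - a (T x) would have; any finitely many of them are limits of coefficients of commutators
    at truncations of x, so their square sum obeys the same bound. Square summability of [u] then
    puts a x into dom T. *)
Lemma sgnlog_commutator_le (Ma : R) x : (forall x, nm (a x) <= Ma * nm x) ->
  0 <= Ma -> 0 <= MD -> dom T x ->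
  dom T (a x) /\ nm (T (a x) - a (T x)) <= (MD + M + K) * nm x.
Proof.
move=> aMa Ma0 MD0 xT; pose K' := MD + M + K.
have K'0 : 0 <= K' by rewrite !addr_ge0.
pose t i := sgnlog (l i).
pose u i := (t i)%:C%C * inner (a x) (e i) - inner (a (T x)) (e i).
have ub m : \sum_(i < m) nm (u i) ^+ 2 <= (K' * nm x) ^+ 2.
  pose c i := if e i == 0 then 0 else u i.
  have uc i : u i = c i.
    by rewrite /c; case: eqP => // ei; rewrite /u ei !inner0r mulr0 subrr.
  have sc : supported e c by move=> i ei; rewrite /c ei eqxx.
  under eq_bigr do rewrite uc.
  rewrite -(nm_sum_sqr_ord eB _ sc) lerXn2r ?nnegrE ?nm_ge0 ?mulr_ge0 ?nm_ge0//.
  apply/ler_addgt0Pr => r r0.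
  pose B := \sum_(i < m) `|t i| + 1.
  have B0 : 0 < B by rewrite ltr_wpDl// sumr_ge0.
  (* Each of the m coefficients is off by at most |t i| Ma r' + Ma r'; this denominator keeps the
     total error below r. *)
  pose r' := r / (Ma * B + m%:R * Ma + 1).
  have den0 : 0 < Ma * B + m%:R * Ma + 1.
    by rewrite ltr_wpDl// addr_ge0 ?mulr_ge0// ltW.
  have r'0 : 0 < r' by rewrite divr_gt0.
  have [N1 /(_ (maxn _ _) (leq_maxl _ _)) +] := trunc_cvg eB x r'0.
  have [N2 /(_ (maxn _ _) (leq_maxr _ _)) +] := trunc_cvg eB (T x) r'0.
  move=> /(_ N1) + /(_ N2); set N := maxn _ _ => TN xN.
  have [aT aTK] := finite_commutator N x.
  set v := T (a (trunc e N x)) - a (T (trunc e N x)) in aTK.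
  have vE i : inner v (e i) =
      (t i)%:C%C * inner (a (trunc e N x)) (e i) - inner (a (trunc e N (T x))) (e i).
    by rewrite /v innerBl TP.2// (diag_trunc_comm eB TP).
  have -> : \sum_(i < m) c i *: e i =
      trunc e m v - (\sum_(i < m) (inner v (e i) - c i) *: e i).
    rewrite /trunc -sumrB; apply: eq_bigr => i _.
    by rewrite scalerBl opprB addrC subrK.
  apply: le_trans (nmB _ _) _; apply: lerD.
    apply: le_trans (nm_trunc_le eB _ _) _; apply: le_trans aTK _.
    by rewrite ler_wpM2l// nm_trunc_le.
  apply: le_trans (nm_sum _ _ _) _.
  apply: (@le_trans _ _ (\sum_(i < m) (`|t i| * (Ma * r') + Ma * r'))).
    apply: ler_sum => i _; rewrite nmZ -uc vE /u.
    have ei1 : nm (e i) <= 1 by rewrite (basis_nm eB); case: (_ != 0).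
    rewrite (_ : _ - _ = (t i)%:C%C * inner (a (trunc e N x - x)) (e i)
       - inner (a (trunc e N (T x) - T x)) (e i)); last first.
      by rewrite !(linB la) !innerBl; ring.
    have small z : nm (z) < r' -> nm (inner (a z) (e i)) <= Ma * r'.
      move=> zr; apply: le_trans (cauchy_schwarz _ _) _.
      apply: (@le_trans _ _ (nm (a z))); first by rewrite ler_piMr ?nm_ge0.
      by apply: le_trans (aMa z) _; rewrite ler_wpM2l// ltW.
    apply: (@le_trans _ _ (nm ((t i)%:C%C * inner (a (trunc e N x - x)) (e i)
       - inner (a (trunc e N (T x) - T x)) (e i)))).
      by rewrite ler_piMr ?nm_ge0.
    apply: le_trans (nmB _ _) _; apply: lerD; last exact: small.
    by rewrite nmM nmC ler_wpM2l// small.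
  rewrite big_split/= -mulr_suml sumr_const card_ord -[_ *+ m]mulr_natl.
  apply: (@le_trans _ _ ((Ma * B + m%:R * Ma + 1) * r')); last first.
    by rewrite /r' mulrC divfK// gt_eqF.
  rewrite !mulrDl mul1r -!mulrA; rewrite -addrA; apply: lerD.
    rewrite mulrCA ler_wpM2l// ler_wpM2r ?(ltW r'0)// /B lerDl. by [].
  by rewrite lerDl ltW.
have axT : dom T (a x).
  apply/TP.1; have aTx := summable_hat eB (a (T x)).
  have su : summable_seq (fun i => nm (u i) ^+ 2) by exists ((K' * nm x) ^+ 2).
  apply: (summable_le _ (summableZ (ler0n _ 2) (summableD su aTx))) => i.
  rewrite -nm_diag_hat -/(t i) (_ : _ * _ = u i + inner (a (T x)) (e i)); last by rewrite /u subrK.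
  have := nmD (u i) (inner (a (T x)) (e i)).
  have := nm_ge0 (u i + inner (a (T x)) (e i)).
  have := sqr_ge0 (nm (u i) - nm (inner (a (T x)) (e i))).
  move: (nm _) (nm _) (nm _) => p q r; nra.
split=> //; apply: (parseval_le eB); last by rewrite mulr_ge0 ?nm_ge0.
by move=> m; under eq_bigr do rewrite innerBl TP.2//.
Qed.

End SignCommutator.

(** The estimates for the adjoint [b], with its own twist s', serve [log_commutator], where one
    factor Delta acts on the side of [b]. *)
Lemma sgnlog_commutator (a b s s' : H -> H) : is_adjoint a b ->
  bounded_op a -> bounded_op b -> bounded_op s -> bounded_op s' ->
  (forall x, dom D x -> dom D (a x)) -> (forall x, dom D x -> dom D (b x)) ->
  bounded_twisted_commutator D a s -> bounded_twisted_commutator absD a s ->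
  bounded_twisted_commutator absD b s' ->
  (forall x, dom T x -> dom T (a x)) /\ bounded_twisted_commutator T a a.
Proof.
move=> ab /bounded_opP[la [Ma [Ma0 aM]]] /bounded_opP[lb [Mb [Mb0 bM]]].
move=> /bounded_opP[_ [Ms [Ms0 sM]]] /bounded_opP[_ [Ms' [Ms'0 s'M]]].
move=> a_dom b_dom /twisted_commutator_bound[MD [MD0 aD]] /twisted_commutator_bound[M [M0 aabs]] /twisted_commutator_bound[M' [M'0 babs]].
have a_dom' x : dom absD x -> dom absD (a x) by move=> /dom_absD/a_dom/dom_absD.
have b_dom' x : dom absD x -> dom absD (b x) by move=> /dom_absD/b_dom/dom_absD.
have Ka := twisted_bound eB absP M0 Ma0 Ms0 aM sM a_dom' aabs.
have Kb := twisted_bound eB absP M'0 Mb0 Ms'0 bM s'M b_dom' babs.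
have Ka0 : 0 <= M + Ms + Ma by rewrite !addr_ge0.
have Kb0 : 0 <= M' + Ms' + Mb by rewrite !addr_ge0.
have logK := log_commutator eB absP LP ab la Ka0 Kb0 a_dom' b_dom' Ka Kb.
have K0 : 0 <= (M + Ms + Ma + (M' + Ms' + Mb)) / 2 by rewrite divr_ge0// addr_ge0.
have res x := sgnlog_commutator_le la M0 a_dom aD aabs logK K0 aM Ma0 MD0 (x := x).
split=> [x xT|]; first by have [] := res x xT.
exists (MD + M + (M + Ms + Ma + (M' + Ms' + Mb)) / 2)%:C%C => x xT.
by have [_] := res x xT; rewrite !nmE -rmorphM lecR.
Qed.

End SgnLogCommutator.

(** * Compact operators and homotopy *)

Section TotallyBoundedMaps.
Context {R : realType} {H : hilbert R}.
Local Notation C := R[i].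
Implicit Types (x y z : H) (T S a : H -> H).

Definition tb_map T := forall r : R, 0 < r -> exists s : seq H,
  forall x, nm x <= 1 -> exists2 y, y \in s & nm (T x - y) < r.

Lemma compact_opE T : compact_op T <-> linear T /\ tb_map T.
Proof.
have ballE x : (`|x| <= 1) = (nm x <= 1) by rewrite nmE -[1]/(1%:C%C) lecR.
split=> -[lT cT]; split=> //.
  move=> r r0; have [s sP] := precompact_tb cT r0; exists s => x x1.
  by apply: sP; exists x => //=; rewrite ballE.
apply: tb_precompact => r r0; have [s sP] := cT r r0; exists s => _ [x /= x1 <-].
by apply: sP; rewrite -ballE.
Qed.

Lemma tb_mapD T S : tb_map T -> tb_map S -> tb_map (fun x => T x + S x).
Proof.
move=> tT tS r r0; have r2 : 0 < r / 2 by rewrite divr_gt0.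
have [s sP] := tT _ r2; have [s' s'P] := tS _ r2.
exists [seq y + y' | y <- s, y' <- s'] => x x1.
have [y ys yx] := sP x x1; have [y' ys' yx'] := s'P x x1.
exists (y + y'); first by apply/allpairsP; exists (y, y').
rewrite opprD addrACA (splitr r); apply: le_lt_trans (nmD _ _) _.
exact: ltrD.
Qed.

Lemma tb_map_bounded T a (M : R) : tb_map T ->
  (forall x y, nm (a x - a y) <= M * nm (x - y)) -> tb_map (a \o T).
Proof.
move=> tT aM r r0; pose M' := `|M| + 1.
have M'0 : 0 < M' by rewrite ltr_wpDl.
have [s sP] := tT _ (divr_gt0 r0 M'0).
exists (map a s) => x x1; have [y ys yx] := sP x x1.
exists (a y); first exact: map_f.
apply: le_lt_trans (aM _ _) _; apply: (@le_lt_trans _ _ (M' * nm (T x - y))).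
  by rewrite ler_wpM2r ?nm_ge0// ler_wpDr// ler_norm.
by rewrite mulrC -ltr_pdivlMr.
Qed.

Lemma tb_map_lim T : (forall r : R, 0 < r -> exists2 S, tb_map S &
  forall x, nm x <= 1 -> nm (T x - S x) < r) -> tb_map T.
Proof.
move=> TS r r0; have r2 : 0 < r / 2 by rewrite divr_gt0.
have [S tS SP] := TS _ r2; have [s sP] := tS _ r2.
exists s => x x1; have [y ys yx] := sP x x1; exists y => //.
rewrite (splitr r); apply: le_lt_trans (nm_triB (S x) _ _) _.
by rewrite ltrD// SP.
Qed.

Lemma tb_map_line (g : H -> R) (v : H) : nm v <= 1 ->
  (forall x, nm x <= 1 -> `|g x| <= 1) -> tb_map (fun x => (g x)%:C%C *: v).
Proof.
move=> v1 g1 r r0; pose n := Num.truncn r^-1.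
have n0 : 0 < n.+1%:R :> R by rewrite ltr0n.
have nr : n.+1%:R^-1 < r.
  by rewrite -[ltRHS]invrK ltf_pV2 ?posrE ?invr_gt0// truncnS_gt.
(* A grid of mesh 1 / n.+1 from -1 to 1; rounding g x down to it costs less than r. *)
pose p (k : nat) : R := k%:R / n.+1%:R - 1.
exists [seq (p k)%:C%C *: v | k <- iota 0 (n.+1 * 2).+1] => x x1.
have := g1 x x1; rewrite ler_norml => /andP[gl gu].
pose t := (g x + 1) * n.+1%:R.
have t0 : 0 <= t by rewrite mulr_ge0 ?(ltW n0)//; lra.
pose k := Num.truncn t.
have /andP[kt tk] := truncn_itv t0.
exists ((p k)%:C%C *: v).
  apply/mapP; exists k => //; rewrite mem_iota/= add0n ltnS.
  rewrite -(ler_nat R) natrM; apply: le_trans kt _.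
  by rewrite /t mulrC ler_wpM2l ?(ltW n0)//; lra.
rewrite -scalerBl -rmorphB/= nmZ nmC; apply: le_lt_trans nr.
apply: (@le_trans _ _ (`|g x - p k|)); first by rewrite ler_piMr.
have -> : g x - p k = (t - k%:R) / n.+1%:R by rewrite /t /p; field; rewrite gt_eqF.
rewrite normrM (ger0_norm (x := _^-1)) ?invr_ge0 ?(ltW n0)//.
rewrite ler_piMl ?invr_ge0 ?(ltW n0)// ger0_norm ?subr_ge0//.
by move: tk; rewrite -natr1 /k; lra.
Qed.

Lemma tb_map_rank1 (u v : H) : nm u <= 1 -> nm v <= 1 ->
  tb_map (fun x => inner x u *: v).
Proof.
move=> u1 v1.
have -> : (fun x => inner x u *: v) = (fun x => (complex.Re (inner x u))%:C%C *: v +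
    (complex.Im (inner x u))%:C%C *: ('i%C *: v)).
  apply/funext => x; rewrite scalerA -scalerDl; congr (_ *: _).
  by rewrite {1}[inner x u]complexE mulrC.
have bd x : nm x <= 1 -> nm (inner x u) <= 1.
  move=> x1; apply: le_trans (cauchy_schwarz _ _) _.
  by rewrite -[leRHS]mulr1 ler_pM ?nm_ge0.
apply: tb_mapD.
  by apply: tb_map_line => // x x1; exact: le_trans (Re_le_nm _) (bd x x1).
apply: tb_map_line => [|x x1].
  rewrite nmZ; have -> : nm ('i%C : C) = 1; last by rewrite mul1r.
  by rewrite /nm normc_def/= expr0n expr1n/= add0r sqrtr1.
apply: le_trans _ (bd x x1); rewrite -(@ler_sqr _ `|_|) ?nnegrE ?nm_ge0//.
by rewrite real_normK ?num_real// nm_sqrE lerDr sqr_ge0.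
Qed.

Lemma tb_map0 : tb_map (fun=> 0).
Proof.
by move=> r r0; exists [:: 0] => x _; exists 0; rewrite ?inE// subrr nm0.
Qed.

Lemma compact_opD T S : compact_op T -> compact_op S -> compact_op (T + S).
Proof.
move=> /compact_opE[lT tT] /compact_opE[lS tS]; apply/compact_opE; split.
  by move=> c x y; rewrite /= !fctE lT lS scalerDr addrACA.
exact: tb_mapD.
Qed.

Lemma compact_op_compl a T : bounded_op a -> compact_op T -> compact_op (a \o T).
Proof.
move=> /bounded_opP[la [M [M0 aM]]] /compact_opE[lT tT]; apply/compact_opE; split.
  by move=> c x y /=; rewrite lT la.
by apply: (tb_map_bounded tT (M := M)) => x y; rewrite -(linB la).
Qed.

Lemma compact_op_compr a T : bounded_op a -> compact_op T -> compact_op (T \o a).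
Proof.
move=> /bounded_opP[la [M [M0 aM]]] /compact_opE[lT tT]; apply/compact_opE; split.
  by move=> c x y /=; rewrite la lT.
(* The map a / M' sends the unit ball into itself, and the scalar M' is moved to the other side of
   T. *)
pose M' := M + 1; have M'0 : 0 < M' by rewrite ltr_wpDl.
have tT' : tb_map ((fun y => M'%:C%C *: y) \o T).
  apply: (tb_map_bounded tT (M := M')) => x y.
  by rewrite -scalerBr nmZ nmC (ger0_norm (ltW M'0)).
move=> r r0; have [s sP] := tT' r r0; exists s => x x1.
have [|y ys yx] := sP (M'^-1%:C%C *: a x); last first.
  exists y => //; move: yx => /=.
  by rewrite (linZ lT) scalerA -rmorphM/= mulfV ?gt_eqF// scale1r.
rewrite nmZ nmC ger0_norm ?invr_ge0 ?(ltW M'0)// ler_pdivrMl// mulr1.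
apply: le_trans (aM x) _; apply: (@le_trans _ _ (M * 1)); first by rewrite ler_wpM2l.
by rewrite mulr1 lerDl.
Qed.

Lemma compact_op_lim T : linear T -> (forall r : R, 0 < r -> exists2 S, compact_op S &
  forall x, nm (T x - S x) <= r * nm x) -> compact_op T.
Proof.
move=> lT TS; apply/compact_opE; split=> //; apply: tb_map_lim => r r0.
have [S /compact_opE[_ tS] SP] := TS (r / 2) (divr_gt0 r0 (ltr0n _ 2)).
exists S => // x x1; apply: le_lt_trans (SP x) _.
apply: (@le_lt_trans _ _ (r / 2)); first by rewrite ler_piMr// divr_ge0// ltW.
by rewrite ltr_pdivrMr// ltr_pMr// ltr1n.
Qed.

Lemma compact_op0 : compact_op (0 : H -> H).
Proof.
apply/compact_opE; split; last exact: tb_map0.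
by move=> c x y; rewrite -[LHS]/0 -[X in c *: X + _]/0 -[X in _ + X]/0 scaler0 addr0.
Qed.

End TotallyBoundedMaps.

Section CompactDiagonal.
Context {R : realType} {H : hilbert R}.
Variables (e : nat -> H).
Hypothesis eB : basis_seq e.
Implicit Types (c : nat -> R) (T : op H).

Definition null_seq c := forall r : R, 0 < r -> exists N, forall n, (N <= n)%N -> `|c n| < r.

Lemma null_seq_bounded c : null_seq c -> exists M : R, 0 <= M /\ forall n, `|c n| <= M.
Proof.
move=> /(_ 1 ltr01)[N cN]; exists (1 + \sum_(i < N) `|c i|); split.
  by rewrite addr_ge0// sumr_ge0.
move=> n; have [/cN/ltW|nN] := leqP N n.
  by move=> /le_trans; apply; rewrite lerDl sumr_ge0.
rewrite (bigD1 (Ordinal nN))//= addrCA lerDl addr_ge0// sumr_ge0//.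
Qed.

Lemma null_sg_bounded c (l : nat -> R) : null_seq (fun n => c n - Num.sg (l n)) ->
  exists M : R, 0 <= M /\ forall n, `|c n| <= M.
Proof.
move=> /null_seq_bounded[M [M0 cM]]; exists (M + 1); split; first exact: addr_ge0.
move=> n; rewrite -[c n](subrK (Num.sg (l n))); apply: le_trans (ler_normD _ _) _.
by rewrite lerD// normr_sg; case: (_ != 0).
Qed.

Lemma compact_trunc N : compact_op (trunc e N).
Proof.
have -> : trunc e N = \sum_(i < N) (fun x => inner x (e i) *: e i).
  by apply/funext => x; rewrite fct_sumE.
elim/big_rec: _ => [|i T _ IH]; first exact: compact_op0.
apply: compact_opD => //; apply/compact_opE; split.
  by move=> k x y; rewrite innerDl innerZl scalerDl scalerA.
by apply: tb_map_rank1; rewrite (basis_nm eB); case: (_ != 0).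
Qed.

(** The finite rank truncations converge in norm, the error being controlled by the remaining |c
    n|. *)
Lemma compact_diag c T : op_diag e c T -> null_seq c -> compact_op T.
Proof.
move=> cT c0; have [M [M0 cM]] := null_seq_bounded c0.
have [Tdom Tb TM] := diag_bounded eB cT M0 (fun i _ => cM i).
have lT : linear T by case: Tb.
apply: compact_op_lim => // r r0; have [N cN] := c0 r r0.
exists (trunc e N \o T); first exact: compact_op_compr Tb (compact_trunc N).
move=> x /=; apply: (parseval_le eB); last by rewrite mulr_ge0 ?nm_ge0// ltW.
move=> m; rewrite exprMn.
apply: (@le_trans _ _ (r ^+ 2 * \sum_(i < m) nm (inner x (e i)) ^+ 2)); last first.
  by rewrite ler_wpM2l ?sqr_ge0// bessel.
rewrite mulr_sumr; apply: ler_sum => i _.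
rewrite innerBl (hat_trunc eB); case: ifPn => [_|]; first by rewrite subrr nm0 expr0n mulr_ge0 ?sqr_ge0.
rewrite -leqNgt subr0 cT.2// nm_diag_hat => /cN ci.
rewrite ler_wpM2r ?sqr_ge0// -(real_normK (num_real (c i))).
by rewrite lerXn2r ?nnegrE ?(ltW r0)// ltW.
Qed.

End CompactDiagonal.

Section CompactCommutators.
Context {R : realType} {H : hilbert R}.
Local Notation C := R[i].
Implicit Types (x y z : H) (A : set (H -> H)).

Lemma commutatorE (T a : H -> H) x : ((T \o a) - (a \o T)) x = T (a x) - a (T x).
Proof. by []. Qed.

Lemma commutator_linear (T a : H -> H) : linear T -> linear a ->
  linear ((T \o a) - (a \o T)).
Proof.
move=> lT la c x y.
by rewrite !commutatorE la lT lT la scalerBr opprD addrACA.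
Qed.

Variables (e : nat -> H) (l : nat -> R) (D absD : op H).
Hypotheses (eB : basis_seq e) (DP : op_diag e l D)
  (absP : op_diag e (fun i => `|l i|) absD)
  (l_oo : forall M : R, exists N, forall n, (N <= n)%N -> M < `|l n|).

Let F := diag e (fun i => Num.sg (l i)).
Let FP : op_diag e (fun i => Num.sg (l i)) F := diagP eB _.
Let F_bounded : [/\ forall x, dom F x, bounded_op F & forall x, nm (F x) <= 1 * nm x].
Proof.
by apply: (diag_bounded eB FP) => // i _; rewrite normr_sg; case: (_ != 0).
Qed.

Lemma inv_abs_null : null_seq (fun i => (1 + `|l i|)^-1).
Proof.
move=> r r0; have [N lN] := l_oo r^-1; exists N => n /lN ln.
have p0 : 0 < 1 + `|l n| by rewrite ltr_pwDl.
rewrite ger0_norm ?invr_ge0 ?(ltW p0)// -[ltRHS]invrK ltf_pV2 ?posrE ?invr_gt0//.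
by apply: lt_le_trans ln _; rewrite lerDr.
Qed.

(* On dom D the commutator is (1 + |D|)^-1 after a bounded operator. *)
Lemma sign_commutator_compact (a s : H -> H) : bounded_op a ->
  (forall x, dom D x -> dom D (a x)) ->
  bounded_twisted_commutator D a s -> bounded_twisted_commutator absD a s ->
  compact_op ((F \o a) - (a \o F)).
Proof.
move=> ba a_dom /twisted_commutator_bound[MD [MD0 aD]].
move=> /twisted_commutator_bound[M [M0 aabs]].
have [la [Ma [Ma0 aM]]] := (bounded_opP a).1 ba.
have [_ bF Fnm] := F_bounded; have lF : linear F by case: bF.
have lc : linear ((F \o a) - (a \o F)) by exact: commutator_linear.
pose Di := diag e (fun i => (1 + `|l i|)^-1).
have DiP : op_diag e (fun i => (1 + `|l i|)^-1) Di := diagP eB _.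
have cDi := compact_diag eB DiP inv_abs_null.
(* MD + M bounds |D| after the commutator and Ma + Ma the commutator itself; their sum bounds Delta
   after it. *)
pose Kc := (MD + M) + (Ma + Ma) + 1.
have Kc0 : 0 < Kc by rewrite ltr_wpDl// !addr_ge0.
have sc x : nm (F (a x) - a (F x)) <= (Ma + Ma) * nm x.
  apply: le_trans (nmB _ _) _; rewrite mulrDl; apply: lerD.
    by apply: le_trans (Fnm _) _; rewrite mul1r.
  apply: le_trans (aM _) _; rewrite ler_wpM2l//.
  by have := Fnm x; rewrite mul1r.
apply/compact_opE; split=> // r r0; have r2 : 0 < r / 2 by rewrite divr_gt0.
(* A net for the image under Delta^-1 of the ball of radius [Kc]. It approximates the commutator at
   truncations of unit vectors up to r / 2; truncating costs the other r / 2. *)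
pose cK := tb_map_bounded ((compact_opE _).1 cDi).2 (a := fun y => Kc%:C%C *: y) (M := Kc).
have [x y|s' s'P] := cK _ _ r2.
  by rewrite -scalerBr nmZ nmC (ger0_norm (ltW Kc0)).
exists s' => x x1.
have [N /(_ N (leqnn N)) xN] := trunc_cvg eB x (divr_gt0 r2 Kc0).
set t := trunc e N x in xN.
have tD : dom D t by exact: (diag_trunc eB DP).
have [yD yM] := sign_commutator eB DP absP M0 a_dom aD aabs tD.
set y := F (a t) - a (F t) in yD yM.
have t1 : nm t <= 1 by apply: le_trans (nm_trunc_le eB _ _) _.
pose w := absD y + y.
have wE i : inner w (e i) = (1 + `|l i|)%:C%C * inner y (e i).
  by rewrite /w innerDl absP.2// rmorphD/= mulrDl rmorph1 mul1r addrC.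
have wK : nm w <= Kc.
  apply: le_trans (nmD _ _) _.
  have := sc t; rewrite -/y => yy.
  have : (MD + M) * nm t <= MD + M by rewrite ler_piMr// addr_ge0.
  have : (Ma + Ma) * nm t <= Ma + Ma by rewrite ler_piMr// addr_ge0.
  rewrite /Kc; move: yM yy; lra.
have Diw : Di w = y.
  have M1 i : e i != 0 -> `|(1 + `|l i|)^-1| <= (1 : R).
    have p0 : 0 < 1 + `|l i| by rewrite ltr_pwDl.
    by move=> _; rewrite ger0_norm ?invr_ge0 ?(ltW p0)// invf_le1// lerDl.
  have [Didom _ _] := diag_bounded eB DiP ler01 M1.
  apply: (diag_ext eB DiP) => // i.
  by rewrite wE mulrA -rmorphM/= mulVf ?mul1r// gt_eqF// ltr_pwDl.
have [|z zs zw] := s'P (Kc^-1%:C%C *: w).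
  by rewrite nmZ nmC ger0_norm ?invr_ge0 ?(ltW Kc0)// ler_pdivrMl// mulr1.
exists z => //; move: zw.
have lDi : linear Di by have /compact_opE[] := cDi.
rewrite -[X in nm (X - z)]/(Kc%:C%C *: Di (Kc^-1%:C%C *: w)) (linZ lDi).
rewrite scalerA -(rmorphM (real_complex R)) mulfV ?gt_eqF// scale1r Diw => zw.
rewrite (splitr r); apply: le_lt_trans (nm_triB y _ _) _; apply: ltrD => //.
have -> : ((F \o a) - (a \o F)) x - y = F (a (x - t)) - a (F (x - t)).
  rewrite commutatorE (linB la) !(linB lF) (linB la) /y.
  by rewrite !opprD !opprK addrACA.
apply: le_lt_trans (sc _) _; rewrite nmBC.
apply: (@le_lt_trans _ _ (Kc * nm (t - x))).
  by rewrite ler_wpM2r ?nm_ge0// /Kc; lra.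
by rewrite mulrC -ltr_pdivlMr.
Qed.

Lemma diag_commutator_compact (c : nat -> R) (T : op H) (a s : H -> H) :
  op_diag e c T -> null_seq (fun n => c n - Num.sg (l n)) ->
  bounded_op a -> (forall x, dom D x -> dom D (a x)) ->
  bounded_twisted_commutator D a s -> bounded_twisted_commutator absD a s ->
  compact_op ((T \o a) - (a \o T)).
Proof.
move=> cT c0 ba a_dom tD tabs.
have cF := sign_commutator_compact ba a_dom tD tabs.
pose G := diag e (fun n => c n - Num.sg (l n)).
have GP : op_diag e (fun n => c n - Num.sg (l n)) G := diagP eB _.
have cG := compact_diag eB GP c0.
have [Md [Md0 cMd]] := null_seq_bounded c0.
have [Gdom _ _] := diag_bounded eB GP Md0 (fun i _ => cMd i).
have [Fdom bF _] := F_bounded.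
have [Mc [Mc0 cM]] := null_sg_bounded c0.
have [Tdom _ _] := diag_bounded eB cT Mc0 (fun i _ => cM i).
have TE x : T x = G x + F x.
  apply: (basis_ext eB) => i; rewrite innerDl cT.2// GP.2// FP.2//.
  by rewrite rmorphB/=; ring.
have [la _] := (bounded_opP a).1 ba.
have lG : linear G by have /compact_opE[] := cG.
have -> : (T \o a) - (a \o T) = ((F \o a) - (a \o F)) + ((G \o a) + (- (a \o G))).
  apply/funext => x; rewrite commutatorE !TE (linD la) opprD addrACA addrC.
  by [].
apply: compact_opD => //; apply: compact_opD; first exact: compact_op_compr.
have -> : - (a \o G) = (fun y => (- 1) *: y) \o (a \o G).
  by apply/funext => x; rewrite /= scaleN1r.
apply: compact_op_compl; last exact: compact_op_compl.
apply/bounded_opP; split; first by move=> k x y; rewrite scalerDr !scalerA mulrC.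
by exists 1; split=> // x; rewrite scaleN1r nmN mul1r.
Qed.

(** The commutator with a bounded T is norm continuous in [a], and norm limits of compact operators
    are compact. *)
Lemma cstar_closure_commutator_compact A (T : H -> H) : bounded_op T ->
  (forall a, A a -> compact_op ((T \o a) - (a \o T))) ->
  forall a, cstar_closure A a -> compact_op ((T \o a) - (a \o T)).
Proof.
move=> bT cA a [ba aA].
have [la _] := (bounded_opP a).1 ba.
have [lT [M [M0 TM]]] := (bounded_opP T).1 bT.
apply: compact_op_lim => [|r r0]; first exact: commutator_linear.
pose d := r / (M + M + 1).
have den0 : 0 < M + M + 1 by rewrite ltr_wpDl// addr_ge0.
have d0 : 0 < d by rewrite divr_gt0.
have [a' Aa' aa'] := aA d d0; exists ((T \o a') - (a' \o T)); first exact: cA.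
move=> x; rewrite [X in nm (_ - X)]commutatorE commutatorE.
have aa x' : nm (a x' - a' x') <= d * nm x'.
  by have := aa' x'; rewrite !nmE -rmorphM lecR.
have -> : T (a x) - a (T x) - (T (a' x) - a' (T x)) =
    T (a x - a' x) - (a (T x) - a' (T x)).
  by rewrite (linB lT) !opprD !opprK addrACA.
apply: le_trans (nmB _ _) _.
apply: (@le_trans _ _ (M * (d * nm x) + d * (M * nm x))).
  apply: lerD; first by apply: le_trans (TM _) _; rewrite ler_wpM2l.
  by apply: le_trans (aa _) _; rewrite ler_wpM2l// ltW.
have -> : M * (d * nm x) + d * (M * nm x) = (M + M) * d * nm x by ring.
rewrite ler_wpM2r ?nm_ge0//; apply: (@le_trans _ _ ((M + M + 1) * d)).
  by rewrite ler_wpM2r ?(ltW d0)// lerDl.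
by rewrite /d mulrC divfK// gt_eqF.
Qed.

Lemma cstar_closure_comm A (g a : H -> H) : bounded_op g ->
  (forall a, A a -> g \o a = a \o g) -> cstar_closure A a -> g \o a = a \o g.
Proof.
move=> bg gA [ba aA]; apply/funext => x /=.
have [lg [M [M0 gM]]] := (bounded_opP g).1 bg.
apply/eqP; rewrite -subr_eq0; apply/eqP/nm0_eq0/eqP.
rewrite eq_le nm_ge0 andbT; apply/ler_addgt0Pr => r r0; rewrite add0r.
pose B := M * nm x + M * nm x + 1.
have B0 : 0 < B by rewrite ltr_wpDl// addr_ge0 ?mulr_ge0 ?nm_ge0.
have d0 : 0 < r / B by rewrite divr_gt0.
have [a' Aa' aa'] := aA _ d0.
have aa x' : nm (a x' - a' x') <= r / B * nm x'.
  by have := aa' x'; rewrite !nmE -rmorphM lecR.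
have ga : g (a' x) = a' (g x) by rewrite -[LHS]/((g \o a') x) gA.
have -> : g (a x) - a (g x) = g (a x - a' x) - (a (g x) - a' (g x)).
  by rewrite (linB lg) ga opprB addrA subrK.
apply: le_trans (nmB _ _) _.
apply: (@le_trans _ _ (M * (r / B * nm x) + r / B * (M * nm x))).
  apply: lerD; first by apply: le_trans (gM _) _; rewrite ler_wpM2l.
  by apply: le_trans (aa _) _; rewrite ler_wpM2l// ltW.
have -> : M * (r / B * nm x) + r / B * (M * nm x) = r / B * (M * nm x + M * nm x) by ring.
apply: (@le_trans _ _ (r / B * B)); last by rewrite divfK// gt_eqF.
by rewrite ler_wpM2l ?(ltW d0)// /B lerDl.
Qed.

End CompactCommutators.

Section GradingDiag.
Context {R : realType} {H : hilbert R}.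
Variables (e : nat -> H) (l : nat -> R) (D T : op H) (f : R -> R) (A : set (H -> H)) (g : H -> H).
Hypotheses (eB : basis_seq e) (DP : op_diag e l D) (TP : op_diag e (f \o l) T)
  (f_odd : forall t, f (- t) = - f t) (gP : is_grading A D g).

(* g maps the eigenspace of l to that of - l. *)
Lemma grading_anticommute x : dom T x -> dom T (g x) /\ T (g x) = - g (T x).
Proof.
move=> xT; have [bg gg _ _ gD] := gP.
have [lg _] := (bounded_opP g).1 bg.
have eig m n : (f (l n))%:C%C * inner (g (e m)) (e n) =
    (f (- l m))%:C%C * inner (g (e m)) (e n).
  have [emD De] := diag_basis eB DP m.
  have [gD1 gD2] := gD _ emD.
  have := DP.2 _ gD1 n; rewrite gD2 De (linZ lg) -scaleNr innerZl => lmn.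
  have [->|nz] := eqVneq (inner (g (e m)) (e n)) 0; first by rewrite !mulr0.
  by move: lmn => /(mulIf nz); rewrite -rmorphN => /complexI ->.
have gem m : dom T (g (e m)) /\ T (g (e m)) = (f (- l m))%:C%C *: g (e m).
  have E n : inner ((f (- l m))%:C%C *: g (e m)) (e n) =
      ((f \o l) n)%:C%C * inner (g (e m)) (e n) by rewrite innerZl -eig.
  by split; [exact: (diag_dom eB TP E)|apply: (diag_ext eB TP _ E); exact: (diag_dom eB TP E)].
have E m : inner (- g (T x)) (e m) = ((f \o l) m)%:C%C * inner (g x) (e m).
  have [gmT gmE] := gem m.
  rewrite innerNl gg (diag_sym eB TP xT gmT) gmE innerZr conj_realC f_odd gg.
  by rewrite rmorphN mulNr opprK.
by split; [exact: (diag_dom eB TP E)|apply: (diag_ext eB TP _ E); exact: (diag_dom eB TP E)].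
Qed.

End GradingDiag.

Section StraightLineHomotopy.
Context {R : realType} {H : hilbert R}.
Local Notation C := R[i].
Implicit Types (x y z : H).
Variables (e : nat -> H) (l : nat -> R) (D absD : op H) (A : set (H -> H))
  (s : (H -> H) -> (H -> H)) (g : option (H -> H)).
Hypotheses (eB : basis_seq e) (DP : op_diag e l D)
  (absP : op_diag e (fun i => `|l i|) absD)
  (l_oo : forall M : R, exists N, forall n, (N <= n)%N -> M < `|l n|)
  (A_bounded : forall a, A a -> bounded_op a)
  (A_dom : forall a x, A a -> dom D x -> dom D (a x))
  (A_comm : forall a, A a -> bounded_twisted_commutator D a (s a))
  (A_abs : forall a, A a -> bounded_twisted_commutator absD a (s a))
  (A_grading : if g is Some gamma then is_grading A D gamma else True).

Lemma sg_sqr_null (c : nat -> R) : null_seq (fun n => c n - Num.sg (l n)) ->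
  null_seq (fun n => c n ^+ 2 - 1).
Proof.
move=> c0 r r0; pose d := Num.min 1 (r / 3).
have d0 : 0 < d by rewrite lt_min ltr01 divr_gt0.
have [N1 N1P] := c0 d d0; have [N2 N2P] := l_oo 0.
exists (maxn N1 N2) => n; rewrite geq_max => /andP[/N1P cn /N2P ln].
have s2 : Num.sg (l n) ^+ 2 = 1 by rewrite sqr_sg -normr_gt0 ln.
have -> : c n ^+ 2 - 1 = (c n - Num.sg (l n)) * (c n - Num.sg (l n) + 2 * Num.sg (l n)).
  by transitivity (c n ^+ 2 - Num.sg (l n) ^+ 2); [rewrite s2|ring].
rewrite normrM; set u := c n - _ in cn *.
have u1 : `|u| < 1 by apply: lt_le_trans cn _; rewrite ge_min lexx.
have u2 : `|u| < r / 3 by apply: lt_le_trans cn _; rewrite ge_min lexx orbT.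
have s1 : `|Num.sg (l n)| = 1 by rewrite normr_sg -normr_gt0 ln.
have : `|u + 2 * Num.sg (l n)| <= `|u| + 2.
  by apply: le_trans (ler_normD _ _) _; rewrite normrM s1 mulr1 ger0_norm.
have := normr_ge0 u; have := normr_ge0 (u + 2 * Num.sg (l n)).
by move: u1 u2; move: `|u| `|u + _| => p q; nra.
Qed.

Lemma fredholm_module_diag (f : R -> R) (T : op H) : (forall t, f (- t) = - f t) ->
  op_diag e (f \o l) T -> null_seq (fun n => f (l n) - Num.sg (l n)) ->
  fredholm_module (cstar_closure A) (Fredholm id T g).
Proof.
move=> f_odd TP f0.
have [M [M0 fM]] := null_sg_bounded f0.
have [Tdom bT _] := diag_bounded eB TP M0 (fun i _ => fM i).
have cA a : cstar_closure A a -> bounded_op a by case.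
split => /=.
- by split=> //.
- exact: bT.
- move=> a /cA ba.
  pose G := diag e (fun n => f (l n) ^+ 2 - 1).
  have GP : op_diag e (fun n => f (l n) ^+ 2 - 1) G := diagP eB _.
  have Gnull := sg_sqr_null f0.
  have [Mg [Mg0 gM]] := null_seq_bounded Gnull.
  have [Gdom _ _] := diag_bounded eB GP Mg0 (fun i _ => gM i).
  have -> : ((T : H -> H) \o T) - idfun = G.
    apply/funext => x; apply/esym/(diag_ext eB GP) => // i.
    rewrite -[_ x]/(T (T x) - x) innerBl !TP.2//= rmorphB rmorphXn/= rmorph1; ring.
  by apply: compact_op_compl => //; exact: compact_diag GP Gnull.
- exists T; first by move=> x y; exact: (diag_sym eB TP).
    move=> a /cA ba; have -> : (T : H -> H) - (T : H -> H) = 0 by rewrite subrr.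
    by apply: compact_op_compl => //; exact: compact_op0.
  split.
    move=> a aA; apply: cstar_closure_commutator_compact aA => // a' Aa'.
    apply: (diag_commutator_compact eB DP absP l_oo TP f0 (s := s a')).
    + exact: A_bounded.
    + by move=> x; exact: A_dom.
    + exact: A_comm.
    + exact: A_abs.
  case: g A_grading => // gamma gP; have [bg gg g2 gA _] := gP; split=> //.
    by move=> a; exact: cstar_closure_comm.
  apply/funext => x; have [_] := grading_anticommute eB DP TP f_odd gP (Tdom x).
  by move=> gT; rewrite -[LHS]/(gamma (T x)) -[RHS]/(- T (gamma x)) gT opprK.
Qed.

Lemma same_K_class_diag (f0 f1 : R -> R) (T0 T1 : op H) :
  (forall t, f0 (- t) = - f0 t) -> (forall t, f1 (- t) = - f1 t) ->
  op_diag e (f0 \o l) T0 -> op_diag e (f1 \o l) T1 ->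
  null_seq (fun n => f0 (l n) - Num.sg (l n)) ->
  null_seq (fun n => f1 (l n) - Num.sg (l n)) ->
  same_K_class (cstar_closure A) (Fredholm id T0 g) (Fredholm id T1 g).
Proof.
move=> odd0 odd1 P0 P1 n0 n1.
pose f t u := (1 - t) * f0 u + t * f1 u.
pose F t := diag e (f t \o l).
have FP t : op_diag e (f t \o l) (F t) := diagP eB _.
have fnull t : null_seq (fun n => f t (l n) - Num.sg (l n)).
  move=> r r0; pose K := `|1 - t| + `|t| + 1.
  have K0 : 0 < K by rewrite ltr_wpDl// addr_ge0.
  have [N0 N0P] := n0 _ (divr_gt0 r0 K0); have [N1 N1P] := n1 _ (divr_gt0 r0 K0).
  exists (maxn N0 N1) => n; rewrite geq_max => /andP[/N0P h0 /N1P h1].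
  have -> : f t (l n) - Num.sg (l n) =
    (1 - t) * (f0 (l n) - Num.sg (l n)) + t * (f1 (l n) - Num.sg (l n)) by rewrite /f; ring.
  apply: le_lt_trans (ler_normD _ _) _; rewrite !normrM.
  apply: (@le_lt_trans _ _ ((`|1 - t| + `|t|) * (r / K))).
    by rewrite mulrDl lerD// ler_wpM2l// ltW.
  apply: (@lt_le_trans _ _ (K * (r / K))); last by rewrite mulrC divfK// gt_eqF.
  by rewrite ltr_pM2r ?divr_gt0// /K ltrDl.
have fodd t u : f t (- u) = - f t u by rewrite /f odd0 odd1; ring.
have fbd t : exists M, [/\ 0 <= M, forall x, dom (F t) x & forall n, `|f t (l n)| <= M].
  have [M [M0 fM]] := null_sg_bounded (fnull t); exists M; split => //.
  by have [] := diag_bounded eB (FP t) M0 (fun i _ => fM i).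
(* [K_homotopy] speaks of the end points F 0 and F 1 literally, so T0 and T1 have to be identified
   with them as functions. *)
have F0E : F 0 = T0 :> (H -> H).
  have [M [M0 dF _]] := fbd 0.
  have fE : f 0 \o l = f0 \o l by apply/funext => i; rewrite /= /f subr0 mul1r mul0r addr0.
  apply/funext => x; apply: (diag_ext eB (FP 0)) => // i.
  rewrite P0.2 ?fE//; apply/P0.1; rewrite -fE; exact: dF.
have F1E : F 1 = T1 :> (H -> H).
  have [M [M0 dF _]] := fbd 1.
  have fE : f 1 \o l = f1 \o l by apply/funext => i; rewrite /= /f subrr mul1r mul0r add0r.
  apply/funext => x; apply: (diag_ext eB (FP 1)) => // i.
  rewrite P1.2 ?fE//; apply/P1.1; rewrite -fE; exact: dF.
rewrite -F0E -F1E.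
apply: (K_homotopy (F := fun t => F t)) => [t _|t r _ r0].
  exact: fredholm_module_diag (FP t) (fnull t).
have [M0 [M00 _ f0M]] := fbd 0; have [M1 [M10 _ f1M]] := fbd 1.
pose K := M0 + M1 + 1; have K0 : 0 < K by rewrite ltr_wpDl// addr_ge0.
exists (r / K); first by rewrite divr_gt0.
move=> t' _ tt' v; rewrite !nmE -rmorphM lecR.
have [_ [_ dt _]] := fbd t; have [_ [_ dt' _]] := fbd t'.
apply: (parseval_le eB); last by rewrite mulr_ge0 ?nm_ge0// ltW.
move=> m; rewrite exprMn.
apply: (@le_trans _ _ (r ^+ 2 * \sum_(i < m) nm (inner v (e i)) ^+ 2)); last first.
  by rewrite ler_wpM2l ?sqr_ge0// bessel.
rewrite mulr_sumr; apply: ler_sum => i _; rewrite innerBl !(FP _).2//.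
rewrite -mulrBl -rmorphB nm_diag_hat ler_wpM2r ?sqr_ge0//.
rewrite -real_normK ?num_real// lerXn2r ?nnegrE ?(ltW r0)//=.
have -> : f t' (l i) - f t (l i) = (t' - t) * (f 1 (l i) - f 0 (l i)) by rewrite /f; ring.
rewrite normrM; apply: (@le_trans _ _ (r / K * K)); last by rewrite divfK// gt_eqF.
apply: ler_pM => //; first exact: ltW.
apply: le_trans (ler_normB _ _) _.
by have := f0M i; have := f1M i; rewrite /K; lra.
Qed.

End StraightLineHomotopy.

(** * Traces and summability *)

Section Trace.
Context {R : realType} {H : hilbert R}.
Local Notation C := R[i].
Implicit Types (x y z : H) (B : set H).
Variable e : nat -> H.
Hypothesis eB : basis_seq e.

Lemma orthonormal_basis_nm B b : orthonormal_basis B -> B b -> nm b = 1.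
Proof.
move=> [BO _] Bb; have := BO _ _ Bb Bb; rewrite eqxx innerE => -[/eqP].
rewrite sqrf_eq1 => /orP[/eqP//|/eqP nb]; have := nm_ge0 b.
by rewrite nb; lra.
Qed.

Lemma orthonormal_basis_orth B b b' : orthonormal_basis B -> B b -> B b' ->
  b != b' -> inner b b' = 0.
Proof. by move=> [BO _] Bb Bb' bb'; rewrite BO// (negPf bb'). Qed.

(* The vectors that are close to their projection onto the first N vectors of
   the basis e stay separated under this projection, which is compact. *)
Lemma orthonormal_basis_countable B : orthonormal_basis B -> countable B.
Proof.
move=> BB; pose X N := B `&` [set b | nm (trunc e N b - b) < 1 / 4].
have -> : B = \bigcup_N X N.
  apply/seteqP; split=> [b Bb|b [N _ []]//].
  have r0 : 0 < 1 / 4 :> R by rewrite divr_gt0.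
  have [N /(_ N (leqnn N)) bN] := trunc_cvg eB b r0.
  by exists N.
apply: bigcup_countable => // N _; apply: finite_set_countable.
apply: (@separated_finite _ _ (trunc e N) _ (1 / 2)).
- move=> r r0; have [_ tb] := (compact_opE _).1 (compact_trunc eB N).
  have [s sP] := tb r r0; exists s => _ [b [Bb _] <-]; apply: sP.
  by rewrite (orthonormal_basis_nm BB Bb).
- by rewrite divr_gt0.
move=> b b' [Bb /= bN] [Bb' /= b'N] bb'.
have d : 1 <= nm (b - b').
  rewrite -(@ler_sqr _ 1) ?nnegrE ?nm_ge0// nm_sqrB (orthonormal_basis_orth BB)//.
  by rewrite !(orthonormal_basis_nm BB)//= expr1n mulr0 subr0; lra.
have := nm_triB (trunc e N b) b b'; have := nm_triB (trunc e N b') (trunc e N b) b'.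
rewrite [nm (b - trunc _ _ _)]nmBC; lra.
Qed.

Lemma basis_seq_orthonormal_basis : orthonormal_basis [set x | exists2 n, e n != 0 & e n = x].
Proof.
split=> [_ _ [m em <-] [n en <-]|x xe].
  rewrite eB.1; have [->|mn] /= := eqVneq m n; first by rewrite en eqxx.
  have [emn|//] := eqVneq (e m) (e n).
  have := eB.1 m n; rewrite (negPf mn) emn innerE (basis_nm eB) en expr1n => /eqP.
  by rewrite eq_complex/= oner_eq0.
apply: eB.2 => n; have [->|en] := eqVneq (e n) 0; first by rewrite inner0r.
by apply: xe; exists n.
Qed.

Lemma parseval (b : nat -> H) x : basis_seq b ->
  (\sum_(n <oo) (nm (inner x (b n)) ^+ 2)%:E = (nm x ^+ 2)%:E)%E.
Proof.
move=> bB; have I1 := diagP bB (fun=> 1).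
have [dom1 _ _] := diag_bounded bB I1 ler01 (fun i _ => ltac:(by rewrite normr1)).
have <- : complex.Re (inner (diag b (fun=> 1) x) x) = nm x ^+ 2.
  rewrite -Re_inner; congr (complex.Re (inner _ x)).
  by apply: (diag_ext bB I1) => // i; rewrite mul1r.
rewrite -(diag_form_series bB I1)//; apply: eq_eseriesr => n _.
by rewrite mul1r.
Qed.

(** The basis in [trace] is an arbitrary chosen one. Once enumerated as b, it gives the double
    series of t n |<b k, e n>|^2, which is interchanged by Tonelli and summed over k by Parseval. *)
Lemma trace_diag (t : nat -> R) (T : op H) : op_diag e t T ->
  (forall x, dom T x) -> (forall n, 0 <= t n) ->
  (trace T = \sum_(n <oo) (t n * (e n != 0)%:R)%:E)%E.
Proof.
move=> tT Tdom t0; rewrite /trace.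
have : exists B : set H, [set B | orthonormal_basis B] B.
  by exists [set x | exists2 n, e n != 0 & e n = x]; exact: basis_seq_orthonormal_basis.
move=> /(xgetPex set0); set B := xget _ _ => BB.
have [b bB benum] := basis_enumeration (orthonormal_basis_countable BB)
  (fun x => orthonormal_basis_nm BB) (fun x y => orthonormal_basis_orth BB) BB.2.
have TE x : (complex.Re (inner (T x) x))%:E =
    (\sum_(n <oo) (t n * nm (inner x (e n)) ^+ 2)%:E)%E.
  by rewrite (diag_form_series eB tT).
have T0 x : (0 <= (complex.Re (inner (T x) x))%:E)%E.
  rewrite TE; apply: nneseries_ge0 => n _ _.
  by rewrite lee_fin mulr_ge0 ?sqr_ge0.
have [bE Bb binj] := benum.
rewrite (reindex_esum [set n | b n != 0] B b); last first.
  split.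
  - by move=> n /= /bE.
  - by move=> m n; rewrite !inE/= => bm _ /(binj m n bm).
  - move=> x Bx; have [n bn] := Bb x Bx; exists n => //=.
    apply/eqP => b0; have := orthonormal_basis_nm BB Bx; rewrite -bn b0 nm0 => /eqP.
    by rewrite eq_sym oner_eq0.
rewrite -(@nneseries_esum _ _ (fun n => b n != 0)); last by move=> n _; exact: T0.
transitivity (\sum_(n <oo) (complex.Re (inner (T (b n)) (b n)))%:E)%E.
  rewrite eseries_mkcond; apply: eq_eseriesr => n _.
  by have [->|] := eqVneq (b n) 0; rewrite ?inner0r.
under eq_eseriesr do rewrite TE.
rewrite (nneseries_interchange xpredT xpredT); last first.
  by move=> i j; rewrite lee_fin mulr_ge0 ?sqr_ge0.
apply: eq_eseriesr => n _.
under eq_eseriesr do rewrite EFinM.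
rewrite nneseriesZl; last by move=> i _; rewrite lee_fin sqr_ge0.
under eq_eseriesr do rewrite innerC nm_conj.
by rewrite parseval// -EFinM (basis_nm eB); case: (e n != 0); rewrite ?expr1n ?expr0n.
Qed.

End Trace.

Section Summability.
Context {R : realType} {H : hilbert R}.
Local Notation C := R[i].
Implicit Types (x y z : H).
Variables (e : nat -> H) (l : nat -> R) (D : op H).
Hypotheses (eB : basis_seq e) (DP : op_diag e l D).

Lemma trace_fcalc_finite (m : nat -> R) (T : op H) (f : R -> R) (M : R) :
  op_diag e m T -> (forall t, 0 <= f t) -> (forall n, e n != 0 -> f (m n) <= M) ->
  ((trace (fcalc T f) < +oo)%E <-> summable_seq (fun n => f (m n) * (e n != 0)%:R)).
Proof.
move=> mT f0 fM; have fT := fcalc_diag eB mT f.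
have fM' n : e n != 0 -> `|(f \o m) n| <= Num.max M 0.
  by move=> en; rewrite ger0_norm//= le_max fM.
have M0 : 0 <= Num.max M 0 by rewrite le_max lexx orbT.
have [fdom _ _] := diag_bounded eB fT M0 fM'.
rewrite (trace_diag eB fT)//; last by move=> n; exact: f0.
exact: (@nneseries_summable _ (fun n => f (m n) * (e n != 0)%:R)
  (fun n => mulr_ge0 (f0 _) (ler0n _ _))).
Qed.

Lemma resolvent_hat (S : H -> H) x n : is_resolvent D (- 'i%C) S ->
  inner (S x) (e n) = ((l n)%:C + 'i)%C^-1 * inner x (e n).
Proof.
move=> [_ /(_ x)[SD DS] _].
rewrite -{2}DS innerBl DP.2// innerZl -mulrBl opprK mulKf//.
by rewrite eq_complex/= addr0 add0r oner_eq0 andbF.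
Qed.

Lemma resolvent_square_diag (S T : H -> H) : is_resolvent D (- 'i%C) S ->
  is_adjoint S T -> op_diag e (fun n => (l n ^+ 2 + 1)^-1) (Op setT (T \o S)).
Proof.
move=> resS ST.
have hat x n : inner ((T \o S) x) (e n) = ((l n ^+ 2 + 1)^-1)%:C%C * inner x (e n).
  rewrite /= (adjoint_sym ST) [LHS]innerC.
  have -> : inner (S (e n)) (S x) = ((l n)%:C + 'i)%C^-1 * inner (e n) (S x).
    have Se : S (e n) = ((l n)%:C + 'i)%C^-1 *: e n.
      apply: (basis_ext eB) => k; rewrite (resolvent_hat _ _ resS) innerZl.
      by have [->//|kn] := eqVneq k n; rewrite (basis_orth eB) ?mulr0// eq_sym.
    by rewrite Se innerZl.
  rewrite rmorphM/= -innerC (resolvent_hat _ _ resS) mulrA.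
  by rewrite [X in X * _]mulrC nm_sqr nm_resolvent_sqr.
split=> [x|x _ n]; last exact: hat.
split=> // _; exists (nm ((T \o S) x) ^+ 2) => N; apply: le_trans (bessel eB N _).
by under eq_bigr do rewrite -nm_diag_hat -hat.
Qed.

Lemma finitely_summableE : compact_resolvent D ->
  finitely_summable D <-> exists2 p : R, 0 < p &
    summable_seq (fun n => Num.sqrt (l n ^+ 2 + 1)^-1 `^ p * (e n != 0)%:R).
Proof.
have sq (S T : H -> H) (p : R) : is_resolvent D (- 'i%C) S -> is_adjoint S T -> 0 < p ->
    (trace (fcalc (Op setT (T \o S)) (fun t : R => (Num.sqrt t `^ p)%R)) < +oo)%E <->
    summable_seq (fun n => Num.sqrt (l n ^+ 2 + 1)^-1 `^ p * (e n != 0)%:R).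
  move=> resS ST p0.
  apply: (trace_fcalc_finite (M := 1) (resolvent_square_diag resS ST)).
    by move=> t; exact: powR_ge0.
  move=> n _; apply: (@le_trans _ _ (1 `^ p)); last by rewrite powR1.
  rewrite ge0_ler_powR ?nnegrE ?sqrtr_ge0 ?(ltW p0)//.
  rewrite -[leRHS]sqrtr1 ler_sqrt// invf_le1 ?lerDr ?sqr_ge0//.
  by rewrite ltr_wpDl ?sqr_ge0.
move=> [S0 resS0 _]; split=> [[p p0 [S resS [bS [T ST trT]]]]|[p p0 sp]].
  by exists p => //; apply/(sq S T).
have [bS _ _] := resS0; have [T ST] := adjoint_exists bS.
exists p => //; exists S0 => //; split=> //; exists T => //.
by apply/(sq S0 T).
Qed.

Lemma Li1_summableE (m : nat -> R) (T : op H) : op_diag e m T ->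
  Li1_summable T <-> exists s0 : R, forall s, 0 < s -> s0 <= s ->
    summable_seq (fun n => expR (- s * `|m n|) * (e n != 0)%:R).
Proof.
move=> mT; have tr s : 0 < s -> (trace (fcalc T (fun t : R => expR (- s * `|t|)%R)) < +oo)%E <->
    summable_seq (fun n => expR (- s * `|m n|) * (e n != 0)%:R).
  move=> s0; apply: (trace_fcalc_finite (M := 1) mT) => [t|n _]; first exact: expR_ge0.
  by rewrite -expR0 ler_expR mulNr oppr_le0 mulr_ge0// ltW.
by split=> -[s0 s0P]; exists s0 => s sp /(s0P s sp)/(tr s sp).
Qed.

(* (1 + t^2)^(-p/2) and (1 + |t|)^(-p) agree up to a factor 2^(p/2). *)
Lemma resolvent_power (t p : R) : Num.sqrt (t ^+ 2 + 1)^-1 `^ p =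
  expR (- (p / 2) * ln (t ^+ 2 + 1)).
Proof.
have t0 : 0 < t ^+ 2 + 1 by rewrite ltr_wpDl ?sqr_ge0.
have s0 : 0 < Num.sqrt (t ^+ 2 + 1)^-1 by rewrite sqrtr_gt0 invr_gt0.
rewrite /powR gt_eqF//; congr expR.
have : ln (t ^+ 2 + 1)^-1 = ln (Num.sqrt (t ^+ 2 + 1)^-1) *+ 2.
  by rewrite -lnXn// sqr_sqrtr ?invr_ge0 ?(ltW t0).
rewrite lnV ?posrE// mulr2n => lnE.
have -> : ln (Num.sqrt (t ^+ 2 + 1)^-1) = - ln (t ^+ 2 + 1) / 2 by lra.
by field.
Qed.

Lemma sgnlog_norm (t : R) : `|sgnlog t| = ln (1 + `|t|).
Proof.
rewrite /sgnlog normrM normr_sg (ger0_norm (x := ln _)) ?ln_ge0 ?lerDl//.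
by have [->|t0] := eqVneq t 0; rewrite ?mul1r// normr0 addr0 ln1 mulr0.
Qed.

Lemma ln_sqr_le (t : R) : ln (t ^+ 2 + 1) <= 2 * ln (1 + `|t|).
Proof.
have p : 0 < 1 + `|t| by rewrite ltr_pwDl.
have -> : 2 * ln (1 + `|t|) = ln ((1 + `|t|) ^+ 2) by rewrite lnXn// mulr_natl.
rewrite ler_ln ?posrE ?exprn_gt0//; last by rewrite ltr_wpDl ?sqr_ge0.
rewrite -(real_normK (num_real t)); have := normr_ge0 t; lra.
Qed.

Lemma ln_sqr_ge (t : R) : 2 * ln (1 + `|t|) <= ln 2 + ln (t ^+ 2 + 1).
Proof.
have p : 0 < 1 + `|t| by rewrite ltr_pwDl.
have t0 : 0 < t ^+ 2 + 1 by rewrite ltr_wpDl ?sqr_ge0.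
have -> : 2 * ln (1 + `|t|) = ln ((1 + `|t|) ^+ 2) by rewrite lnXn// mulr_natl.
rewrite -lnM ?posrE// ler_ln ?posrE ?exprn_gt0 ?mulr_gt0//.
have := sqr_ge0 (`|t| - 1); rewrite -(real_normK (num_real t)); lra.
Qed.

Lemma summability_equiv (T : op H) : compact_resolvent D ->
  op_diag e (fun n => sgnlog (l n)) T ->
  finitely_summable D <-> Li1_summable T.
Proof.
move=> cD TP; rewrite finitely_summableE// (Li1_summableE TP); split.
  move=> [p p0 sp]; exists p => s s0 ps.
  apply: summable_le sp => n; rewrite ler_wpM2r//.
  rewrite resolvent_power sgnlog_norm ler_expR !mulNr lerN2.
  have := ln_sqr_le (l n).
  have : 0 <= ln (1 + `|l n|) by rewrite ln_ge0 ?lerDl.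
  move: (ln _) (ln _) => u v; nra.
(* The exponent p = s has to be positive as well as at least s0; the comparison then costs the
   factor exp (s / 2 ln 2) = 2^(s/2). *)
move=> [s0 sP]; pose s := Num.max 1 s0.
have s1 : 0 < s by rewrite lt_max ltr01.
have ss : s0 <= s by rewrite le_max lexx orbT.
exists s => //.
apply: summable_le (summableZ (expR_ge0 (s / 2 * ln 2)) (sP s s1 ss)) => n.
rewrite mulrA ler_wpM2r// resolvent_power sgnlog_norm -expRD ler_expR.
have := ln_sqr_ge (l n).
move: (ln (1 + _)) (ln (_ + 1)) (ln 2) => u v w; nra.
Qed.

End Summability.

(** * Normalising functions and the proof of the theorem *)

Section SgnLog.
Context {R : realType}.

Lemma sgnlogN (t : R) : sgnlog (- t) = - sgnlog t.
Proof. by rewrite /sgnlog sgrN normrN mulNr. Qed.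

(** D and D_log thus have the same sign operator F, the common reference for both bounded
    transforms. *)
Lemma sg_sgnlog (t : R) : Num.sg (sgnlog t) = Num.sg t.
Proof.
rewrite /sgnlog sgrM sgr_id; have [->|t0] := eqVneq t 0; first by rewrite sgr0 mul0r.
by rewrite [Num.sg (ln _)]gtr0_sg ?mulr1// ln_gt0// ltrDl normr_gt0.
Qed.

Lemma sgnlog_infty (l : nat -> R) :
  (forall M : R, exists N, forall n, (N <= n)%N -> M < `|l n|) ->
  forall M : R, exists N, forall n, (N <= n)%N -> M < `|sgnlog (l n)|.
Proof.
move=> l_oo M; have [N lN] := l_oo (expR M); exists N => n /lN ln.
have p : 0 < 1 + `|l n| by rewrite ltr_pwDl.
rewrite sgnlog_norm -(expRK M) ltr_ln ?posrE ?expR_gt0//.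
by apply: lt_le_trans ln _; rewrite lerDr.
Qed.

(** Oddness carries the limit at +oo over to the negative eigenvalues. *)
Lemma normalising_null {H : hilbert R} (D : op H) (chi : R -> R) (l : nat -> R) :
  normalising D chi ->
  (forall M : R, exists N, forall n, (N <= n)%N -> M < `|l n|) ->
  null_seq (fun n => chi (l n) - Num.sg (l n)).
Proof.
move=> [_ chiN chi1 _] l_oo r r0.
have [M [_ MP]] := (cvgrPdist_lt _ _).1 chi1 r r0.
have [N lN] := l_oo (Num.max M 0); exists N => n /lN.
rewrite gt_max => /andP[Ml l0].
have chir t : M < t -> 0 < t -> `|chi t - Num.sg t| < r.
  by move=> Mt t0; rewrite gtr0_sg// distrC; exact: MP.
have [ln|ln] := ltP 0 (l n); first by apply: chir => //; rewrite -(gtr0_norm ln).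
have := chir `|l n| Ml l0.
by rewrite (ler0_norm ln) chiN sgrN -opprD normrN.
Qed.

End SgnLog.

Theorem theorem1 (R : realType) (H : hilbert R) (A : set (H -> H)) (D : op H)
    (Doms : set (H -> H)) (sigma : (H -> H) -> (H -> H))
    (g : option (H -> H)) :
  weakly_twisted_spectral_triple A D Doms sigma g ->
  lipschitz_regular A D sigma ->
  compact_resolvent D ->
  let Dlog := fcalc D sgnlog in
  [/\ self_adjoint Dlog,
      spectral_triple A Dlog g,
      same_K_homology_class A D Dlog g &
      finitely_summable D <-> Li1_summable Dlog].
Proof.
move=> [Aalg saD [_ s_bd _ _ _] ADoms A_dom A_comm _ A_grading] lip cD Dlog.
have [e [l [eB DP l_oo]]] := eigen_sequence saD cD.
have DlogP : op_diag e (sgnlog \o l) Dlog := fcalc_diag eB DP sgnlog.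
have absP := fcalc_diag eB DP (fun t => `|t|).
have [A_bd _ _ _ A_adj] := Aalg.
have commP a : A a -> (forall x, dom Dlog x -> dom Dlog (a x)) /\
    bounded_twisted_commutator Dlog a a.
  move=> Aa; have [b Ab ab] := A_adj a Aa.
  apply: (sgnlog_commutator eB DP absP DlogP ab (s := sigma a) (s' := sigma b)).
  - exact: A_bd.
  - exact: A_bd.
  - exact/s_bd/ADoms.
  - exact/s_bd/ADoms.
  - by move=> x; exact: A_dom.
  - by move=> x; exact: A_dom.
  - exact: A_comm.
  - exact: lip.
  - exact: lip.
have llog_oo := sgnlog_infty l_oo.
split.
- exact: (diag_self_adjoint eB DlogP).
- split=> //.
  + exact: (diag_self_adjoint eB DlogP).
  (* For the trivial twist, regularity asks that the given adjoint lies in A; A contains an adjoint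
     of a, and adjoints are unique. *)
  + split=> //; split=> // a b Aa ab; exists b; split=> //.
    by have [b' Ab' ab'] := A_adj a Aa; rewrite (adjoint_unique ab ab').
  + by move=> a x Aa; have [+ _] := commP a Aa; exact.
  + by move=> a Aa; have [] := commP a Aa.
  + move=> a Aa; apply: compact_op_compl; first exact: A_bd.
    apply: (compact_diag eB (fcalc_diag eB DlogP _)) => r r0.
    (* (1 + x^2)^(-1/2) is at most 1 / |x|, so eigenvalues of D_log beyond 1 / r suffice. *)
    have [N lN] := llog_oo r^-1; exists N => n /lN ln /=.
    have p : 0 < 1 + sgnlog (l n) ^+ 2 by rewrite ltr_pwDl ?sqr_ge0.
    have sp : 0 < Num.sqrt (1 + sgnlog (l n) ^+ 2) by rewrite sqrtr_gt0.
    rewrite ger0_norm ?invr_ge0 ?(ltW sp)// -[ltRHS]invrK ltf_pV2 ?posrE ?invr_gt0//.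
    apply: lt_le_trans ln _; rewrite -sqrtr_sqr; apply: ler_wsqrtr.
    by rewrite lerDr.
  + case: g A_grading => // gamma gP; have [bg gg g2 gA _] := gP.
    split=> // x xD; exact: (grading_anticommute eB DP DlogP sgnlogN gP xD).
- move=> chi chi' chiP chi'P.
  (* chi'(D_log) is the function chi' o sgnlog of D, so both bounded transforms are functions of D
     and the straight line stays within such functions. *)
  apply: (same_K_class_diag eB DP absP l_oo A_bd A_dom A_comm lip A_grading
    (f0 := chi) (f1 := chi' \o sgnlog)).
  + by case: chiP.
  + by move=> t /=; rewrite sgnlogN; case: chi'P => _ ->.
  + exact: fcalc_diag.
  + exact: (fcalc_diag eB DlogP chi').
  + exact: normalising_null chiP l_oo.
  + move=> r r0; have [N NP] := normalising_null chi'P llog_oo r0.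
    by exists N => n /NP; rewrite sg_sgnlog.
- exact: (summability_equiv eB DP cD DlogP).
Qed.
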